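(* Let $S$ be a complex manifold of dimension $n$ and let $D\subseteq S$ be a divisor that is defined locally at a point $p$ by $\{gh=0\}$, where $g,h\in\mathcal{O}_{S,p}$ are reduced non-units (not necessarily irreducible) with no common factor. Put $(D_1,p)=\{g=0\}$ and $(D_2,p)=\{h=0\}$. (1) If $J_{gh}=gJ_h+hJ_g$, then $D=D_1\cup D_2$ is splayed at $p$. (2) Conversely, if $D=D_1\cup D_2$ is splayed at $p$ and $g,h$ are chosen in different variables (i.e. there are coordinates $(x_1,\dots,x_n)$ at $p$ and $1\le k\le n-1$ such that $g$ depends only on $x_1,\dots,x_k$ and $h$ depends only on $x_{k+1},\dots,x_n$), then $J_{gh}=gJ_h+hJ_g$. Consequently, $D=D_1\cup D_2$ is splayed at $p$ if and only if, after possibly multiplying $g$ and $h$ by units of $\mathcal{O}_{S,p}$, the equality $J_{gh}=gJ_h+hJ_g$ holds.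
   Context: Work in the complex analytic category. $\mathcal{O}_{S,p}\cong\mathbb{C}\{x_1,\dots,x_n\}$ is the local ring of germs of holomorphic functions at $p$, with $(x_1,\dots,x_n)$ complex coordinates of $S$ at $p$. A divisor is a hypersurface; its local defining equations are always taken reduced (square-free). For $f\in\mathcal{O}_{S,p}$, the Jacobian ideal is $J_f=(\partial_{x_1}f,\dots,\partial_{x_n}f)\subseteq\mathcal{O}_{S,p}$. Splayed: $(D,p)=(D_1,p)\cup(D_2,p)$ is splayed at $p$ (with splayed components $D_1,D_2$) if there exist complex coordinates $(x_1,\dots,x_n)$ at $p$ and an integer $1\le k\le n-1$ such that $D$ is defined by $h_1(x_1,\dots,x_k)\,h_2(x_{k+1},\dots,x_n)$, where $h_i$ is a reduced defining equation of $D_i$ at $p$ ($i=1,2$; the $h_i$ need not be irreducible). *)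

(* Defs.v *)
From mathcomp Require Import all_boot all_order all_algebra.
From mathcomp Require Import complex.
From mathcomp Require Import all_classical all_reals all_analysis.

Set Implicit Arguments.
Unset Strict Implicit.
Unset Printing Implicit Defensive.

Import Order.TTheory GRing.Theory Num.Theory.
Import numFieldNormedType.Exports.

Local Open Scope classical_set_scope.
Local Open Scope ring_scope.
Local Open Scope complex_scope.

(* R[i], typed as a numClosedFieldType so that the topology and the norm that
   MathComp-Analysis puts on any such field are inferred on it and on row
   vectors over it. *)
Definition Cplx (R : realType) : numClosedFieldType := R[i].

(** * Holomorphic functions on C^n *)

(* [f] is, on the open polydisc of polyradius (r, ..., r) around [a], the sum
   of a power series that converges absolutely at polyradius (r, ..., r).
   Multi-indices are finite functions; partial sums run over the boxes
   [0, N)^n.  In [Cplx R], [0 < r] forces [r] to be real. *)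
Definition analytic_at (R : realType) (n : nat)
    (f : 'rV[Cplx R]_n -> Cplx R) (a : 'rV[Cplx R]_n) : Prop :=
  exists (c : {ffun 'I_n -> nat} -> Cplx R) (r M : Cplx R),
    [/\ 0 < r,
        forall N : nat,
          \sum_(m : {ffun 'I_n -> 'I_N})
             `|c [ffun i => m i : nat]| * \prod_i r ^+ m i <= M
      & forall z : 'rV[Cplx R]_n,
          (forall i, `|z ord0 i - a ord0 i| < r) ->
          (fun N : nat => \sum_(m : {ffun 'I_n -> 'I_N})
             c [ffun i => m i : nat] *
             \prod_i (z ord0 i - a ord0 i) ^+ m i) @ \oo --> f z].

Definition holomorphic_map_on (R : realType) (n : nat)
    (U : set 'rV[Cplx R]_n) (F : 'rV[Cplx R]_n -> 'rV[Cplx R]_n) : Prop :=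
  forall z, U z -> forall i, analytic_at (fun w => F w ord0 i) z.

(** * Complex manifolds *)

(* Only the values of [cmap] on [cdom] and of [cinv] on the image of [cdom]
   are meaningful. *)
Record chart (R : realType) (n : nat) (T : topologicalType) := Chart {
  cdom : set T;
  cmap : T -> 'rV[Cplx R]_n;
  cinv : 'rV[Cplx R]_n -> T }.

Definition is_chart (R : realType) (n : nat) (T : topologicalType)
    (c : chart R n T) : Prop :=
  [/\ open (cdom c), open (cmap c @` cdom c),
      forall q, cdom c q -> cinv c (cmap c q) = q,
      {within cdom c, continuous (cmap c)}
    & {within cmap c @` cdom c, continuous (cinv c)}].

Definition compatible (R : realType) (n : nat) (T : topologicalType)
    (c d : chart R n T) : Prop :=
  holomorphic_map_on (cmap c @` (cdom c `&` cdom d)) (cmap d \o cinv c) /\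
  holomorphic_map_on (cmap d @` (cdom c `&` cdom d)) (cmap c \o cinv d).

Record complexManifold (R : realType) (n : nat) := ComplexManifold {
  mspace :> topologicalType;
  atlas : set (chart R n mspace);
  _ : hausdorff_space mspace;
  _ : forall c, atlas c -> is_chart c;
  _ : forall q : mspace, exists2 c, atlas c & cdom c q;
  _ : forall c d, atlas c -> atlas d -> compatible c d }.

(* Complex coordinates (x_1, ..., x_n) at p: a chart of the maximal atlas,
   centred at p. *)
Definition coordinates_at (R : realType) (n : nat) (S : complexManifold R n)
    (p : S) (x : chart R n S) : Prop :=
  [/\ is_chart x, forall c, atlas c -> compatible c x,
      cdom x p & cmap x p = 0].

(** * The local ring O_{S,p} *)

(* A germ at p is given by a function on S, of which only the values near p
   matter; equality in O_{S,p} is [germ_eq p]. *)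
Definition holomorphic_at (R : realType) (n : nat) (S : complexManifold R n)
    (p : S) (f : S -> Cplx R) : Prop :=
  exists c : chart R n S,
    [/\ atlas c, cdom c p & analytic_at (f \o cinv c) (cmap c p)].

Definition germ_eq (R : realType) (n : nat) (S : complexManifold R n)
    (p : S) (f g : S -> Cplx R) : Prop :=
  \forall q \near p, f q = g q.

Definition germ_unit (R : realType) (n : nat) (S : complexManifold R n)
    (p : S) (f : S -> Cplx R) : Prop :=
  holomorphic_at p f /\
  exists2 v, holomorphic_at p v & germ_eq p (f \* v) (fun=> 1).

Definition germ_dvd (R : realType) (n : nat) (S : complexManifold R n)
    (p : S) (a f : S -> Cplx R) : Prop :=
  exists2 b, holomorphic_at p b & germ_eq p f (a \* b).

(* Square-free; the zero germ is excluded, since 0 * 0 divides it. *)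
Definition germ_reduced (R : realType) (n : nat) (S : complexManifold R n)
    (p : S) (f : S -> Cplx R) : Prop :=
  forall a, holomorphic_at p a -> germ_dvd p (a \* a) f -> germ_unit p a.

Definition no_common_factor (R : realType) (n : nat) (S : complexManifold R n)
    (p : S) (f g : S -> Cplx R) : Prop :=
  forall a, holomorphic_at p a ->
    germ_dvd p a f -> germ_dvd p a g -> germ_unit p a.

(* Ideals of O_{S,p} are sets of representatives, saturated for
   [germ_eq p]. *)
Definition ideal_gen (R : realType) (n : nat) (S : complexManifold R n)
    (p : S) (m : nat) (F : 'I_m -> S -> Cplx R) : set (S -> Cplx R) :=
  [set u | exists2 a : 'I_m -> S -> Cplx R,
     forall i, holomorphic_at p (a i)
     & germ_eq p u (fun q => \sum_i a i q * F i q)].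

Definition ideal_scale (R : realType) (n : nat) (S : complexManifold R n)
    (p : S) (f : S -> Cplx R) (I : set (S -> Cplx R)) : set (S -> Cplx R) :=
  [set u | exists2 v, I v & germ_eq p u (f \* v)].

Definition ideal_add (R : realType) (n : nat) (S : complexManifold R n)
    (p : S) (I J : set (S -> Cplx R)) : set (S -> Cplx R) :=
  [set u | exists v w, [/\ I v, J w & germ_eq p u (v \+ w)]].

Definition partial_derivative (R : realType) (n : nat)
    (S : complexManifold R n) (x : chart R n S) (i : 'I_n)
    (f : S -> Cplx R) : S -> Cplx R :=
  fun q => 'D_('e_i) (f \o cinv x) (cmap x q).

Definition jacobian_ideal (R : realType) (n : nat) (S : complexManifold R n)
    (p : S) (x : chart R n S) (f : S -> Cplx R) : set (S -> Cplx R) :=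
  ideal_gen p (fun i : 'I_n => partial_derivative x i f).

(* J_{gh} = g J_h + h J_g *)
Definition jacobian_leibniz (R : realType) (n : nat) (S : complexManifold R n)
    (p : S) (x : chart R n S) (g h : S -> Cplx R) : Prop :=
  jacobian_ideal p x (g \* h) =
  ideal_add p (ideal_scale p g (jacobian_ideal p x h))
              (ideal_scale p h (jacobian_ideal p x g)).

(** * Divisors and splayedness *)

Definition reduced_equation (R : realType) (n : nat) (S : complexManifold R n)
    (p : S) (f : S -> Cplx R) (D : set S) : Prop :=
  [/\ holomorphic_at p f, germ_reduced p f
    & \forall q \near p, D q <-> f q = 0].

Definition is_divisor (R : realType) (n : nat) (S : complexManifold R n)
    (D : set S) : Prop :=
  closed D /\ forall q, D q -> exists f, reduced_equation q f D.

(* Near p, the value of [f] is determined by the coordinates x_i, i in P. *)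
Definition depends_only_on (R : realType) (n : nat) (S : complexManifold R n)
    (p : S) (x : chart R n S) (P : pred 'I_n) (f : S -> Cplx R) : Prop :=
  \forall q \near p & q' \near p,
    (forall i, P i -> cmap x q ord0 i = cmap x q' ord0 i) -> f q = f q'.

(* g = g(x_1, ..., x_k) and h = h(x_{k+1}, ..., x_n); coordinates are indexed
   from 0 in 'I_n. *)
Definition separate_variables (R : realType) (n : nat) (S : complexManifold R n)
    (p : S) (x : chart R n S) (k : nat) (g h : S -> Cplx R) : Prop :=
  depends_only_on p x (fun i => (i < k)%N) g /\
  depends_only_on p x (fun i => (k <= i)%N) h.

Definition splayed (R : realType) (n : nat) (S : complexManifold R n)
    (p : S) (D D1 D2 : set S) : Prop :=
  (\forall q \near p, D q <-> (D1 `|` D2) q) /\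
  exists (x : chart R n S) (k : nat) (h1 h2 : S -> Cplx R),
    [/\ coordinates_at p x,
        (1 <= k <= n.-1)%N,
        separate_variables p x k h1 h2,
        reduced_equation p h1 D1 /\ reduced_equation p h2 D2
      & reduced_equation p (h1 \* h2) D].

(* Main.v *)
Require Import Defs.
From HB Require Import structures.
From mathcomp Require Import all_boot all_order all_algebra all_field.
From mathcomp Require Import complex.
From mathcomp Require Import all_classical all_reals all_analysis.
From mathcomp Require Import ring lra zify.
Set Implicit Arguments.
Unset Strict Implicit.
Unset Printing Implicit Defensive.
Import Order.TTheory GRing.Theory Num.Theory.
Import numFieldNormedType.Exports.
Local Open Scope classical_set_scope.
Local Open Scope ring_scope.

(* If J_gh = g J_h + h J_g, every coordinate field d_k splits as the sum of
   delta_k = \sum_i a_i d_i, where g d_k h = \sum_i a_i d_i (g h), and of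
   d_k - delta_k.  Comparing the two sides, h divides g (d_k - delta_k) h and g
   divides h delta_k g, so delta_k is logarithmic for g and d_k - delta_k for h.
   A logarithmic field of g not vanishing at p can be straightened to a
   coordinate field along which a unit multiple of g is constant; iterating, a
   unit multiple of g becomes a function of coordinates whose differentials at
   p are killed by all logarithmic fields of g, and likewise for h.  As the
   d_k span the tangent space, the two families of differentials are linearly
   independent and extend together to coordinates splaying D.  The converse is
   the chain rule, and reduced equations of one hypersurface differ by a unit.

   The divisibility facts about germs rest on the following form of the
   Nullstellensatz: if h is reduced and coprime to g, and g F vanishes on
   h = 0, then h divides F.  After Weierstrass preparation h is a polynomial
   whose discriminant, and whose resultant with g, are not zero: at a generic
   point its roots are simple and g does not vanish there, so the remainder of
   F modulo h is zero. *)

(** * Moduli and limits in C *)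

(** Unique factorization in the local ring is bypassed. A factor of a Weierstrass polynomial is made
    monic by bounding its roots, together with the fact that a quotient of germs which stays bounded
    is again a germ; this replaces Gauss's lemma over a factorial ring. Flows are bypassed as well:
    a field is straightened by solving linear equations with an explicit exponential series, whose
    convergence follows from Cauchy estimates spread evenly over a shrinking polydisc. The norm
    throughout is the sum of the moduli of all terms on a polydisc, not a supremum: it is
    submultiplicative, bounds derivatives without integrals, and gains a factor for each degree when
    the polydisc shrinks. The Jacobian equality may change when [g] and [h] are multiplied by units,
    whereas the hypersurfaces do not. Straightening yields only unit multiples of [g] and [h], which
    is harmless for splayedness; this is why units appear in the last claim. *)

Section Norm.
Variable R : realType.
Notation C := (Cplx R).

(** The norm of [Cplx R] has values in the complex numbers themselves; its real part moves all
    estimates into the ordered field [R]. *)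
Definition nm (z : C) : R := complex.Re (`|z| : R[i]).

Definition RC (x : R) : C := real_complex R x.

Lemma nmE (z : C) : `|z| = RC (nm z).
Proof. by rewrite /nm /RC RRe_real // ger0_real. Qed.

Lemma RC_le x y : (RC x <= RC y) = (x <= y). Proof. exact: lecR. Qed.
Lemma RC_lt x y : (RC x < RC y) = (x < y). Proof. exact: ltcR. Qed.
Lemma RC_inj : injective RC. Proof. exact: complexI. Qed.

Lemma RC_zmod : zmod_morphism RC. Proof. exact: (raddfB (real_complex R)). Qed.
Lemma RC_monoid : monoid_morphism RC.
Proof. by split; [exact: (rmorph1 (real_complex R))|exact: (rmorphM (real_complex R))]. Qed.
HB.instance Definition _ := GRing.isZmodMorphism.Build R C RC RC_zmod.
HB.instance Definition _ := GRing.isMonoidMorphism.Build R C RC RC_monoid.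

Lemma RC_gt0 x : (0 < RC x) = (0 < x).
Proof. by rewrite -RC_lt rmorph0. Qed.

Lemma pos_RC (e : C) : 0 < e -> exists2 x : R, 0 < x & e = RC x.
Proof.
move=> e0; exists (nm e); last by rewrite -nmE gtr0_norm.
by rewrite -RC_gt0 -nmE gtr0_norm.
Qed.

Lemma nm_ge0 z : 0 <= nm z.
Proof. by rewrite -RC_le rmorph0 -nmE. Qed.
Lemma nm0 : nm 0 = 0.
Proof. by apply: RC_inj; rewrite -nmE normr0 rmorph0. Qed.
Lemma nm1 : nm 1 = 1.
Proof. by apply: RC_inj; rewrite -nmE normr1 rmorph1. Qed.
Lemma nm_eq0 z : (nm z == 0) = (z == 0).
Proof. by rewrite -(inj_eq RC_inj) -nmE rmorph0 normr_eq0. Qed.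
Lemma nm_gt0 z : (0 < nm z) = (z != 0).
Proof. by rewrite lt_def nm_ge0 andbT nm_eq0. Qed.
Lemma nmM x y : nm (x * y) = nm x * nm y.
Proof. by apply: RC_inj; rewrite rmorphM -!nmE normrM. Qed.
Lemma nmN x : nm (- x) = nm x.
Proof. by apply: RC_inj; rewrite -!nmE normrN. Qed.
Lemma nmD x y : nm (x + y) <= nm x + nm y.
Proof. by rewrite -RC_le rmorphD -!nmE ler_normD. Qed.
Lemma nmB x y : nm (x - y) <= nm x + nm y.
Proof. by rewrite -(nmN y) nmD. Qed.
Lemma nm_sub x y : nm (x - y) = nm (y - x).
Proof. by rewrite -nmN opprB. Qed.
Lemma nm_lowB x y : nm x - nm y <= nm (x - y).
Proof. by have := nmD (x - y) y; rewrite subrK; lra. Qed.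
Lemma nmV x : nm (x^-1) = (nm x)^-1.
Proof. by apply: RC_inj; rewrite fmorphV -!nmE normfV. Qed.
Lemma nmX x k : nm (x ^+ k) = nm x ^+ k.
Proof. by apply: RC_inj; rewrite rmorphXn -!nmE normrX. Qed.
Lemma nm_RC x : nm (RC x) = `|x|.
Proof. 
apply: RC_inj; rewrite -nmE.
have [hx|hx] := boolP (0 <= x).
  by rewrite (ger0_norm hx) ger0_norm // -(rmorph0 RC) RC_le.
rewrite -ltNge in hx; rewrite (ltr0_norm hx) rmorphN ltr0_norm //.
by rewrite -(rmorph0 RC) RC_lt.
Qed.
Lemma nm_nat k : nm (k%:R) = k%:R.
Proof. by rewrite -(rmorph_nat RC) nm_RC normr_nat. Qed.
Lemma nm_sum (I : Type) (s : seq I) (P : pred I) (F : I -> C) :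
  nm (\sum_(i <- s | P i) F i) <= \sum_(i <- s | P i) nm (F i).
Proof.
elim/big_rec2: _ => [|i x y _ h]; first by rewrite nm0.
by apply: le_trans (nmD _ _) _; rewrite lerD2l.
Qed.
Lemma nm_prod (I : Type) (s : seq I) (F : I -> C) :
  nm (\prod_(i <- s) F i) = \prod_(i <- s) nm (F i).
Proof. by rewrite (big_morph nm nmM nm1). Qed.

Lemma nm_le_eps z : (forall e, 0 < e -> nm z <= e) -> z = 0.
Proof.
move=> h; apply/eqP; rewrite -nm_eq0 eq_le nm_ge0 andbT.
apply/ler_addgt0Pl => e e0; rewrite addr0; exact: h.
Qed.

(** Convergence with nonstrict real bounds, the form in which the series estimates deliver it; [cvP]
    links it to the topology. *)
Definition cv (u : nat -> C) (l : C) : Prop :=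
  forall e : R, 0 < e -> exists N, forall k, (N <= k)%N -> nm (u k - l) <= e.

Lemma cvP (u : nat -> C) (l : C) : (u @ \oo --> l) <-> cv u l.
Proof.
split=> [/cvgrPdist_le h e e0|h].
  have /h : 0 < RC e by rewrite RC_gt0.
  case=> N _ hN; exists N => k hk; have := hN k hk; rewrite /= nmE RC_le.
  by rewrite nm_sub.
apply/cvgrPdist_le => _ /pos_RC[e e0 ->]; have [N hN] := h _ e0.
by exists N => // k /= hk; rewrite nmE RC_le nm_sub; exact: hN.
Qed.

Lemma cv_nm_le (u : nat -> C) (l : C) M :
  cv u l -> (forall N, nm (u N) <= M) -> nm l <= M.
Proof.
move=> h hM; apply/ler_addgt0Pl => e e0; have [N hN] := h e e0.
have := hN N (leqnn _); have := hM N; have := nm_lowB l (u N).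
by rewrite nm_sub; lra.
Qed.

Lemma cv_uniq (u : nat -> C) (l l' : C) : cv u l -> cv u l' -> l = l'.
Proof.
move=> h1 h2; apply/eqP; rewrite -subr_eq0; apply/eqP.
apply: nm_le_eps => e e0; have e20 : 0 < e / 2 by rewrite divr_gt0.
have [N1 k1] := h1 _ e20; have [N2 k2] := h2 _ e20.
have := k1 _ (leq_maxl N1 N2); have := k2 _ (leq_maxr N1 N2).
set w := u _; have := nmD (l - w) (w - l'); rewrite addrA subrK (nm_sub l w).
lra.
Qed.

Lemma cv_ext (u v : nat -> C) (l : C) : u =1 v -> cv u l -> cv v l.
Proof. by move=> /funext ->. Qed.

Lemma cv_cst (a : C) : cv (fun=> a) a.
Proof. by move=> e /ltW e0; exists 0%N => k _; rewrite subrr nm0. Qed.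
Lemma cvD (u v : nat -> C) (a b : C) : cv u a -> cv v b ->
  cv (fun N => u N + v N) (a + b).
Proof. move=> hu hv; apply: (cvP _ _).1; apply: (@cvgD C C); exact: (cvP _ _).2. Qed.
Lemma cvM (u v : nat -> C) (a b : C) : cv u a -> cv v b ->
  cv (fun N => u N * v N) (a * b).
Proof. move=> hu hv; apply: (cvP _ _).1; apply: (@cvgM C); exact: (cvP _ _).2. Qed.
Lemma cvMl (v : nat -> C) (a b : C) : cv v b -> cv (fun N => a * v N) (a * b).
Proof. by apply: cvM; exact: cv_cst. Qed.
Lemma cv_shift (u : nat -> C) (a : C) : cv u a -> cv (fun N => u N.+1) a.
Proof. by move=> h e /h [N hN]; exists N => k hk; apply: hN; exact: leqW. Qed.

Lemma nm_Re (z : C) : `|complex.Re z| <= nm z.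
Proof.
rewrite /nm normc_def /= -(sqrtr_sqr (complex.Re z)) ler_sqrt ?addr_ge0 ?sqr_ge0 //.
by rewrite lerDl sqr_ge0.
Qed.
Lemma nm_Im (z : C) : `|complex.Im z| <= nm z.
Proof.
rewrite /nm normc_def /= -(sqrtr_sqr (complex.Im z)) ler_sqrt ?addr_ge0 ?sqr_ge0 //.
by rewrite lerDr sqr_ge0.
Qed.
Lemma nm_ReIm (a b : R) : nm (Complex a b) <= `|a| + `|b|.
Proof.
have -> : Complex a b = RC a + Complex 0 1 * RC b.
  by rewrite /RC /=; apply/eqP; rewrite eq_complex /= !(mul0r,mul1r,addr0,add0r,mulr0,oppr0) ?subr0 !eqxx.
apply: le_trans (nmD _ _) _; rewrite nmM !nm_RC lerD2l.
have -> : nm (Complex 0 1) = 1; last by rewrite mul1r.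
by rewrite /nm normc_def /= expr0n expr1n add0r sqrtr1.
Qed.

Lemma real_series_cv (a : nat -> R) M :
  (forall N, \sum_(k < N) `|a k| <= M) -> exists l : R,
  (fun N => \sum_(k < N) a k) @ \oo --> l.
Proof.
move=> hM.
have h : cvgn [series a k]_k.
  apply: normed_cvg; apply: nondecreasing_is_cvgn.
    by apply: nondecreasing_series => k _ _; exact: normr_ge0.
  exists M => _ [N _ <-]; by have := hM N; rewrite -(big_mkord xpredT (fun k => `|a k|)).
exists (limn [series a k]_k); move: h.
rewrite (_ : (fun N => \sum_(k < N) a k) = [series a k]_k) //.
by apply/funext => N; rewrite /series /= big_mkord.
Qed.

Lemma C_series_cv (a : nat -> C) M :
  (forall N, \sum_(k < N) nm (a k) <= M) -> exists l : C,
  cv (fun N => \sum_(k < N) a k) l.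
Proof.
move=> hM.
have [N|x hx] := @real_series_cv (fun k => complex.Re (a k)) M.
  by apply: le_trans (hM N); apply: ler_sum => i _; exact: nm_Re.
have [N|y hy] := @real_series_cv (fun k => complex.Im (a k)) M.
  by apply: le_trans (hM N); apply: ler_sum => i _; exact: nm_Im.
exists (Complex x y) => e e0.
have e20 : 0 < e / 2 by rewrite divr_gt0.
move/cvgrPdist_le/(_ _ e20) : hx => [N1 _ h1].
move/cvgrPdist_le/(_ _ e20) : hy => [N2 _ h2].
exists (maxn N1 N2) => k; rewrite geq_max => /andP[/h1 /= k1 /h2 /= k2].
have -> : (\sum_(j < k) a j - Complex x y : C) =
   Complex (\sum_(j < k) complex.Re (a j) - x) (\sum_(j < k) complex.Im (a j) - y).
  apply/eqP; rewrite eq_complex; apply/andP; split; apply/eqP => /=.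
    by rewrite (raddfB (@complex.Re R : {additive Rcomplex R -> R})) raddf_sum.
  by rewrite (raddfB (@complex.Im R : {additive Rcomplex R -> R})) raddf_sum.
apply: le_trans (nm_ReIm _ _) _; rewrite distrC (distrC _ y); lra.
Qed.

Lemma series_tail (a : nat -> R) M e : (forall k, 0 <= a k) ->
  (forall N, \sum_(k < N) a k <= M) -> 0 < e ->
  exists N0, forall N, \sum_(N0 <= k < N) a k <= e.
Proof.
move=> a0 hM e0.
have [N|l hl] := @real_series_cv a M.
  by under eq_bigr do rewrite ger0_norm //.
move/cvgrPdist_le/(_ (e/2)) : hl; rewrite divr_gt0 // => /(_ isT) [N0 _ h].
exists N0 => N; case: (leqP N0 N) => hN; last by rewrite big_geq ?ltW // ltnW.
have /= h1 := h _ (leqnn N0); have /= h2 := h N hN.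
have : \sum_(k < N) a k = \sum_(k < N0) a k + \sum_(N0 <= k < N) a k.
  by rewrite -!(big_mkord xpredT) -big_cat_nat.
move: h1 h2; rewrite !ler_norml => /andP[? ?] /andP[? ?]; lra.
Qed.

End Norm.

(** * Absolutely convergent power series *)

Section Words.
Variables (R : realType) (n : nat).
Notation C := (Cplx R).
Notation V := 'rV[Cplx R]_n.
Notation word := (seq 'I_n).
Notation ps := (seq (C * word)).
Implicit Types (z : V) (rho sigma : 'I_n -> R) (f g : V -> C) (Q : pred word).

(* A power series is handled as a sequence of finite sums of monomials, a
   monomial being a coefficient with a word in the variables: products and
   compositions of series then need no rearrangement by multi-index. *)
Definition wev z (w : word) : C := \prod_(i <- w) z ord0 i.
Definition wnm rho (w : word) : R := \prod_(i <- w) rho i.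
Definition pev z (p : ps) : C := \sum_(t <- p) t.1 * wev z t.2.
Definition pnm rho (p : ps) : R := \sum_(t <- p) nm t.1 * wnm rho t.2.
Definition pmul (p q : ps) : ps := [seq (t.1 * s.1, t.2 ++ s.2) | t <- p, s <- q].
Definition pscale (c : C) (p : ps) : ps := [seq (c * t.1, t.2) | t <- p].

Definition inD rho z := forall i, nm (z ord0 i) <= rho i.
Definition nneg rho := forall i, 0 <= rho i.

Lemma wnm_ge0 rho w : nneg rho -> 0 <= wnm rho w.
Proof. by move=> h; apply: prodr_ge0 => i _; exact: h. Qed.
Lemma pnm_ge0 rho p : nneg rho -> 0 <= pnm rho p.
Proof. by move=> h; apply: sumr_ge0 => t _; rewrite mulr_ge0 ?nm_ge0 ?wnm_ge0. Qed.
Lemma wev_le rho z w : inD rho z -> nm (wev z w) <= wnm rho w.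
Proof.
move=> h; rewrite nm_prod; apply: ler_prod => i _; by rewrite nm_ge0 h.
Qed.
Lemma pev_le rho z p : inD rho z -> nm (pev z p) <= pnm rho p.
Proof.
move=> h; apply: le_trans (nm_sum _ _ _) _; apply: ler_sum => t _.
by rewrite nmM ler_wpM2l ?nm_ge0 ?wev_le.
Qed.
Lemma wev_cat z w w' : wev z (w ++ w') = wev z w * wev z w'.
Proof. by rewrite /wev big_cat. Qed.
Lemma wnm_cat rho w w' : wnm rho (w ++ w') = wnm rho w * wnm rho w'.
Proof. by rewrite /wnm big_cat. Qed.
Lemma pev_cat z p q : pev z (p ++ q) = pev z p + pev z q.
Proof. by rewrite /pev big_cat. Qed.
Lemma pnm_cat rho p q : pnm rho (p ++ q) = pnm rho p + pnm rho q.
Proof. by rewrite /pnm big_cat. Qed.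
Lemma pev_mul z p q : pev z (pmul p q) = pev z p * pev z q.
Proof.
rewrite /pev big_allpairs_dep /= big_distrl /=; apply: eq_bigr => t _.
rewrite big_distrr /=; apply: eq_bigr => s _; rewrite wev_cat; ring.
Qed.
Lemma pnm_mul rho p q : pnm rho (pmul p q) = pnm rho p * pnm rho q.
Proof.
rewrite /pnm big_allpairs_dep /= big_distrl /=; apply: eq_bigr => t _.
rewrite big_distrr /=; apply: eq_bigr => s _; rewrite wnm_cat nmM; ring.
Qed.
Lemma pev_scale z c p : pev z (pscale c p) = c * pev z p.
Proof. by rewrite /pev big_map big_distrr; apply: eq_bigr => t _ /=; rewrite mulrA. Qed.
Lemma pnm_scale rho c p : pnm rho (pscale c p) = nm c * pnm rho p.
Proof.
by rewrite /pnm big_map big_distrr; apply: eq_bigr => t _ /=; rewrite nmM mulrA.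
Qed.
Lemma wnm_mono rho sigma w : nneg rho -> (forall i, rho i <= sigma i) ->
  wnm rho w <= wnm sigma w.
Proof. by move=> h h'; apply: ler_prod => i _; rewrite h h'. Qed.
Lemma pnm_mono rho sigma p : nneg rho -> (forall i, rho i <= sigma i) ->
  pnm rho p <= pnm sigma p.
Proof.
by move=> h h'; apply: ler_sum => t _; rewrite ler_wpM2l ?nm_ge0 ?wnm_mono.
Qed.

Definition psQ Q (p : ps) := all (fun t => Q t.2) p.

(* f is on the closed polydisc of polyradius rho the sum of a series of norm at
   most M, all of whose words satisfy Q; independence of some of the variables
   is expressed through Q. *)
Definition An Q rho (M : R) f := exists p : nat -> ps,
  [/\ forall k, psQ Q (p k), forall N, \sum_(k < N) pnm rho (p k) <= M
    & forall z, inD rho z -> cv (fun N => \sum_(k < N) pev z (p k)) (f z)].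

Lemma An_ge0 Q rho M f : An Q rho M f -> 0 <= M.
Proof. by case=> p [_ /(_ 0%N) h _]; rewrite big_ord0 in h. Qed.

(** The terms from the [N]-th on have total norm at most what the first [N] leave of [M], and this
    bound passes to the limit. *)
Lemma An_tail rho M f (p : nat -> ps) z :
  (forall N, \sum_(k < N) pnm rho (p k) <= M) ->
  cv (fun N => \sum_(k < N) pev z (p k)) (f z) -> inD rho z ->
  forall N, nm (f z - \sum_(k < N) pev z (p k)) <= M - \sum_(k < N) pnm rho (p k).
Proof.
move=> hM hc hz N.
apply/ler_addgt0Pl => e e0; move/(_ e e0) : hc => [N1 h1].
have := h1 _ (leq_maxl N1 N); have := hM (maxn N1 N).
have -> : \sum_(k < maxn N1 N) pnm rho (p k) =
  \sum_(k < N) pnm rho (p k) + \sum_(N <= k < maxn N1 N) pnm rho (p k).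
  by rewrite -!(big_mkord xpredT (fun k => pnm rho (p k))) -big_cat_nat // leq_maxr.
have -> : \sum_(k < maxn N1 N) pev z (p k) =
  \sum_(k < N) pev z (p k) + \sum_(N <= k < maxn N1 N) pev z (p k).
  by rewrite -!(big_mkord xpredT (fun k => pev z (p k))) -big_cat_nat // leq_maxr.
have : nm (\sum_(N <= k < maxn N1 N) pev z (p k)) <= \sum_(N <= k < maxn N1 N) pnm rho (p k).
  by apply: le_trans (nm_sum _ _ _) _; apply: ler_sum => i _; exact: pev_le.
set A := \sum_(k < N) pev _ _; set B := \sum_(_ <= _ < _) pev _ _.
set a := \sum_(k < N) pnm _ _; set b := \sum_(_ <= _ < _) pnm _ _ => h2 h3 h4.
have e1 : f z - A = (f z - (A + B)) + B by ring.
have := nmD (f z - (A + B)) B; rewrite -e1 (nm_sub _ (A + B)); lra.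
Qed.

Lemma An_bound Q rho M f z : An Q rho M f -> inD rho z -> nm (f z) <= M.
Proof.
move=> [p [_ hM hc]] hz; have := An_tail hM (hc z hz) hz 0.
by rewrite !big_ord0 !subr0.
Qed.

Lemma An_ext Q rho M f g : (forall z, inD rho z -> f z = g z) ->
  An Q rho M f -> An Q rho M g.
Proof.
move=> h [p [h1 h2 h3]]; exists p; split; [exact: h1|exact: h2|].
by move=> z hz; rewrite -(h z hz); exact: h3.
Qed.

Lemma An_mono Q Q' rho rho' M M' f : nneg rho' -> (forall i, rho' i <= rho i) ->
  M <= M' -> subpred Q Q' -> An Q rho M f -> An Q' rho' M' f.
Proof.
move=> h0 h1 h2 hQ [p [k1 k2 k3]]; exists p; split.
- by move=> k; apply: sub_all (k1 k) => t; exact: hQ.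
- move=> N; apply: le_trans h2; apply: le_trans (k2 N).
  by apply: ler_sum => i _; exact: pnm_mono.
- by move=> z hz; apply: k3 => i; apply: le_trans (h1 i); exact: hz.
Qed.

Lemma An_le Q rho M M' f : nneg rho -> M <= M' -> An Q rho M f -> An Q rho M' f.
Proof. by move=> h hM; apply: An_mono => //. Qed.

Lemma An_weak Q rho M f : nneg rho -> An Q rho M f -> An predT rho M f.
Proof. by move=> h; apply: An_mono. Qed.

Lemma An_poly Q rho p : nneg rho -> psQ Q p -> An Q rho (pnm rho p) (pev^~ p).
Proof.
move=> h hp; exists (fun k => if k is 0%N then p else [::]).
split; first by case.
- case=> [|N]; first by rewrite big_ord0 pnm_ge0.
  rewrite big_ord_recl /= big1 ?addr0 // => i _; by rewrite /pnm big_nil.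
- move=> z hz; move=> e1 e0; exists 1%N => -[//|N] _.
  rewrite big_ord_recl /= big1 ?addr0 ?subrr ?nm0 ?ltW // => i _; by rewrite /pev big_nil.
Qed.

Lemma An_const Q rho c M : nneg rho -> Q [::] -> nm c <= M -> An Q rho M (fun=> c).
Proof.
move=> h hQ hM; apply: (@An_le _ _ (pnm rho [:: (c, [::])])) => //.
  by rewrite /pnm big_seq1 /= /wnm big_nil mulr1.
apply: (An_ext (f := pev^~ [:: (c, [::])])).
  by move=> z _; rewrite /pev big_seq1 /= /wev big_nil mulr1.
by apply: An_poly => //; rewrite /psQ /= hQ.
Qed.

Lemma An_var Q rho i : nneg rho -> Q [:: i] -> An Q rho (rho i) (fun z => z ord0 i).
Proof.
move=> h hQ; apply: (@An_le _ _ (pnm rho [:: (1, [:: i])])) => //.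
  by rewrite /pnm big_seq1 /= /wnm big_seq1 nm1 mul1r.
apply: (An_ext (f := pev^~ [:: (1, [:: i])])).
  by move=> z _; rewrite /pev big_seq1 /= /wev big_seq1 mul1r.
by apply: An_poly => //; rewrite /psQ /= hQ.
Qed.

Lemma An_add Q rho M M' f g : An Q rho M f -> An Q rho M' g ->
  An Q rho (M + M') (fun z => f z + g z).
Proof.
move=> [p [h1 h2 h3]] [q [k1 k2 k3]]; exists (fun k => p k ++ q k); split.
- by move=> k; rewrite /psQ all_cat; apply/andP; split; [exact: h1|exact: k1].
- move=> N; under eq_bigr do rewrite pnm_cat; by rewrite big_split /= lerD ?h2 ?k2.
- move=> z hz; apply: (cv_ext (u := fun N => \sum_(k < N) pev z (p k) + \sum_(k < N) pev z (q k))).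
    by move=> N /=; rewrite -big_split /=; apply: eq_bigr => i _; rewrite pev_cat.
  by apply: cvD; [exact: h3|exact: k3].
Qed.

Lemma An_scale Q rho M c f : An Q rho M f -> An Q rho (nm c * M) (fun z => c * f z).
Proof.
move=> [p [h1 h2 h3]]; exists (fun k => pscale c (p k)); split.
- by move=> k; rewrite /psQ all_map; exact: h1.
- move=> N; under eq_bigr do rewrite pnm_scale.
  by rewrite -big_distrr /= ler_wpM2l ?nm_ge0 ?h2.
- move=> z hz; apply: (cv_ext (u := fun N => c * \sum_(k < N) pev z (p k))).
    by move=> N /=; rewrite big_distrr /=; apply: eq_bigr => i _; rewrite pev_scale.
  by apply: cvMl; exact: h3.
Qed.

Lemma An_opp Q rho M f : An Q rho M f -> An Q rho M (fun z => - f z).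
Proof.
move=> /(An_scale (-1)); rewrite nmN nm1 mul1r; apply: An_ext => z _; by rewrite mulN1r.
Qed.

Lemma An_sub Q rho M M' f g : An Q rho M f -> An Q rho M' g ->
  An Q rho (M + M') (fun z => f z - g z).
Proof. by move=> hf /An_opp; exact: An_add. Qed.

(** Closure under concatenation makes the functions built from words in [Q] an algebra. *)
Definition catQ Q := forall w w', Q w -> Q w' -> Q (w ++ w').

(** The [k]-th summand collects the pairs of indices with maximum [k]. Partial sums of the product
    series arranged in this way are exactly products of partial sums. *)
Lemma sum_prod_tele (S : comPzRingType) (a b : nat -> S) N :
  \sum_(k < N) (a k * \sum_(j < k.+1) b j + (\sum_(j < k) a j) * b k) =
  (\sum_(k < N) a k) * (\sum_(k < N) b k).
Proof.
elim: N => [|N IH]; first by rewrite !big_ord0 mul0r.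
by rewrite big_ord_recr /= IH !big_ord_recr /=; ring.
Qed.

Lemma pev_flat z (p : nat -> ps) N :
  pev z (flatten [seq p k | k <- iota 0 N]) = \sum_(k < N) pev z (p k).
Proof.
rewrite -(big_mkord xpredT (fun k => pev z (p k))) /index_iota subn0.
elim: (iota 0 N) => [|k s IH]; first by rewrite /pev !big_nil.
by rewrite /= pev_cat IH big_cons.
Qed.
Lemma pnm_flat rho (p : nat -> ps) N :
  pnm rho (flatten [seq p k | k <- iota 0 N]) = \sum_(k < N) pnm rho (p k).
Proof.
rewrite -(big_mkord xpredT (fun k => pnm rho (p k))) /index_iota subn0.
elim: (iota 0 N) => [|k s IH]; first by rewrite /pnm !big_nil.
by rewrite /= pnm_cat IH big_cons.
Qed.
Lemma psQ_flat Q (p : nat -> ps) s : (forall k, psQ Q (p k)) ->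
  psQ Q (flatten [seq p k | k <- s]).
Proof. by move=> h; elim: s => //= k s IH; rewrite /psQ all_cat; apply/andP; split; [exact: h|exact: IH]. Qed.
Lemma psQ_mul Q p q : catQ Q -> psQ Q p -> psQ Q q -> psQ Q (pmul p q).
Proof.
move=> hQ /allP hp /allP hq; apply/allP => _ /allpairsP [[t s] /= [/hp ht /hq hs ->]].
exact: hQ.
Qed.

Lemma An_mul Q rho M M' f g : nneg rho -> catQ Q -> An Q rho M f -> An Q rho M' g ->
  An Q rho (M * M') (fun z => f z * g z).
Proof.
move=> h0 hQ [p [h1 h2 h3]] [q [k1 k2 k3]].
exists (fun k => pmul (p k) (flatten [seq q j | j <- iota 0 k.+1]) ++
                 pmul (flatten [seq p j | j <- iota 0 k]) (q k)); split.
- by move=> k; rewrite /psQ all_cat; apply/andP; split;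
    (apply: psQ_mul => //; exact: psQ_flat).
- move=> N; under eq_bigr do rewrite pnm_cat !pnm_mul !pnm_flat.
  rewrite (sum_prod_tele (fun k => pnm rho (p k)) (fun k => pnm rho (q k))); apply: ler_pM; [| |exact: h2|exact: k2];
    by apply: sumr_ge0 => i _; exact: pnm_ge0.
- move=> z hz; apply: (cv_ext (u := fun N => (\sum_(k < N) pev z (p k)) * (\sum_(k < N) pev z (q k)))).
    move=> N; cbv beta; under [RHS]eq_bigr do rewrite pev_cat !pev_mul !pev_flat.
    by rewrite (sum_prod_tele (fun k => pev z (p k)) (fun k => pev z (q k))).
  by apply: cvM; [exact: h3|exact: k3].
Qed.

Lemma An_series Q rho (M : nat -> R) K (f : nat -> V -> C) F :
  (forall k, An Q rho (M k) (f k)) -> (forall N, \sum_(k < N) M k <= K) ->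
  nneg rho ->
  (forall z, inD rho z -> cv (fun N => \sum_(k < N) f k z) (F z)) -> An Q rho K F.
Proof.
move=> hf hK h0 hF.
have {hf} [p hp] := choice hf.
(* The pieces [p k j] with maximal index [N] are grouped together, so that partial sums run over
   squares. *)
pose r N := flatten [seq p N j | j <- iota 0 N.+1] ++
            flatten [seq p k N | k <- iota 0 N].
have er (T : zmodType) (e : nat -> nat -> T) N :
  \sum_(k < N) (\sum_(j < k.+1) e k j + \sum_(j < k) e j k) =
  \sum_(k < N) \sum_(j < N) e k j.
  elim: N => [|N IH]; first by rewrite !big_ord0.
  rewrite big_ord_recr /= IH [RHS]big_ord_recr /=.
  under [X in _ = X + _]eq_bigr do rewrite big_ord_recr /=.
  rewrite big_split /= -!addrA; congr (_ + _); exact: addrC.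
exists r; split.
- move=> k; rewrite /psQ all_cat; apply/andP; split; apply: psQ_flat => j.
    by have [h _ _] := hp k; exact: h.
  by have [h _ _] := hp j; exact: h.
- move=> N; under eq_bigr do rewrite pnm_cat !pnm_flat.
  rewrite (er _ (fun k j => pnm rho (p k j))); apply: le_trans (hK N).
  by apply: ler_sum => k _; have [_ h _] := hp k; exact: h.
- move=> z hz.
  apply: (cv_ext (u := fun N => \sum_(k < N) \sum_(j < N) pev z (p k j))).
    move=> N /=; under [RHS]eq_bigr do rewrite pev_cat !pev_flat.
    by rewrite (er _ (fun k j => pev z (p k j))).
  move=> e e0.
  have M0 k : 0 <= M k by have [_ /(_ 0%N) h _] := hp k; rewrite big_ord0 in h.
  have e40 : 0 < e / 4 by rewrite divr_gt0.
  (* Rows past [N0] contribute little both to the square sum and to [F z], being dominated by the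
     tail of [M]; the finitely many rows before it converge one by one. Four errors arise, hence
     [e / 4]. *)
  have [N0 hN0] := series_tail M0 hK e40.
  have [N1 hN1] := hF z hz _ e40.
  have [N2 hN2] : exists N2, forall N, (N2 <= N)%N ->
     nm (\sum_(k < N0) f k z - \sum_(k < N0) \sum_(j < N) pev z (p k j)) <= e / 4.
    have : cv (fun N => \sum_(k < N0) \sum_(j < N) pev z (p k j)) (\sum_(k < N0) f k z).
      elim: (N0) => [|m IH].
        by apply: (cv_ext (u := fun=> 0)) => [N|]; rewrite ?big_ord0 //; exact: cv_cst.
      rewrite big_ord_recr /=.
      apply: (cv_ext (u := fun N => \sum_(k < m) \sum_(j < N) pev z (p k j) +
          \sum_(j < N) pev z (p m j))); first by move=> N; rewrite big_ord_recr.
      by apply: cvD => //; have [_ _ h] := hp m; exact: h.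
    by move=> /(_ _ e40) [N2 h]; exists N2 => N /h; rewrite nm_sub.
  exists (maxn N0 (maxn N1 N2)) => N; rewrite !geq_max => /and3P[l0 l1 l2].
  have a1 := hN1 N l1; have a2 := hN2 N l2; have a3 := hN0 N.
  have s1 : \sum_(k < N) f k z = \sum_(k < N0) f k z + \sum_(N0 <= k < N) f k z.
    by rewrite -!(big_mkord xpredT (fun k => f k z)) -big_cat_nat.
  have s2 : \sum_(k < N) \sum_(j < N) pev z (p k j) =
     \sum_(k < N0) \sum_(j < N) pev z (p k j) + \sum_(N0 <= k < N) \sum_(j < N) pev z (p k j).
    by rewrite -!(big_mkord xpredT (fun k => \sum_(j < N) pev z (p k j))) -big_cat_nat.
  have b1 : nm (\sum_(N0 <= k < N) f k z) <= \sum_(N0 <= k < N) M k.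
    apply: le_trans (nm_sum _ _ _) _; apply: ler_sum => k _.
    exact: (@An_bound Q rho (M k) (f k) z (ex_intro _ (p k) (hp k)) hz).
  have b2 : nm (\sum_(N0 <= k < N) \sum_(j < N) pev z (p k j)) <= \sum_(N0 <= k < N) M k.
    apply: le_trans (nm_sum _ _ _) _; apply: ler_sum => k _.
    have [_ h _] := hp k; apply: le_trans (h N); apply: le_trans (nm_sum _ _ _) _.
    by apply: ler_sum => j _; exact: pev_le.
  rewrite s2; rewrite s1 in a1; move: a1 a2 a3 b1 b2.
  set A := \sum_(k < N0) _; set B := \sum_(N0 <= k < N) _; set A' := \sum_(k < N0) _;
  set B' := \sum_(N0 <= k < N) _; set m := \sum_(N0 <= k < N) _ => a1 a2 a3 b1 b2.
  have -> : A + B - F z = (A' + B' - F z) - (A' - A) - B' + B by ring.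
  have c1 := nmD (A' + B' - F z - (A' - A) - B') B.
  have c2 := nmB (A' + B' - F z - (A' - A)) B'.
  have c3 := nmB (A' + B' - F z) (A' - A).
  lra.
Qed.

(** The sum is obtained pointwise from completeness; off the polydisc its value is arbitrary. *)
Lemma An_series_ex Q rho (M : nat -> R) K (f : nat -> V -> C) :
  (forall k, An Q rho (M k) (f k)) -> (forall N, \sum_(k < N) M k <= K) ->
  nneg rho -> exists F, An Q rho K F /\
  forall z, inD rho z -> cv (fun N => \sum_(k < N) f k z) (F z).
Proof.
move=> hf hK h0.
have hF z : exists l, inD rho z -> cv (fun N => \sum_(k < N) f k z) l.
  have [hz|hz] := pselect (inD rho z); last by exists 0.
  have [N|l hl] := @C_series_cv R (fun k => f k z) K; last by exists l.
  apply: le_trans (hK N); apply: ler_sum => k _; exact: An_bound (hf k) hz.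
have [F hF'] := choice hF; exists F; split=> //.
exact: (An_series hf hK h0 hF').
Qed.

Lemma An_sum (I : Type) (s : seq I) (M : I -> R) Q rho (f : I -> V -> C) :
  nneg rho -> Q [::] -> (forall i, An Q rho (M i) (f i)) ->
  An Q rho (\sum_(i <- s) M i) (fun z => \sum_(i <- s) f i z).
Proof.
move=> h0 hQ hf; elim: s => [|i s IH].
  apply: (An_ext (f := fun=> 0)) => [z _|]; first by rewrite big_nil.
  by apply: An_const; rewrite ?big_nil ?nm0.
apply: (An_ext (f := fun z => f i z + \sum_(i <- s) f i z)) => [z _|].
  by rewrite big_cons.
by rewrite big_cons; exact: An_add.
Qed.

Lemma An_exp Q rho M f k : nneg rho -> Q [::] -> catQ Q -> An Q rho M f ->
  An Q rho (M ^+ k) (fun z => f z ^+ k).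
Proof.
move=> h0 hQ cQ hf; elim: k => [|k IH].
  by apply: An_const; rewrite ?nm1.
apply: (An_ext (f := fun z => f z * f z ^+ k)) => [z _|]; first by rewrite exprS.
by rewrite exprS; exact: An_mul.
Qed.

(** Substitution turns a word into a product of components, whose norm is at most the value of the
    word at the bounds [sigma]; these bounds thus play the role of radii for [f]. *)
Lemma An_comp Q rho sigma M f (F : V -> V) : nneg rho -> Q [::] -> catQ Q ->
  (forall i, An Q rho (sigma i) (fun z => F z ord0 i)) ->
  An predT sigma M f -> An Q rho M (fun z => f (F z)).
Proof.
move=> h0 hQ cQ hF [p [_ h2 h3]].
apply: (@An_series Q rho (fun k => pnm sigma (p k)) M (fun k z => pev (F z) (p k))) => //.
  move=> k; rewrite /pnm /pev.
  have hw w : An Q rho (wnm sigma w) (fun z => wev (F z) w).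
    elim: w => [|i w IH].
      apply: (An_ext (f := fun=> 1)) => [z _|]; first by rewrite /wev big_nil.
      by apply: An_const; rewrite ?nm1 ?/wnm ?big_nil.
    apply: (An_ext (f := fun z => F z ord0 i * wev (F z) w)) => [z _|].
      by rewrite /wev big_cons.
    by rewrite /wnm big_cons; exact: An_mul.
  by apply: An_sum => // t; exact: An_scale.
move=> z hz; apply: h3 => i; exact: An_bound (hF i) hz.
Qed.

(** Taylor data are extracted by sorting monomials: lower bounds on the degree, powers of a single
    variable and absence of a variable are all predicates on words. *)
Lemma An_split Q P rho M f : nneg rho -> An Q rho M f -> exists f1 f2,
  [/\ An (predI Q P) rho M f1, An (predI Q (predC P)) rho M f2
    & forall z, inD rho z -> f z = f1 z + f2 z].
Proof.
move=> h0 [p [h1 h2 h3]].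
have hP (P' : pred word) : exists f1, An (predI Q P') rho M f1 /\
    forall z, inD rho z -> cv (fun N => \sum_(k < N) pev z [seq t <- p k | P' t.2]) (f1 z).
  apply: (@An_series_ex _ _ (fun k => pnm rho [seq t <- p k | P' t.2]) M (fun k z => pev z [seq t <- p k | P' t.2])) => //.
    move=> k; apply: An_poly => //; apply/allP => t; rewrite mem_filter /= => /andP[-> ht].
    by rewrite andbT; exact: (allP (h1 k)).
  move=> N; apply: le_trans (h2 N); apply: ler_sum => k _.
  rewrite /pnm big_filter [X in _ <= X](bigID (fun t => P' t.2)) /= lerDl.
  by apply: sumr_ge0 => t _; rewrite mulr_ge0 ?nm_ge0 ?wnm_ge0.
have [f1 [k1 l1]] := hP P; have [f2 [k2 l2]] := hP (predC P).
exists f1, f2; split=> // z hz; apply: (cv_uniq (h3 z hz)).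
apply: (cv_ext (u := fun N => \sum_(k < N) pev z [seq t <- p k | P t.2] +
   \sum_(k < N) pev z [seq t <- p k | predC P t.2])).
  move=> N; rewrite -big_split /=; apply: eq_bigr => k _.
  by rewrite /pev !big_filter [RHS](bigID (fun t => P t.2)).
by apply: cvD; [exact: l1|exact: l2].
Qed.

Lemma An_divX Q Q' rho M f i0 : nneg rho -> 0 < rho i0 ->
  (forall w, Q w -> i0 \in w /\ Q' (rem i0 w)) -> An Q rho M f ->
  exists q, An Q' rho (M / rho i0) q /\
   forall z, inD rho z -> f z = z ord0 i0 * q z.
Proof.
move=> h0 ri hQ [p [h1 h2 h3]].
pose p' k : ps := [seq (t.1, rem i0 t.2) | t <- p k].
have wE (S : comPzRingType) (F : 'I_n -> S) w : i0 \in w ->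
    \prod_(i <- w) F i = F i0 * \prod_(i <- rem i0 w) F i.
  by move=> hw; rewrite (perm_big _ (perm_to_rem hw)) big_cons.
have e1 k z : pev z (p k) = z ord0 i0 * pev z (p' k).
  rewrite /pev big_map big_distrr /=; apply: eq_big_seq => t ht.
  have [hw _] := hQ _ (allP (h1 k) _ ht).
  rewrite /wev (wE _ (fun i => z ord0 i)) //; ring.
have e2 k : pnm rho (p k) = rho i0 * pnm rho (p' k).
  rewrite /pnm big_map big_distrr /=; apply: eq_big_seq => t ht.
  have [hw _] := hQ _ (allP (h1 k) _ ht).
  rewrite /wnm (wE _ rho) //; ring.
have [q [k1 k2]] : exists q, An Q' rho (M / rho i0) q /\
    forall z, inD rho z -> cv (fun N => \sum_(k < N) pev z (p' k)) (q z).
  apply: (@An_series_ex _ _ (fun k => pnm rho (p' k)) _ (fun k z => pev z (p' k))) => //.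
    move=> k; apply: An_poly => //; rewrite /psQ all_map; apply/allP => t ht /=.
    by have [_ hw] := hQ _ (allP (h1 k) _ ht).
  move=> N; rewrite ler_pdivlMr // mulrC big_distrr /=.
  by apply: le_trans (h2 N); apply: ler_sum => k _; rewrite e2.
exists q; split=> // z hz; apply: (cv_uniq (h3 z hz)).
apply: (cv_ext (u := fun N => z ord0 i0 * \sum_(k < N) pev z (p' k))).
  by move=> N; rewrite big_distrr /=; apply: eq_bigr => k _; rewrite e1.
by apply: cvMl; exact: k2.
Qed.

End Words.

(** * Germs of analytic functions and the identity theorem *)

Section Germs.
Variables (R : realType) (n : nat).
Notation C := (Cplx R).
Notation V := 'rV[Cplx R]_n.
Notation word := (seq 'I_n).
Implicit Types (z : V) (rho sigma : 'I_n -> R) (f g : V -> C) (Q : pred word).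

Definition cst (r : R) : 'I_n -> R := fun=> r.

Lemma nneg_cst r : 0 <= r -> nneg (cst r).
Proof. by move=> h i. Qed.

Lemma An_shrink Q rho rho' c M f : nneg rho' -> (forall i, rho' i <= rho i) -> 0 <= c ->
  (forall w, Q w -> wnm rho' w <= c * wnm rho w) -> An Q rho M f -> An Q rho' (c * M) f.
Proof.
move=> h0 h1 c0 hc [p [k1 k2 k3]]; exists p; split => [//|N|z hz].
  apply: (@le_trans _ _ (c * \sum_(k < N) pnm rho (p k))); last by rewrite ler_wpM2l ?k2.
  rewrite big_distrr; apply: ler_sum => k _ /=; rewrite /pnm big_distrr /=.
  rewrite !big_seq; apply: ler_sum => t ht; rewrite mulrCA ler_wpM2l ?nm_ge0 ?hc //.
  exact: (allP (k1 k)).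
by apply: k3 => i; apply: le_trans (h1 i); exact: hz.
Qed.

Lemma wnm_scale rho (l : R) w : wnm (fun i => l * rho i) w = l ^+ size w * wnm rho w.
Proof.
elim: w => [|i w IH]; first by rewrite /wnm !big_nil expr0 mul1r.
by rewrite /wnm !big_cons -!/(wnm _ _) IH /= exprS; ring.
Qed.

Definition minsize k : pred word := fun w => (k <= size w)%N.

(** Schwarz's lemma for the sum norm: each word of length at least [k] shrinks by [l ^+ k] or
    better. *)
Lemma An_minsize k rho l M f : nneg rho -> 0 <= l -> l <= 1 -> An (minsize k) rho M f ->
  An (minsize k) (fun i => l * rho i) (l ^+ k * M) f.
Proof.
move=> h0 l0 l1; apply: An_shrink.
- by move=> i; rewrite mulr_ge0.
- by move=> i; rewrite ler_piMl.
- exact: exprn_ge0.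
- move=> w hw; rewrite wnm_scale ler_wpM2r ?wnm_ge0 //.
  exact: ler_wiXn2l.
Qed.

Lemma cv_sum (m : nat) (u : 'I_m -> nat -> C) (l : 'I_m -> C) :
  (forall i, cv (u i) (l i)) -> cv (fun N => \sum_i u i N) (\sum_i l i).
Proof.
elim: m u l => [|m IH] u l h.
  rewrite big_ord0; apply: (cv_ext (u := fun=> 0)); last exact: cv_cst.
  by move=> N; rewrite big_ord0.
rewrite big_ord_recr /=.
apply: (cv_ext (u := fun N => \sum_(i < m) u (widen_ord (leqnSn m) i) N + u ord_max N)).
  by move=> N; rewrite big_ord_recr.
by apply: cvD => //; exact: IH.
Qed.

(** Linearity, homogeneity and independence of a variable are checked on monomials and pass to the
    sum of the series through this lemma and its two special cases. *)
Lemma An_lin Q rho M f (m : nat) z (c : 'I_m -> C) (y : 'I_m -> V) :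
  (forall w, Q w -> wev z w = \sum_i c i * wev (y i) w) -> An Q rho M f ->
  inD rho z -> (forall i, inD rho (y i)) -> f z = \sum_i c i * f (y i).
Proof.
move=> hw [p [k1 k2 k3]] hz hy; apply: (cv_uniq (k3 z hz)).
apply: (cv_ext (u := fun N => \sum_i c i * \sum_(k < N) pev (y i) (p k))).
  move=> N; under eq_bigr do rewrite big_distrr /=.
  rewrite exchange_big; apply: eq_bigr => k _ /=; rewrite /pev.
  under eq_bigr do rewrite big_distrr /=.
  rewrite exchange_big; apply: eq_big_seq => t ht /=.
  rewrite hw; last exact: (allP (k1 k)).
  by rewrite big_distrr /=; apply: eq_bigr => i _; ring.
by apply: cv_sum => i; apply: cvMl; exact: k3.
Qed.

Lemma An_lin1 Q rho M f z c y :
  (forall w, Q w -> wev z w = c * wev y w) -> An Q rho M f ->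
  inD rho z -> inD rho y -> f z = c * f y.
Proof.
move=> hw hf hz hy.
rewrite (@An_lin Q rho M f 1 z (fun=> c) (fun=> y)) ?big_ord1 //.
by move=> w /hw ->; rewrite big_ord1.
Qed.

Lemma An_congr Q rho M f z y :
  (forall w, Q w -> wev z w = wev y w) -> An Q rho M f ->
  inD rho z -> inD rho y -> f z = f y.
Proof.
move=> hw hf hz hy; rewrite (@An_lin1 Q rho M f z 1 y) ?mul1r // => w /hw ->.
by rewrite mul1r.
Qed.

Lemma wev_scale (t : C) z w : wev (t *: z) w = t ^+ size w * wev z w.
Proof.
elim: w => [|i w IH]; first by rewrite /wev !big_nil expr0 mul1r.
by rewrite /wev !big_cons -!/(wev _ _) IH /= mxE exprS; ring.
Qed.

Lemma inD0 rho : nneg rho -> inD rho 0.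
Proof. by move=> h i; rewrite mxE nm0. Qed.

Lemma wev0 w : (0 < size w)%N -> wev (0 : V) w = 0.
Proof. by case: w => // i w _; rewrite /wev big_cons mxE mul0r. Qed.

Lemma An_minsize0 k rho M f : nneg rho -> An (minsize k.+1) rho M f -> f 0 = 0.
Proof.
move=> h0 hf; rewrite (@An_lin1 _ _ _ _ 0 0 0 _ hf) ?mul0r //; try exact: inD0.
by move=> w hw; rewrite wev0 ?mul0r // (leq_trans _ hw).
Qed.

Lemma An_at0 rho M f : nneg rho -> An predT rho M f ->
  exists g, An (minsize 1) rho M g /\ forall z, inD rho z -> f z = f 0 + g z.
Proof.
move=> h0 /(An_split (minsize 1) h0) [g [g0 [hg hg0 e]]]; exists g; split.
  by apply: An_mono hg.
move=> z hz; rewrite (e 0); last exact: inD0.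
rewrite (@An_minsize0 0 rho M g) //.
rewrite add0r addrC e //; congr (_ + _).
apply: (An_congr _ hg0) => //; last exact: inD0.
by case=> //= _; rewrite /wev !big_nil.
Qed.

Lemma An_at1 (r : R) M f : 0 < r -> An predT (cst r) M f ->
  exists (a : 'I_n -> C) g, [/\ An (minsize 2) (cst r) M g, forall i, nm (a i) <= M / r &
   forall z, inD (cst r) z -> f z = f 0 + \sum_i z ord0 i * a i + g z].
Proof.
move=> r0 /(An_at0 (nneg_cst (ltW r0))) [g [hg eg]].
have h0 := nneg_cst (ltW r0).
have [g2 [g1 [hg2 hg1 e]]] := An_split (minsize 2) h0 hg.
have dr i : inD (cst r) (RC r *: 'e_i : V).
  move=> j; rewrite !mxE eqxx /=; case: eqP => _; last by rewrite mulr0 nm0 ltW.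
  by rewrite mulr1 nm_RC ger0_norm // ltW.
(* The words of length one form a linear function, so its coefficients are recovered from its values
   at the points [RC r *: 'e_i]; the bound [M / r] is Cauchy's estimate. *)
exists (fun i => (RC r)^-1 * g1 (RC r *: 'e_i)), g2; split.
- by apply: An_mono hg2 => // w /andP[].
- move=> i; rewrite nmM nmV nm_RC (ger0_norm (ltW r0)) [M / r]mulrC.
  apply: ler_wpM2l; first by rewrite invr_ge0 ltW.
  exact: An_bound hg1 (dr i).
- move=> z hz; rewrite eg // e // -addrA; congr (_ + _); rewrite addrC; congr (_ + _).
  rewrite (@An_lin _ _ _ _ n z (fun i => z ord0 i * (RC r)^-1) (fun i => RC r *: 'e_i) _ hg1) //.
    by apply: eq_bigr => i _; rewrite mulrA.
  move=> [|j [|j' w]] //= _; rewrite /wev big_seq1 (bigD1 j) //= [X in _ + X]big1 => [|i ij].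
    rewrite big_seq1 !mxE !eqxx addr0 mulr1 mulfVK //.
    by rewrite -nm_eq0 nm_RC normr_eq0 gt_eqF.
  by rewrite big_seq1 !mxE eqxx /= eq_sym (negPf ij) mulr0n !mulr0.
Qed.

Definition O_ Q f := exists (r M : R), 0 < r /\ An Q (cst r) M f.
Notation O := (O_ predT).

Definition near0 (P : V -> Prop) := exists r : R, 0 < r /\ forall z, inD (cst r) z -> P z.

Lemma near0_and P P' : near0 P -> near0 P' -> near0 (fun z => P z /\ P' z).
Proof.
move=> [r [r0 h]] [s [s0 k]]; exists (Num.min r s); split.
  by rewrite lt_min r0.
by move=> z hz; split; [apply: h|apply: k] => i; apply: le_trans (hz i) _;
  rewrite /cst ge_min lexx ?orbT.
Qed.
Lemma near0_imp (P P' : V -> Prop) : (forall z, P z -> P' z) -> near0 P -> near0 P'.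
Proof. by move=> h [r [r0 k]]; exists r; split=> // z /k /h. Qed.
Lemma near0_all (P : V -> Prop) : (forall z, P z) -> near0 P.
Proof. by move=> h; exists 1. Qed.
Lemma near0_fin (I : finType) (P : I -> V -> Prop) :
  (forall i, near0 (P i)) -> near0 (fun z => forall i, P i z).
Proof.
move=> h; have [r hr] := choice h.
suff [s [s0 hs]] : exists s : R, 0 < s /\ forall i, s <= r i.
  exists s; split=> // z hz i; have [_ k] := hr i; apply: k => j.
  by apply: le_trans (hz j) _; rewrite /cst.
suff [s [s0 hs]] : exists s : R, 0 < s /\ forall i, i \in enum I -> s <= r i.
  by exists s; split=> // i; apply: hs; rewrite mem_enum.
elim: (enum I) => [|i l [s [s0 hs]]]; first by exists 1.
exists (Num.min (r i) s); split; first by rewrite lt_min s0; have [-> _] := hr i.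
by move=> j; rewrite inE => /orP[/eqP ->|/hs h']; rewrite ge_min ?lexx // h' orbT.
Qed.
Lemma near0_0 (P : V -> Prop) : near0 P -> P 0.
Proof. by move=> [r [r0 h]]; apply: h; apply: inD0; exact: nneg_cst (ltW r0). Qed.

Lemma An_cont (rho : 'I_n -> R) M f e : (forall i, 0 < rho i) -> An predT rho M f -> 0 < e ->
  near0 (fun z => nm (f z - f 0) <= e).
Proof.
move=> r0 hf e0; have h0 : nneg rho by move=> i; exact: ltW.
have M0 := An_ge0 hf; have [g [hg eg]] := An_at0 h0 hf.
have [l [l0 l1 lM]] : exists l : R, [/\ 0 < l, l <= 1 & l * M <= e].
  exists (e / (e + M)); rewrite divr_gt0 ?ltr_wpDr //; split=> //.
    by rewrite ler_pdivrMr ?ltr_wpDr // mul1r lerDl.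
  have eM : 0 < e + M by rewrite ltr_wpDr.
    by rewrite mulrAC ler_pdivrMr // ler_wpM2l ?(ltW e0) // lerDr (ltW e0).
have [s [s0 hs]] : exists s : R, 0 < s /\ forall i, s <= l * rho i.
  have : near0 (fun z => forall i, nm (z ord0 i) <= l * rho i).
    apply: near0_fin => i; exists (l * rho i); split; first by rewrite mulr_gt0.
    by move=> z; apply.
  move=> [s [s0 hs]]; exists s; split=> // i.
  have hh : inD (cst s) (const_mx (RC s)).
    by move=> j; rewrite mxE nm_RC (ger0_norm (ltW s0)).
  by have := hs _ hh i; rewrite mxE nm_RC (ger0_norm (ltW s0)).
exists s; split=> // z hz.
have hz' : inD (fun i => l * rho i) z by move=> i; apply: le_trans (hz i) (hs i).
have hz1 : inD rho z by move=> i; apply: le_trans (hz' i) _; rewrite ler_piMl.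
rewrite eg // addrC addKr; apply: le_trans lM.
by have := An_bound (An_minsize h0 (ltW l0) l1 hg) hz'; rewrite expr1.
Qed.

Lemma O_cont f e : O f -> 0 < e -> near0 (fun z => nm (f z - f 0) <= e).
Proof. by move=> [r [M [r0 hf]]]; apply: An_cont hf. Qed.

Lemma O_neq0 f : O f -> f 0 != 0 -> near0 (fun z => f z != 0).
Proof.
move=> hf f0; have e0 : 0 < nm (f 0) / 2 by rewrite divr_gt0 ?nm_gt0.
apply: near0_imp (O_cont hf e0) => z; rewrite -!nm_gt0 in f0 *.
by have := nm_lowB (f 0) (f z); rewrite nm_sub; lra.
Qed.

(** Homogeneous parts are stripped off in increasing degree. The first one that is nonzero at [z]
    gives the leading term along the line. If all vanish at [z], then [f] agrees on the segment with
    series of arbitrarily high order, which tend to zero there because [l < 1]. *)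
Lemma An_line rho M f l z : nneg rho -> An predT rho M f -> 0 <= l -> l < 1 ->
  inD (fun i => l * rho i) z ->
  (forall t, nm t <= 1 -> f (t *: z) = 0) \/
  (exists d c K, c != 0 /\ forall t, nm t <= 1 -> nm (f (t *: z) - c * t ^+ d) <= K * nm t ^+ d.+1).
Proof.
move=> h0 hf l0 l1 hz.
have hz1 : inD rho z by move=> i; apply: le_trans (hz i) _; rewrite ler_piMl // ltW.
have ht rho' t z' : inD rho' z' -> nm t <= 1 -> inD rho' (t *: z').
  move=> hz' t1 i; rewrite mxE nmM; apply: le_trans (hz' i).
  by rewrite ler_piMl ?nm_ge0.
have hb k g t : An (minsize k) rho M g -> nm t <= 1 -> nm (g (t *: z)) <= nm t ^+ k * M.
  move=> hg t1; apply: (An_bound (An_minsize h0 (nm_ge0 t) t1 hg)) => i.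
  by rewrite mxE nmM ler_wpM2l ?nm_ge0.
have [hord|nord] := pselect (exists (d : nat) (c : C) (K : R), c != 0 /\
  forall t, nm t <= 1 -> nm (f (t *: z) - c * t ^+ d) <= K * nm t ^+ d.+1); first by right.
left.
have step k : exists g, An (minsize k) rho M g /\ forall t, nm t <= 1 -> f (t *: z) = g (t *: z).
  elim: k => [|k [g [hg eg]]]; first by exists f; split=> //; apply: An_mono hf.
  have [g2 [g1 [hg2 hg1 e]]] := An_split (minsize k.+1) h0 hg.
  have {}hg2 : An (minsize k.+1) rho M g2 by apply: An_mono hg2 => // w /andP[].
  have e1 t : nm t <= 1 -> g1 (t *: z) = t ^+ k * g1 z.
    move=> t1; apply: (An_lin1 _ hg1) => //; last exact: ht.
    move=> w /andP[/= a b]; rewrite wev_scale; congr (_ ^+ _ * _).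
    by apply/eqP; rewrite eqn_leq -ltnS ltnNge b.
  have [g10|g10] := eqVneq (g1 z) 0.
    exists g2; split=> // t t1; rewrite eg // e ?e1 ?g10 ?mulr0 ?addr0 //; exact: ht.
  case: nord; exists k, (g1 z), M; split=> // t t1.
  rewrite eg // e; last exact: ht.
  rewrite e1 // (_ : g2 (t *: z) + t ^+ k * g1 z - g1 z * t ^+ k = g2 (t *: z)); last by ring.
  by rewrite mulrC; exact: hb.
move=> t t1; apply: nm_le_eps => e e0.
have lM : exists k, l ^+ k * M <= e.
  have : (fun k => l ^+ k) @ \oo --> (0 : R) by apply: cvg_expr; rewrite ger0_norm.
  have M0 := An_ge0 hf.
  have e1 : 0 < e / (M + 1) by rewrite divr_gt0 // ltr_wpDl.
  move=> /cvgrPdist_le/(_ _ e1) [N _ /(_ N (leqnn _))] /=.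
  rewrite sub0r normrN ger0_norm ?exprn_ge0 // => h; exists N.
  apply: le_trans (ler_wpM2r M0 h) _; rewrite mulrAC ler_pdivrMr ?ltr_wpDl //.
  by rewrite ler_wpM2l ?(ltW e0) // lerDl.
have [k hk] := lM; have [g [hg ->]] := step k; last by [].
apply: le_trans hk; apply: (An_bound (An_minsize h0 l0 (ltW l1) hg)).
exact: ht.
Qed.

(** The order of vanishing along the line spanned by [v], phrased with a remainder bound so that the
    restriction to the line needs no series of its own. *)
Definition hasord f (v : V) d := exists (c : C) (K e : R), [/\ c != 0, 0 < e &
  forall t, nm t <= e -> nm (f (t *: v) - c * t ^+ d) <= K * nm t ^+ d.+1].

Lemma hasord_nz f v d : hasord f v d -> exists e, 0 < e /\
  forall t, nm t <= e -> t != 0 -> f (t *: v) != 0.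
Proof.
move=> [c [K [e [c0 e0 h]]]].
exists (Num.min e (nm c / (`|K| + 1) / 2)); split.
  by rewrite lt_min e0 !divr_gt0 ?nm_gt0 // ltr_wpDl.
move=> t; rewrite le_min => /andP[/h h1 h2] t0; apply/eqP => f0.
move: h1; rewrite f0 sub0r nmN nmM nmX exprS mulrA.
rewrite ler_pM2r ?exprn_gt0 ?nm_gt0 //; apply/negP; rewrite -ltNge.
apply: (@le_lt_trans _ _ ((`|K| + 1) * nm t)).
  by rewrite ler_wpM2r ?nm_ge0 // (le_trans (ler_norm _)) // lerDl.
move: h2; rewrite -mulrA -invfM ler_pdivlMr ?mulr_gt0 ?ltr_wpDl //.
have : 0 < nm c by rewrite nm_gt0.
by rewrite mulrC; lra.
Qed.

(** A leading term along the line through [z] would make [f] nonzero at all small nonzero multiples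
    of [z], and these lie where [f] vanishes. The alternative of [An_line] then includes the value
    at [z]. *)
Lemma An_ident rho M f l z : nneg rho -> An predT rho M f -> 0 <= l -> l < 1 ->
  inD (fun i => l * rho i) z -> near0 (fun z => f z = 0) -> f z = 0.
Proof.
move=> h0 hf l0 l1 hz [s [s0 hs]].
case: (An_line h0 hf l0 l1 hz) => [/(_ 1)|[d [c [K [c0 h]]]]].
  by rewrite nm1 scale1r; apply.
exfalso; have ho : hasord f z d by exists c, K, 1.
have [e [e0 /(_ (RC (Num.min e (s / (1 + \sum_i nm (z ord0 i))))))]] := hasord_nz ho.
set q := 1 + _; have q0 : 0 < q by rewrite ltr_wpDr // sumr_ge0 // => i _; exact: nm_ge0.
set t := Num.min _ _; have t0 : 0 < t by rewrite lt_min e0 divr_gt0.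
have te : t <= e by rewrite ge_min lexx.
rewrite nm_RC (ger0_norm (ltW t0)) => /(_ te).
rewrite -(nm_eq0 (RC t)) nm_RC (ger0_norm (ltW t0)) gt_eqF // => /(_ isT)/negP; apply; apply/eqP; apply: hs.
move=> i; rewrite mxE nmM nm_RC (ger0_norm (ltW t0)).
have iq : nm (z ord0 i) <= q.
  rewrite /q (bigD1 i) //= addrCA lerDl addr_ge0 // sumr_ge0 // => j _; exact: nm_ge0.
apply: (@le_trans _ _ (s / q * q)); last by rewrite divfK // gt_eqF.
by apply: ler_pM => //; rewrite ?nm_ge0 ?(ltW t0) // ge_min lexx orbT.
Qed.

Lemma An_recenter (r s : R) M f (a : V) : inD (cst s) a -> 0 <= s -> s <= r ->
  An predT (cst r) M f -> An predT (cst (r - s)) M (fun z => f (a + z)).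
Proof.
move=> ha s0 sr hf; have h0 : nneg (cst (r - s)) by apply: nneg_cst; rewrite subr_ge0.
apply: (An_comp (F := fun z => a + z)) hf => // i.
apply: (An_ext (f := fun z => a ord0 i + z ord0 i)) => [z _|]; first by rewrite mxE.
apply: (@An_le _ _ _ _ (s + (r - s))) => //; first by rewrite addrC subrK /cst.
by apply: An_add; [apply: An_const => //; exact: ha|exact: An_var].
Qed.

Lemma O_recenter f r M (a : V) s : 0 <= s -> s < r -> An predT (cst r) M f ->
  inD (cst s) a -> O (fun z => f (a + z)).
Proof.
move=> s0 sr hf ha; exists (r - s), M; split; first by rewrite subr_gt0.
exact: An_recenter ha s0 (ltW sr) hf.
Qed.

Lemma O_common f g : O f -> O g -> exists r M M', [/\ 0 < r, An predT (cst r) M f & An predT (cst r) M' g].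
Proof.
move=> [r [M [r0 hf]]] [s [M' [s0 hg]]]; exists (Num.min r s), M, M'.
have m0 : 0 < Num.min r s by rewrite lt_min r0.
split=> //; [apply: An_mono hf|apply: An_mono hg]; rewrite /cst => //; try (by move=> i; exact: ltW);
  by move=> i; rewrite ge_min lexx ?orbT.
Qed.

(** If [f a] is nonzero at some [a] close to the origin, then [g] vanishes near [a], and the
    identity theorem on a polydisc centred at [a] brings this back to the origin. *)
Lemma O_domain f g : O f -> O g -> near0 (fun z => f z * g z = 0) ->
  near0 (fun z => f z = 0) \/ near0 (fun z => g z = 0).
Proof.
move=> hf hg [s [s0 hs]]; have [r [M [M' [r0 {}hf {}hg]]]] := O_common hf hg.
(* With [a] and [z] within [r / 8], the difference [z - a] stays in half of the polydisc of radius
   [r - e]; the bound [s / 2] keeps points near [a] where the product vanishes. *)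
pose e := Num.min (r / 8) (s / 2).
have e0 : 0 < e by rewrite lt_min !divr_gt0.
have [er es] : e <= r / 8 /\ e <= s / 2 by rewrite /e !ge_min !lexx orbT.
have [hz|] := pselect (forall z, inD (cst e) z -> f z = 0); first by left; exists e.
move=> /existsNP [a /not_implyP [ha fa]]; right.
have er' : e < r by lra.
have /O_neq0 : O (fun z => f (a + z)) by exact: O_recenter (ltW e0) er' hf ha.
rewrite addr0 => /(_ (introN eqP fa)) [q [q0 hq]].
have hga := An_recenter ha (ltW e0) (ltW er') hg.
exists (r / 8); split; first by rewrite divr_gt0.
move=> z hz; have re0 : 0 < r - e by rewrite subr_gt0.
have -> : z = a + (z - a) by rewrite addrC subrK.
apply: (@An_ident (cst (r - e)) M' (fun z => g (a + z)) (1/2)) => //; try lra.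
- exact: nneg_cst (ltW re0).
- move=> i; rewrite !mxE; have := nmB (z ord0 i) (a ord0 i).
  by have := hz i; have := ha i; rewrite /cst; lra.
- exists (Num.min q (s / 2)); split; first by rewrite lt_min q0 divr_gt0.
  move=> y hy; have yq : inD (cst q) y.
    by move=> i; apply: le_trans (hy i) _; rewrite /cst ge_min lexx.
  have ys : inD (cst s) (a + y).
    move=> i; rewrite mxE; have := nmD (a ord0 i) (y ord0 i).
    have := ha i; have := hy i; rewrite /cst le_min => /andP[_]; lra.
  by have /eqP := hs _ ys; rewrite mulf_eq0 (negPf (hq y yq)) => /eqP.
Qed.

End Germs.
Notation O := (O_ predT).

(** * Derivatives *)

Section Gradient.
Variables (R : realType) (n : nat).
Notation C := (Cplx R).
Notation V := 'rV[Cplx R]_n.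
Notation word := (seq 'I_n).
Implicit Types (z a h : V) (f g : V -> C) (d : 'I_n -> C).

(* Holomorphy gives a quadratic remainder, with a constant that is uniform in
   the base point; pd0_pr relies on it. *)
Definition grad_at_bound (K : R) f a d := 0 < K /\ forall e h, 0 <= e -> K * e <= 1 ->
  inD (cst e) h -> nm (f (a + h) - f a - \sum_i h ord0 i * d i) <= K * e ^+ 2.
Definition grad_at f a d := exists K, grad_at_bound K f a d.

Lemma grad_at_bound_mono K K' f a d : K <= K' -> grad_at_bound K f a d -> grad_at_bound K' f a d.
Proof.
move=> KK' [K0 hK]; split; first exact: lt_le_trans KK'.
move=> e h e0 Ke he; apply: (@le_trans _ _ (K * e ^+ 2)).
  by apply: hK => //; apply: le_trans Ke; rewrite ler_wpM2r.
by rewrite ler_wpM2r // exprn_ge0.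
Qed.

Lemma grad_at_ext f g a d : near0 (fun h => f (a + h) = g (a + h)) -> grad_at f a d -> grad_at g a d.
Proof.
move=> hn [K hK]; have fa := near0_0 hn; rewrite addr0 in fa.
have [r [r0 hr]] := hn; have Kr : K <= K + r^-1 by rewrite lerDl invr_ge0 ltW.
exists (K + r^-1); have [K0 hK'] := grad_at_bound_mono Kr hK; split=> // e h e0 Ke he.
rewrite -fa -hr ?hK' // => i; apply: le_trans (he i) _; rewrite /cst.
have r10 : 0 < r^-1 by rewrite invr_gt0.
rewrite -(@ler_pM2l _ (r^-1)) // mulVf ?gt_eqF //.
have : 0 <= K * e by rewrite mulr_ge0 // (ltW hK.1).
by move: Ke; rewrite mulrDl; lra.
Qed.

Lemma grad_at_eqd f a d d' : d =1 d' -> grad_at f a d -> grad_at f a d'.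
Proof. by move=> /funext ->. Qed.

Lemma grad_at_const c a : grad_at (fun=> c) a (fun=> 0).
Proof.
exists 1; split=> // e h e0 _ _; rewrite subrr big1 => [|i _]; last by rewrite mulr0.
by rewrite subr0 nm0 mul1r exprn_ge0.
Qed.

Lemma grad_at_var j a : grad_at (fun z => z ord0 j) a (fun i => (i == j)%:R).
Proof.
exists 1; split=> // e h e0 _ _; rewrite mxE (bigD1 j) //= big1.
  rewrite eqxx mulr1 addr0 (_ : _ - _ - _ = 0) ?nm0 ?mul1r ?exprn_ge0 //; ring.
by move=> i /negPf ->; rewrite mulr0.
Qed.

Lemma grad_at_add f g a d d' : grad_at f a d -> grad_at g a d' ->
  grad_at (fun z => f z + g z) a (fun i => d i + d' i).
Proof.
move=> [K hK] [K' hK']; have [K0 _] := hK; have [K0' _] := hK'.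
exists (K + K'); split=> [|e h e0 Ke he]; first by rewrite addr_gt0.
move: Ke; rewrite mulrDl => Ke.
have Ke1 : K * e <= 1 by have := mulr_ge0 (ltW K0') e0; lra.
have Ke2 : K' * e <= 1 by have := mulr_ge0 (ltW K0) e0; lra.
have h1 := hK.2 e h e0 Ke1 he; have h2 := hK'.2 e h e0 Ke2 he.
rewrite mulrDl; apply: le_trans (lerD h1 h2); apply: le_trans (nmD _ _).
under eq_bigr do rewrite mulrDr.
by rewrite big_split /= (_ : f (a + h) + _ - _ - _ = f (a + h) - f a - \sum_i h ord0 i * d i +
  (g (a + h) - g a - \sum_i h ord0 i * d' i)) //; ring.
Qed.

Lemma lin_bound d h e : inD (cst e) h ->
  nm (\sum_i h ord0 i * d i) <= (\sum_i nm (d i)) * e.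
Proof.
move=> he; apply: le_trans (nm_sum _ _ _) _; rewrite big_distrl /=.
by apply: ler_sum => i _; rewrite nmM mulrC ler_wpM2l ?nm_ge0 //; exact: he.
Qed.

Lemma grad_at_mul f g a d d' : grad_at f a d -> grad_at g a d' ->
  grad_at (fun z => f z * g z) a (fun i => f a * d' i + d i * g a).
Proof.
move=> [K hK] [K' hK']; have [K0 _] := hK; have [K0' _] := hK'.
set S := \sum_i nm (d i); set S' := \sum_i nm (d' i).
have S0 : 0 <= S by apply: sumr_ge0 => i _; exact: nm_ge0.
have S0' : 0 <= S' by apply: sumr_ge0 => i _; exact: nm_ge0.
set B := nm (f a) * K' + nm (g a) * K + S * S' + S + S' + 1.
have fK : 0 <= nm (f a) * K' by rewrite mulr_ge0 ?nm_ge0 // ltW.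
have gK : 0 <= nm (g a) * K by rewrite mulr_ge0 ?nm_ge0 // ltW.
have SS : 0 <= S * S' by rewrite mulr_ge0.
have B0 : 0 < B by rewrite /B; lra.
exists (K + K' + B); split=> [|e h e0 Ke he]; first lra.
have Be : 0 <= B * e by rewrite mulr_ge0 // ltW.
have K1 : 0 <= K * e by rewrite mulr_ge0 // ltW.
have K2 : 0 <= K' * e by rewrite mulr_ge0 // ltW.
have {}Ke : K * e + K' * e + B * e <= 1 by rewrite -!mulrDl.
have Ke1 : K * e <= 1 by lra.
have Ke2 : K' * e <= 1 by lra.
have := hK.2 e h e0 Ke1 he; have := hK'.2 e h e0 Ke2 he.
set L := \sum_i h ord0 i * d i; set L' := \sum_i h ord0 i * d' i.
set E := f (a + h) - f a - L; set E' := g (a + h) - g a - L' => hE' hE.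
have -> : \sum_i h ord0 i * (f a * d' i + d i * g a) = f a * L' + g a * L.
  rewrite /L /L' !big_distrr -big_split; apply: eq_bigr => i _ /=; ring.
have hL : nm L <= S * e by exact: lin_bound.
have hL' : nm L' <= S' * e by exact: lin_bound.
have -> : f (a + h) * g (a + h) - f a * g a - (f a * L' + g a * L) =
  f a * E' + g a * E + L * L' + L * E' + E * L' + E * E' by rewrite /E /E'; ring.
have E1 : nm E <= e.
  by apply: le_trans hE _; rewrite expr2 mulrA -[X in _ <= X]mul1r ler_wpM2r.
have E1' : nm E' <= e.
  by apply: le_trans hE' _; rewrite expr2 mulrA -[X in _ <= X]mul1r ler_wpM2r.
have t1 : nm (f a * E') <= nm (f a) * K' * e ^+ 2.
  by rewrite nmM -mulrA ler_wpM2l ?nm_ge0.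
have t2 : nm (g a * E) <= nm (g a) * K * e ^+ 2.
  by rewrite nmM -mulrA ler_wpM2l ?nm_ge0.
have t3 : nm (L * L') <= S * S' * e ^+ 2.
  by rewrite nmM expr2 mulrACA ler_pM ?nm_ge0.
have t4 : nm (L * E') <= S * e ^+ 2.
  by rewrite nmM expr2 mulrA ler_pM ?nm_ge0.
have t5 : nm (E * L') <= S' * e ^+ 2.
  by rewrite nmM expr2 mulrCA ler_pM ?nm_ge0.
have t6 : nm (E * E') <= e ^+ 2.
  by rewrite nmM expr2 ler_pM ?nm_ge0.
have e20 : 0 <= e ^+ 2 by exact: exprn_ge0.
have Kee : 0 <= K * e ^+ 2 by rewrite mulr_ge0 // ltW.
have Kee' : 0 <= K' * e ^+ 2 by rewrite mulr_ge0 // ltW.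
have -> : (K + K' + B) * e ^+ 2 = K * e ^+ 2 + K' * e ^+ 2 + (nm (f a) * K' * e ^+ 2 +
   nm (g a) * K * e ^+ 2 + S * S' * e ^+ 2 + S * e ^+ 2 + S' * e ^+ 2 + e ^+ 2).
  by rewrite /B; ring.
move: t1 t2 t3 t4 t5 t6.
set x1 := f a * E'; set x2 := g a * E; set x3 := L * L'.
set x4 := L * E'; set x5 := E * L'; set x6 := E * E' => t1 t2 t3 t4 t5 t6.
have n1 := nmD (x1 + x2 + x3 + x4 + x5) x6.
have n2 := nmD (x1 + x2 + x3 + x4) x5.
have n3 := nmD (x1 + x2 + x3) x4.
have n4 := nmD (x1 + x2) x3.
have n5 := nmD x1 x2.
lra.
Qed.

Lemma grad_at_comp f (F : V -> V) a d (D : 'I_n -> 'I_n -> C) :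
  (forall j, grad_at (fun z => F z ord0 j) a (D j)) -> grad_at f (F a) d ->
  grad_at (fun z => f (F z)) a (fun i => \sum_j d j * D j i).
Proof.
move=> hF [K' hK']; have [K0' _] := hK'.
have [K [K0 hK]] : exists K, 0 < K /\ forall j, grad_at_bound K (fun z => F z ord0 j) a (D j).
  have [k hk] := choice hF; exists (1 + \sum_j k j); split.
    by rewrite ltr_wpDr // sumr_ge0 // => j _; have [/ltW] := hk j.
  move=> j; apply: grad_at_bound_mono (hk j); rewrite (bigD1 j) //= addrCA lerDl addr_ge0 //.
  by rewrite sumr_ge0 // => i _; have [/ltW] := hk i.
set S := \sum_j \sum_i nm (D j i).
have Sj j : \sum_i nm (D j i) <= S.
  rewrite /S [X in _ <= X](bigD1 j) //= lerDl; apply: sumr_ge0 => k _.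
  by apply: sumr_ge0 => i _; exact: nm_ge0.
have S0 : 0 <= S by apply: sumr_ge0 => k _; apply: sumr_ge0 => i _; exact: nm_ge0.
set T := \sum_j nm (d j).
have T0 : 0 <= T by apply: sumr_ge0 => i _; exact: nm_ge0.
(* A Lipschitz constant of [F] at [a]: [S] accounts for the linear part, [1] for the remainder,
   which is at most [e] as soon as [K * e <= 1]. *)
set B := S + 1; have B0 : 0 < B by rewrite ltr_wpDl.
have b1 : 0 <= K' * B by rewrite mulr_ge0 // ltW.
have b2 : 0 <= K' * B ^+ 2 by rewrite mulr_ge0 // ?exprn_ge0 // ltW.
have b3 : 0 <= T * K by rewrite mulr_ge0 // ltW.
exists (K + K' * B + K' * B ^+ 2 + T * K); split=> [|e h e0 Ke he]; first lra.
have c0 : 0 <= K * e by rewrite mulr_ge0 // ltW.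
have c1 : 0 <= K' * B * e by rewrite mulr_ge0.
have c2 : 0 <= K' * B ^+ 2 * e by rewrite mulr_ge0.
have c3 : 0 <= T * K * e by rewrite mulr_ge0.
move: Ke; rewrite !mulrDl => Ke.
have Ke1 : K * e <= 1 by lra.
pose k := F (a + h) - F a.
pose E j := F (a + h) ord0 j - F a ord0 j - \sum_i h ord0 i * D j i.
have hE j : nm (E j) <= K * e ^+ 2 by exact: (hK j).2.
have kE j : k ord0 j = \sum_i h ord0 i * D j i + E j by rewrite /k !mxE /E; ring.
have hk : inD (cst (B * e)) k.
  move=> j; rewrite kE /cst /B mulrDl mul1r; apply: le_trans (nmD _ _) _.
  apply: lerD.
    by apply: le_trans (lin_bound _ he) _; rewrite ler_wpM2r.
  apply: le_trans (hE j) _; rewrite expr2 mulrA.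
  by rewrite -[X in _ <= X]mul1r ler_wpM2r.
have Be0 : 0 <= B * e by rewrite mulr_ge0 // ltW.
have KB : K' * (B * e) <= 1 by rewrite mulrA; lra.
have := hK'.2 _ k Be0 KB hk.
have -> : F a + k = F (a + h) by rewrite /k addrC subrK.
have -> : \sum_i k ord0 i * d i = \sum_i h ord0 i * (\sum_j d j * D j i) + \sum_j E j * d j.
  under eq_bigr do rewrite kE mulrDl big_distrl /=.
  rewrite big_split /= exchange_big /=; congr (_ + _); apply: eq_bigr => i _.
  by rewrite big_distrr /=; apply: eq_bigr => j _; ring.
set X := \sum_i _; set Y := \sum_j _ => hX.
have hY : nm Y <= T * K * e ^+ 2.
  apply: le_trans (nm_sum _ _ _) _; rewrite /T -mulrA big_distrl /=; apply: ler_sum => j _.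
  by rewrite nmM mulrC ler_wpM2l ?nm_ge0.
have -> : f (F (a + h)) - f (F a) - X = (f (F (a + h)) - f (F a) - (X + Y)) + Y by ring.
apply: le_trans (nmD _ _) _; apply: le_trans (lerD hX hY) _.
clearbody B; rewrite exprMn mulrA.
have e20 : 0 <= e ^+ 2 by exact: exprn_ge0.
have := mulr_ge0 (ltW K0) e20; have := mulr_ge0 b1 e20; lra.
Qed.

Definition pd (i : 'I_n) f a : C := 'D_('e_i) f a.

Lemma HL_pd f a (c : C) i (K : R) : 0 < K ->
  (forall t, K * nm t <= 1 -> nm (f (a + t *: 'e_i) - f a - t * c) <= K * nm t ^+ 2) ->
  pd i f a = c.
Proof.
move=> K0 hK; rewrite /pd /derive.
apply: cvg_lim => //; apply/cvgrPdist_le => _ /pos_RC[e e0 ->].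
have [s [s0 sK se]] : exists s, [/\ 0 < s, K * s <= 1 & K * s <= e].
  exists (Num.min 1 e / K); rewrite divr_gt0 ?lt_min ?e0 ?ltr01 //.
  by rewrite mulrC divfK ?gt_eqF // !ge_min !lexx orbT.
exists (RC s) => /=; first by rewrite RC_gt0.
move=> t /=; rewrite sub0r normrN nmE RC_lt => ts t0; rewrite nmE RC_le.
have t0' : 0 < nm t by rewrite nm_gt0.
have tK : K * nm t <= 1 by apply: le_trans sK; rewrite ler_pM2l // ltW.
have := hK t tK; rewrite [t *: _ + a]addrC.
set X := f _ - f a => h1.
have -> : c - t^-1 * X = - t^-1 * (X - t * c).
  have key (u x y : C) : u != 0 -> y - u^-1 * x = - u^-1 * (x - u * y).
    by move=> u0; field.
  exact: key.
rewrite nmM nmN nmV mulrC ler_pdivrMr //; apply: le_trans h1 _.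
rewrite expr2 mulrA ler_wpM2r ?nm_ge0 //; apply: le_trans se.
by rewrite ler_pM2l // ltW.
Qed.

Lemma grad_at_line f a d i : grad_at f a d -> exists K : R, 0 < K /\ forall t, K * nm t <= 1 -> nm (f (a + t *: 'e_i) - f a - t * d i) <= K * nm t ^+ 2.
Proof.
move=> [K [K0 hK]]; exists K; split=> // t tK.
have hh : inD (cst (nm t)) (t *: 'e_i : V).
  move=> j; rewrite !mxE eqxx /=; case: eqP => _; first by rewrite mulr1.
  by rewrite mulr0 nm0 nm_ge0.
have := hK _ _ (nm_ge0 t) tK hh.
rewrite (bigD1 i) //= big1 => [|j ji]; last by rewrite !mxE eqxx /= (negPf ji) mulr0 mul0r.
by rewrite !mxE !eqxx mulr1 addr0.
Qed.

Lemma grad_at_pd f a d i : grad_at f a d -> pd i f a = d i.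
Proof. by move=> /(grad_at_line i) [K [K0 hK]]; exact: HL_pd hK. Qed.

(** Agreement along one coordinate line is enough; it serves for functions that are prescribed only
    on a hyperplane. *)
Lemma pd_line f g a d (e : R) i : 0 < e -> grad_at f a d ->
  (forall t, nm t <= e -> f (a + t *: 'e_i) = g (a + t *: 'e_i)) -> pd i g a = d i.
Proof.
move=> e0 /(grad_at_line i) [K [K0 hK]] hfg.
have fg0 : f a = g a by have := hfg 0; rewrite nm0 scale0r addr0 ltW //; apply.
have K1 : 0 < K + e^-1 by rewrite addr_gt0 ?invr_gt0.
apply: (HL_pd K1) => t; rewrite mulrDl => tK.
have t1 : 0 <= K * nm t by rewrite mulr_ge0 ?nm_ge0 ?ltW.
have t2 : 0 <= e^-1 * nm t by rewrite mulr_ge0 ?nm_ge0 // invr_ge0 ltW.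
have te : nm t <= e.
  by rewrite -[leRHS]mulr1 -ler_pdivrMl //; lra.
rewrite -hfg // -fg0; apply: (@le_trans _ _ (K * nm t ^+ 2)); first by apply: hK; lra.
by rewrite ler_wpM2r ?exprn_ge0 ?nm_ge0 // lerDl invr_ge0 ltW.
Qed.

Definition Oat f a := O (fun z => f (a + z)).

(** The part of order two gains [(s / r) ^+ 2], which gives [M / r ^+ 2]; the summand [r^-1] of the
    constant forces [s <= r]. *)
Lemma An_grad_at_bound (r : R) M f a : 0 < r -> An predT (cst r) M (fun z => f (a + z)) ->
  grad_at_bound (r^-1 + M / r ^+ 2) f a (fun i => pd i f a) /\ forall i, nm (pd i f a) <= M / r.
Proof.
move=> r0 hf; have [d [g [hg hd e]]] := An_at1 r0 hf.
have M0 := An_ge0 hf.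
have hG : grad_at_bound (r^-1 + M / r ^+ 2) f a d.
  split.
    by rewrite ltr_pwDl ?invr_gt0 // divr_ge0 // exprn_ge0 // ltW.
  move=> s h s0 hs hh.
  have m0 : 0 <= M / r ^+ 2 * s by rewrite !mulr_ge0 ?invr_ge0 ?exprn_ge0 // ltW.
  have sr : s / r <= 1.
    by move: hs; rewrite mulrDl [r^-1 * s]mulrC; lra.
  have hr : inD (cst r) h.
    move=> i; apply: le_trans (hh i) _.
    by move: sr; rewrite ler_pdivrMr // mul1r.
  rewrite e // addr0.
  have -> : f a + \sum_i h ord0 i * d i + g h - f a - \sum_i h ord0 i * d i = g h by ring.
  have l0 : 0 <= s / r by rewrite divr_ge0 // ltW.
  have h' : inD (fun i => s / r * cst r i) h.
    by move=> i; rewrite /cst divfK ?gt_eqF //; exact: hh.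
  apply: le_trans (An_bound (An_minsize (nneg_cst (ltW r0)) l0 sr hg) h') _.
  rewrite expr_div_n mulrDl mulrAC [s ^+ 2 * M]mulrC mulrAC lerDr.
  by rewrite mulr_ge0 ?exprn_ge0 // invr_ge0 ltW.
have e' i : pd i f a = d i by apply: grad_at_pd; exists (r^-1 + M / r ^+ 2).
by split=> [|i]; rewrite ?e' // (_ : (fun i => pd i f a) = d) //; apply/funext.
Qed.

Lemma An_grad_at (r : R) M f a : 0 < r -> An predT (cst r) M (fun z => f (a + z)) ->
  grad_at f a (fun i => pd i f a) /\ forall i, nm (pd i f a) <= M / r.
Proof. by move=> r0 /(An_grad_at_bound r0) [h1 h2]; split=> //; exists (r^-1 + M / r ^+ 2). Qed.

Lemma Oat_grad_at f a : Oat f a -> grad_at f a (fun i => pd i f a).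
Proof. by move=> [r [M [r0 hf]]]; have [] := An_grad_at r0 hf. Qed.

(** Leibniz's rule on words: one word for each occurrence of [i], with that occurrence deleted. *)
Fixpoint pder (i : 'I_n) (w : word) : seq word :=
  if w is j :: w' then (if j == i then [:: w'] else [::]) ++ map (cons j) (pder i w')
  else [::].

Lemma grad_at_wev w a : grad_at (fun z => wev z w) a (fun i => \sum_(w' <- pder i w) wev a w').
Proof.
elim: w => [|j w IH] /=.
  apply: (@grad_at_ext (fun=> 1)); last first.
    by apply: grad_at_eqd (grad_at_const _ _) => i; rewrite big_nil.
  by apply: near0_all => z; rewrite /wev big_nil.
apply: (@grad_at_ext (fun z => z ord0 j * wev z w)).
  by apply: near0_all => z; rewrite /wev big_cons.
apply: grad_at_eqd (grad_at_mul (grad_at_var j a) IH) => i; symmetry.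
rewrite big_cat /= big_map big_distrr /= addrC; congr (_ + _).
  by apply: eq_bigr => w' _; rewrite /wev big_cons.
by rewrite eq_sym; case: eqP => _; rewrite ?big_seq1 ?big_nil ?mul1r ?mul0r.
Qed.

Definition pderp i (p : seq (C * word)) : seq (C * word) :=
  [seq (t.1, w') | t <- p, w' <- pder i t.2].

Lemma grad_at_pev p a : grad_at (fun z => pev z p) a (fun i => pev a (pderp i p)).
Proof.
elim: p => [|t p IH].
  apply: (@grad_at_ext (fun=> 0)); first by apply: near0_all => z; rewrite /pev big_nil.
  by apply: grad_at_eqd (grad_at_const _ _) => i; rewrite /pev big_nil.
apply: (@grad_at_ext (fun z => t.1 * wev z t.2 + pev z p)).
  by apply: near0_all => z; rewrite /pev big_cons.
apply: grad_at_eqd (grad_at_add (grad_at_mul (grad_at_const t.1 a) (grad_at_wev t.2 a)) IH) => i; symmetry.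
rewrite /pderp /= pev_cat mul0r addr0; congr (_ + _).
by rewrite /pev big_map /= big_distrr.
Qed.

Lemma grad_at_sum (m : nat) (F : 'I_m -> V -> C) a (D : 'I_m -> 'I_n -> C) :
  (forall j, grad_at (F j) a (D j)) -> grad_at (fun z => \sum_j F j z) a (fun i => \sum_j D j i).
Proof.
elim: m F D => [|m IH] F D hF.
  apply: (@grad_at_ext (fun=> 0)); first by apply: near0_all => z; rewrite big_ord0.
  by apply: grad_at_eqd (grad_at_const _ _) => i; rewrite big_ord0.
apply: (@grad_at_ext (fun z => F ord0 z + \sum_j F (lift ord0 j) z)).
  by apply: near0_all => z; rewrite big_ord_recl.
apply: (@grad_at_eqd _ _ (fun i => D ord0 i + \sum_j D (lift ord0 j) i)).
  by move=> i; rewrite big_ord_recl.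
apply: grad_at_add => //; exact: (IH (fun j => F (lift ord0 j)) (fun j => D (lift ord0 j))).
Qed.

(** Closure under subwords makes the class stable under differentiation, which deletes letters. *)
Definition subQ (Q : pred word) := forall w w', subseq w w' -> Q w' -> Q w.

Lemma pder_subseq i w w' : w' \in pder i w -> subseq w' w.
Proof.
elim: w w' => [|j w IH] w' //=; rewrite mem_cat => /orP[|/mapP[u /IH hu ->]].
  by case: eqP => // _; rewrite inE => /eqP ->; exact: (subseq_cons w j).
by rewrite /= eqxx.
Qed.

(** Cauchy's estimate for one monomial, by induction on the word from
    [1 + s / (r - s) = r / (r - s)]. *)
Lemma pder_norm i (r s : R) w : 0 <= s -> s < r ->
  \sum_(w' <- pder i w) wnm (cst s) w' <= wnm (cst r) w / (r - s).
Proof.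
move=> s0 sr; have rs : 0 < r - s by rewrite subr_gt0.
have hs (u : word) : 0 <= wnm (cst s) u by apply: wnm_ge0 => j.
have hsr (u : word) : wnm (cst s) u <= wnm (cst r) u.
  by apply: wnm_mono => // j; exact: ltW.
elim: w => [|j w IH] /=.
  by rewrite big_nil divr_ge0 ?(ltW rs) //; apply: wnm_ge0 => j; rewrite /cst; lra.
rewrite big_cat big_map /=.
have -> : \sum_(w' <- pder i w) wnm (cst s) (j :: w') = s * \sum_(w' <- pder i w) wnm (cst s) w'.
  by rewrite big_distrr; apply: eq_bigr => u _; rewrite /wnm big_cons.
have h1 : \sum_(w' <- (if j == i then [:: w] else [::])) wnm (cst s) w' <= wnm (cst r) w.
  case: eqP => _; first by rewrite big_seq1.
  by rewrite big_nil; apply: le_trans (hsr w); exact: hs.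
apply: le_trans (lerD h1 (ler_wpM2l s0 IH)) _.
have -> : wnm (cst r) (j :: w) = r * wnm (cst r) w by rewrite /wnm big_cons.
rewrite le_eqVlt (_ : _ == _ = true) //; apply/eqP; field; by rewrite gt_eqF.
Qed.

Lemma sum_shift (T : nmodType) (F : nat -> T) N K :
  \sum_(N <= k < N + K) F k = \sum_(k < K) F (N + k)%N.
Proof.
have := big_addn 0 (N + K) N xpredT F; rewrite add0n addKn => ->.
by rewrite big_mkord; apply: eq_bigr => k _; rewrite addnC.
Qed.

(** The termwise derivative converges by [pder_norm]. It is the derivative of [f] because the
    gradient bound, applied to a tail of small norm, shows that the derivative of the tail is
    small. *)
Lemma An_pd Q (r s : R) M f i : subQ Q -> 0 <= s -> s < r -> An Q (cst r) M f ->
  An Q (cst s) (M / (r - s)) (pd i f).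
Proof.
move=> hQ s0 sr [p [k1 k2 k3]]; have rs : 0 < r - s by rewrite subr_gt0.
have r0 : 0 <= r by rewrite (le_trans s0) ?ltW.
have hr := nneg_cst (n := n) r0; have hs := nneg_cst (n := n) s0.
have [g [hg eg]] : exists g, An Q (cst s) (M / (r - s)) g /\
    forall z, inD (cst s) z -> cv (fun N => \sum_(k < N) pev z (pderp i (p k))) (g z).
  apply: (@An_series_ex _ _ _ _ (fun k => pnm (cst s) (pderp i (p k))) _ (fun k z => pev z (pderp i (p k)))) => //.
    move=> k; apply: An_poly => //; apply/allP => _ /allpairsPdep [t [w' [ht hw' ->]]] /=.
    by apply: hQ (pder_subseq hw') _; exact: (allP (k1 k)).
  move=> N; rewrite ler_pdivlMr // big_distrl /=; apply: le_trans (k2 N).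
  apply: ler_sum => k _; rewrite /pnm /pderp big_allpairs_dep big_distrl /=.
  apply: ler_sum => t _; rewrite -big_distrr /= -mulrA ler_wpM2l ?nm_ge0 //.
  by rewrite -ler_pdivlMr //; exact: pder_norm.
apply: An_ext hg => a ha; apply/eqP; rewrite eq_sym -subr_eq0; apply/eqP.
apply: nm_le_eps => e e0.
have e20 : 0 < e / 2 by rewrite divr_gt0.
have e30 : 0 < e / 2 * (r - s) by rewrite mulr_gt0.
have p0 k : 0 <= pnm (cst r) (p k) by exact: pnm_ge0.
have [N0 hN0] := series_tail p0 k2 e30.
have [N1 hN1] := eg a ha _ e20.
pose N := maxn N0 N1.
have hfN : An predT (cst r) (e / 2 * (r - s)) (fun z => f z - \sum_(k < N) pev z (p k)).
  exists (fun k => p (N + k)%N); split.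
  - by move=> k; apply: sub_all (k1 (N + k)%N).
  - move=> K; apply: le_trans (hN0 (N + K)%N).
    rewrite (@big_cat_nat _ _ _ N) ?leq_maxl ?leq_addr //=.
    have -> : \sum_(N <= k < N + K) pnm (cst r) (p k) = \sum_(k < K) pnm (cst r) (p (N + k)%N).
      exact: (sum_shift (fun k => pnm (cst r) (p k))).
    by rewrite lerDr; apply: sumr_ge0.
  - move=> z hz; apply: (cv_ext (u := fun K => \sum_(k < N + K) pev z (p k) + - \sum_(k < N) pev z (p k))).
      move=> K; rewrite -!(big_mkord xpredT (fun k => pev z (p k))).
      rewrite (@big_cat_nat _ _ _ N) ?leq_addr //= addrAC subrr add0r.
      by rewrite (sum_shift (fun k => pev z (p k))).
    apply: cvD; last exact: cv_cst.
    move=> e1 /(k3 z hz) [N2 hN2]; exists N2 => k hk; apply: hN2.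
    by rewrite (leq_trans hk) // leq_addl.
have hfa : An predT (cst (r - s)) M (fun z => f (a + z)).
  by apply: (An_recenter ha) => //; [exact: ltW|exists p; split=> // k; exact: sub_all (k1 k)].
have hfNa := An_recenter ha s0 (ltW sr) hfN.
have [hG _] := An_grad_at rs hfa.
have [hGN /(_ i)] := An_grad_at (f := fun z => f z - \sum_(k < N) pev z (p k)) rs hfNa.
have hS := grad_at_sum (fun k : 'I_N => grad_at_pev (p k) a).
have hS' := grad_at_add hG (grad_at_mul (grad_at_const (-1) a) hS).
rewrite (@grad_at_pd _ a _ i (grad_at_ext _ hS')); last first.
  by apply: near0_all => z; ring.
rewrite mul0r addr0 mulN1r mulfK ?gt_eqF // => h1.
have := hN1 N (leq_maxr _ _); set X := \sum_(k < N) _ in h1 * => h2.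
have -> : pd i f a - g a = (pd i f a - X) + (X - g a) by ring.
by apply: le_trans (nmD _ _) _; lra.
Qed.

Lemma O_pdQ Q i f : subQ Q -> O_ Q f -> O_ Q (pd i f).
Proof.
move=> sQ [r [M [r0 hf]]]; exists (r / 2), (M / (r - r / 2)); split; first by rewrite divr_gt0.
by apply: An_pd => //; lra.
Qed.

Lemma O_pd i f : O f -> O (pd i f).
Proof. exact: O_pdQ. Qed.

End Gradient.

(** * Composition and the inverse function theorem *)

Section Closure.
Variables (R : realType) (n : nat).
Notation C := (Cplx R).
Notation V := 'rV[Cplx R]_n.
Notation word := (seq 'I_n).
Implicit Types (z a h w : V) (f g : V -> C).

Lemma O_ext f g : near0 (fun z => f z = g z) -> O f -> O g.
Proof.
move=> [s [s0 hs]] [r [M [r0 hf]]]; exists (Num.min r s), M.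
have m0 : 0 < Num.min r s by rewrite lt_min r0.
split=> //; apply: (An_ext (f := f)).
  by move=> z hz; apply: hs => i; apply: le_trans (hz i) _; rewrite /cst ge_min lexx orbT.
apply: An_mono hf => //; first exact: nneg_cst (ltW m0).
by move=> i; rewrite /cst ge_min lexx.
Qed.
Lemma O_const c : O ((fun=> c) : V -> C).
Proof. by exists 1, (nm c); split=> //; apply: An_const => // i; exact: ler01. Qed.
Lemma O_var i : O (fun z => z ord0 i).
Proof. by exists 1, 1; split=> //; apply: (@An_var _ _ _ (cst 1)) => // j; exact: ler01. Qed.
Lemma O_add f g : O f -> O g -> O (fun z => f z + g z).
Proof.
by move=> hf hg; have [r [M [M' [r0 h1 h2]]]] := O_common hf hg; exists r, (M + M'); split=> //; exact: An_add.
Qed.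
Lemma O_opp f : O f -> O (fun z => - f z).
Proof. by move=> [r [M [r0 h1]]]; exists r, M; split=> //; exact: An_opp. Qed.
Lemma O_sub f g : O f -> O g -> O (fun z => f z - g z).
Proof. by move=> hf hg; apply: O_add => //; exact: O_opp. Qed.
Lemma O_mul f g : O f -> O g -> O (fun z => f z * g z).
Proof.
move=> hf hg; have [r [M [M' [r0 h1 h2]]]] := O_common hf hg; exists r, (M * M'); split=> //.
by apply: An_mul => //; exact: nneg_cst (ltW r0).
Qed.
Lemma O_sum (I : Type) (s : seq I) (F : I -> V -> C) :
  (forall i, O (F i)) -> O (fun z => \sum_(i <- s) F i z).
Proof.
move=> hF; elim: s => [|i s IH].
  by apply: (@O_ext (fun=> 0)); [apply: near0_all => z; rewrite big_nil|exact: O_const].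
apply: (@O_ext (fun z => F i z + \sum_(i <- s) F i z)).
  by apply: near0_all => z; rewrite big_cons.
exact: O_add.
Qed.
Lemma O_exp f k : O f -> O (fun z => f z ^+ k).
Proof.
move=> hf; elim: k => [|k IH].
  by apply: (@O_ext (fun=> 1)); [apply: near0_all => z; rewrite expr0|exact: O_const].
by apply: (@O_ext (fun z => f z * f z ^+ k)); [apply: near0_all => z; rewrite exprS|exact: O_mul].
Qed.

Lemma small_scale (M e : R) : 0 <= M -> 0 < e -> exists l : R, [/\ 0 < l, l <= 1 & l * M <= e].
Proof.
move=> M0 e0; have eM : 0 < e + M by rewrite ltr_wpDr.
exists (e / (e + M)); split; first by rewrite divr_gt0.
  by rewrite ler_pdivrMr // mul1r lerDl.
by rewrite mulrAC ler_pdivrMr // ler_wpM2l ?(ltW e0) // lerDr (ltW e0).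
Qed.

Lemma O_small f e : O f -> f 0 = 0 -> 0 < e -> exists s0 : R, 0 < s0 /\
  forall s, 0 < s -> s <= s0 -> An predT (cst s) e f.
Proof.
move=> [r [M [r0 hf]]] f0 e0; have h0 := nneg_cst (n := n) (ltW r0).
have [g [hg eg]] := An_at0 h0 hf; have [l [l0 l1 lM]] := small_scale (An_ge0 hf) e0.
exists (l * r); split=> [|s s0 sl]; first by rewrite mulr_gt0.
have := An_minsize h0 (ltW l0) l1 hg; rewrite expr1 => hgl.
apply: (An_ext (f := g)).
  move=> z hz; rewrite eg ?f0 ?add0r // => i; apply: le_trans (hz i) _.
  by apply: le_trans sl _; rewrite ler_piMl // ltW.
by apply: An_mono hgl => //; exact: nneg_cst (ltW s0).
Qed.

Lemma O_small_all (I : finType) (F : I -> V -> C) e : (forall i, O (F i)) ->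
  (forall i, F i 0 = 0) -> 0 < e -> exists s0 : R, 0 < s0 /\
  forall s, 0 < s -> s <= s0 -> forall i, An predT (cst s) e (F i).
Proof.
move=> hF F0 e0.
have [s hs] := choice (fun i => O_small (hF i) (F0 i) e0).
suff [s0 [s00 h]] : exists s0 : R, 0 < s0 /\ forall i, s0 <= s i.
  exists s0; split=> // t t0 ts i; apply: (hs i).2 => //; exact: le_trans ts (h i).
suff [s0 [s00 h]] : exists s0 : R, 0 < s0 /\ forall i, i \in enum I -> s0 <= s i.
  by exists s0; split=> // i; apply: h; rewrite mem_enum.
elim: (enum I) => [|i l [s0 [s00 h]]]; first by exists 1.
exists (Num.min (s i) s0); split; first by rewrite lt_min s00 (hs i).1.
by move=> j; rewrite inE => /orP[/eqP ->|/h h']; rewrite ge_min ?lexx // h' orbT.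
Qed.

Lemma O_comp f (F : V -> V) : (forall j, O (fun z => F z ord0 j)) -> Oat f (F 0) ->
  O (fun z => f (F z)).
Proof.
move=> hF [r [M [r0 hf]]].
have [|//|//|s0 [s00 /(_ s0 s00 (lexx _)) h]] := @O_small_all _ (fun j z => F z ord0 j - F 0 ord0 j) r.
- by move=> j; apply: O_sub => //; exact: O_const.
- by move=> j; rewrite subrr.
exists s0, M; split=> //.
apply: (An_ext (f := fun z => f (F 0 + (F z - F 0)))) => [z _|].
  by rewrite addrC subrK.
apply: (An_comp (F := fun z => F z - F 0)) hf => //; first exact: nneg_cst (ltW s00).
by move=> i; apply: An_ext (h i) => z _; rewrite !mxE.
Qed.

Lemma near0_comp (P : V -> Prop) (F : V -> V) : (forall i, O (fun z => F z ord0 i)) -> F 0 = 0 ->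
  near0 P -> near0 (fun z => P (F z)).
Proof.
move=> hF F0 [t [t0 ht]]; have F0i i : F 0 ord0 i = 0 by rewrite F0 mxE.
have [s [s0 /(_ _ s0 (lexx _)) hs]] := O_small_all hF F0i t0.
by exists s; split=> // z hz; apply: ht => i; exact: An_bound (hs i) hz.
Qed.

Lemma O_Oat f : O f -> near0 (fun a => Oat f a).
Proof.
move=> [r [M [r0 hf]]]; exists (r / 2); split; first by rewrite divr_gt0.
by move=> a ha; apply: (O_recenter _ _ hf ha); lra.
Qed.
Lemma Oat0 f : Oat f 0 <-> O f.
Proof. by rewrite /Oat; under eq_fun do rewrite add0r. Qed.

Lemma cv_geo (x : C) (l : R) : l < 1 -> nm x <= l -> cv (fun N => x ^+ N) 0.
Proof.
move=> l1 xl e e0; have l0 : 0 <= l by apply: le_trans xl; exact: nm_ge0.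
have : (fun k => l ^+ k) @ \oo --> (0 : R) by apply: cvg_expr; rewrite ger0_norm.
move=> /cvgrPdist_le/(_ _ e0) [N _ hN]; exists N => k /hN /=.
rewrite !sub0r normrN ger0_norm ?exprn_ge0 // subr0 nmX => h; apply: le_trans h.
by rewrite lerXn2r // ?nnegrE ?nm_ge0.
Qed.

Lemma geo_half N : \sum_(k < N) (1 / 2 : R) ^+ k <= 2.
Proof.
suff -> : \sum_(k < N) (1 / 2 : R) ^+ k = 2 - 2 * (1 / 2) ^+ N.
  by rewrite lerBlDr lerDl mulr_ge0 // exprn_ge0 // divr_ge0.
elim: N => [|N IH]; first by rewrite big_ord0 expr0; ring.
by rewrite big_ord_recr /= IH exprS; field.
Qed.

(** A geometric series in [1 - f / f 0], whose norm is at most [1 / 2] on a small polydisc. *)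
Lemma O_inv f : O f -> f 0 != 0 -> O (fun z => (f z)^-1).
Proof.
move=> hf f0; pose g z := 1 - (f 0)^-1 * f z.
have hg : O g by apply: O_sub; [exact: O_const|apply: O_mul => //; exact: O_const].
have g0 : g 0 = 0 by rewrite /g mulVf // subrr.
have h2 : 0 < (1 / 2 : R) by rewrite divr_gt0.
have [s [s0 /(_ s s0 (lexx _)) hs]] := O_small hg g0 h2.
have hn := nneg_cst (n := n) (ltW s0).
have [F [hF eF]] := @An_series_ex _ _ predT (cst s) (fun k => (1/2) ^+ k) 2 (fun k z => g z ^+ k)
  (fun k => An_exp k hn isT (fun _ _ _ _ => isT) hs) geo_half hn.
apply: (@O_ext (fun z => (f 0)^-1 * F z)); last first.
  by apply: O_mul; [exact: O_const|exists s, 2].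
exists s; split=> // z hz.
have hl : (1 / 2 : R) < 1 by lra.
have gz := An_bound hs hz.
have e : F z * (1 - g z) = 1.
  apply: (cv_uniq (u := fun N => (\sum_(k < N) g z ^+ k) * (1 - g z))).
    by apply: cvM; [exact: eF|exact: cv_cst].
  apply: (cv_ext (u := fun N => 1 + -1 * g z ^+ N)).
    move=> N; elim: N => [|N IH]; first by rewrite big_ord0 expr0; ring.
    by rewrite big_ord_recr /= mulrDl -IH exprS; ring.
  rewrite -[X in cv _ X](_ : 1 + -1 * 0 = 1); last by rewrite mulr0 addr0.
  by apply: cvD; [exact: cv_cst|apply: cvMl; exact: cv_geo gz].
have e' : F z * ((f 0)^-1 * f z) = 1 by rewrite -e /g; congr (_ * _); ring.
have fz : f z != 0.
  by apply/eqP => fz; move: e'; rewrite fz !mulr0 => /eqP; rewrite eq_sym oner_eq0.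
by apply: (mulIf fz); rewrite mulVf // -e'; ring.
Qed.

Lemma word_lip (s sg eta : R) (F G : V -> V) (w : word) : 0 <= s -> 0 <= sg -> 0 <= eta ->
  (forall i, An predT (cst s) sg (fun z => F z ord0 i)) ->
  (forall i, An predT (cst s) sg (fun z => G z ord0 i)) ->
  (forall i, An predT (cst s) eta (fun z => F z ord0 i - G z ord0 i)) ->
  An predT (cst s) (eta * ((size w)%:R * sg ^+ (size w).-1)) (fun z => wev (F z) w - wev (G z) w).
Proof.
move=> s0 sg0 eta0 hF hG hFG; have hn := nneg_cst (n := n) s0.
have hw (H : V -> V) u : (forall i, An predT (cst s) sg (fun z => H z ord0 i)) ->
    An predT (cst s) (sg ^+ size u) (fun z => wev (H z) u).
  move=> hH; elim: u => [|i u IH].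
    apply: (An_ext (f := fun=> 1)) => [z _|]; first by rewrite /wev big_nil.
    by apply: An_const => //; rewrite nm1.
  apply: (An_ext (f := fun z => H z ord0 i * wev (H z) u)) => [z _|].
    by rewrite /wev big_cons.
  by rewrite exprS; exact: An_mul.
elim: w => [|i w IH] /=.
  apply: (An_ext (f := fun=> 0)) => [z _|]; first by rewrite /wev !big_nil subrr.
  by apply: An_const => //; rewrite nm0 mul0r mulr0.
apply: (An_ext (f := fun z => F z ord0 i * (wev (F z) w - wev (G z) w) +
   (F z ord0 i - G z ord0 i) * wev (G z) w)) => [z _|].
  by rewrite /wev !big_cons; ring.
apply: (@An_le _ _ _ _ (sg * (eta * ((size w)%:R * sg ^+ (size w).-1)) + eta * sg ^+ size w)) => //.
  case: (size w) => [|k] /=; first by rewrite !mul0r mulr0 !mulr0 add0r expr0 mul1r.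
  by rewrite le_eqVlt (_ : _ == _ = true) //; apply/eqP; rewrite exprS (natrD _ 1 k.+1); ring.
by apply: An_add; apply: An_mul => //; exact: hw.
Qed.

Lemma lam_bound (l : R) k : 0 <= l -> l <= 1 / 2 -> k.+2%:R * l ^+ k.+1 <= 2 * l.
Proof.
move=> l0 l2; elim: k => [|k IH]; first by rewrite expr1.
apply: le_trans IH; rewrite exprS mulrCA.
have h : 0 <= l ^+ k.+1 by exact: exprn_ge0.
rewrite mulrA; apply: ler_wpM2r => //.
apply: (@le_trans _ _ (1 / 2 * k.+3%:R)); first by rewrite ler_wpM2r.
have k0 := ler0n R k; rewrite -[k.+3]addn3 -[k.+2]addn2 !natrD; lra.
Qed.

(** A series of order two is Lipschitz at scale [l * r] with a constant proportional to [l]; this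
    makes the Picard iteration of the inverse function theorem contract. *)
Lemma comp_lip (r M l s eta : R) phi (F G : V -> V) : 0 < r -> 0 <= l -> l <= 1 / 2 ->
  An (minsize 2) (cst r) M phi -> 0 <= s -> 0 <= eta ->
  (forall i, An predT (cst s) (l * r) (fun z => F z ord0 i)) ->
  (forall i, An predT (cst s) (l * r) (fun z => G z ord0 i)) ->
  (forall i, An predT (cst s) eta (fun z => F z ord0 i - G z ord0 i)) ->
  An predT (cst s) (2 * l * M / r * eta) (fun z => phi (F z) - phi (G z)).
Proof.
move=> r0 l0 l2 [p [k1 k2 k3]] s0 eta0 hF hG hFG; have hn := nneg_cst (n := n) s0.
have lr0 : 0 <= l * r by rewrite mulr_ge0 // ltW.
have lr : l * r <= r by rewrite ler_piMl ?(ltW r0) //; lra.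
have kk0 : 0 <= 2 * l / r * eta by rewrite !mulr_ge0 // invr_ge0 ltW.
apply: (@An_series _ _ predT (cst s) (fun k => 2 * l / r * eta * pnm (cst r) (p k)) _
  (fun k z => pev (F z) (p k) - pev (G z) (p k))) => //.
- move=> k.
  apply: (An_ext (f := fun z => \sum_(t <- p k | minsize 2 t.2) t.1 * (wev (F z) t.2 - wev (G z) t.2))).
    move=> z _; rewrite /pev -sumrB big_seq_cond [RHS]big_seq; apply: eq_big => [t|t _].
      by case: (boolP (t \in p k)) => //= ht; exact: (allP (k1 k)).
    by rewrite mulrBr.
  rewrite /pnm big_distrr /=; move: (k1 k) => /allP; elim: (p k) => [|t q IH] hq.
    apply: (An_ext (f := fun=> 0)) => [z _|]; first by rewrite big_nil.
    by apply: An_const => //; rewrite big_nil nm0.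
  have ht : minsize 2 t.2 by apply: hq; rewrite mem_head.
  apply: (An_ext (f := fun z => t.1 * (wev (F z) t.2 - wev (G z) t.2) +
     \sum_(t <- q | minsize 2 t.2) t.1 * (wev (F z) t.2 - wev (G z) t.2))) => [z _|].
    by rewrite big_cons ht.
  rewrite big_cons; apply: An_add; last by apply: IH => u uq; apply: hq; rewrite inE uq orbT.
  have hsc := An_scale t.1 (word_lip t.2 s0 lr0 eta0 hF hG hFG).
  apply: An_le hsc => //; rewrite [X in _ <= X]mulrCA ler_wpM2l ?nm_ge0 //.
  have -> : wnm (cst r : 'I_n -> R) t.2 = r ^+ size t.2.
    by rewrite /wnm big_const_seq count_predT iter_mulr_1.
  rewrite /minsize in ht; case: (size t.2) ht => [|[|k']] // _ /=.
  have := lam_bound k' l0 l2 => hl.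
  have -> : 2 * l / r * eta * r ^+ k'.+2 = eta * (2 * l * r ^+ k'.+1).
    by rewrite [r ^+ k'.+2]exprS; field; rewrite gt_eqF.
  by rewrite ler_wpM2l // exprMn mulrA ler_wpM2r // exprn_ge0 // ltW.
- move=> N; rewrite -big_distrr /=.
  have -> : 2 * l * M / r * eta = 2 * l / r * eta * M by ring.
  exact: (ler_wpM2l kk0 (k2 N)).
- move=> z hz; apply: (cv_ext (u := fun N => \sum_(k < N) pev (F z) (p k) + -1 * \sum_(k < N) pev (G z) (p k))).
    by move=> N; rewrite mulN1r -sumrB.
  rewrite -[- phi (G z)]mulN1r; apply: cvD; last apply: cvMl.
    by apply: k3 => i; apply: le_trans (An_bound (hF i) hz) _.
  by apply: k3 => i; apply: le_trans (An_bound (hG i) hz) _.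
Qed.

(** The transpose of the usual Jacobian matrix: points are row vectors, so the differential acts by
    right multiplication and the chain rule keeps the order of composition. *)
Definition dmat (F : V -> V) : 'M[C]_n := \matrix_(j, i) pd j (fun z => F z ord0 i) 0.

(** The Picard iteration sends [Z] to [w - phi (Z w)]. Its successive differences are halved in
    norm, so the limit is again a convergent series; the same contraction proves uniqueness of the
    solution and hence the left inverse. *)
Lemma inverse_function_id (r M : R) (phi : 'I_n -> V -> C) : 0 < r ->
  (forall i, An (minsize 2) (cst r) M (phi i)) ->
  exists Z : V -> V, [/\ forall i, O (fun w => Z w ord0 i), Z 0 = 0,
    near0 (fun w => forall i, Z w ord0 i + phi i (Z w) = w ord0 i) &
    near0 (fun z => Z (\row_i (z ord0 i + phi i z)) = z)].
Proof.
move=> r0 hphi.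
(* Chosen so that the constant of [comp_lip] is at most [1 / 2]. Iterates then stay within
   [sg = l * r] over the radius [s = sg / 2], since [s + sg / 2 = sg]. The absolute value covers
   [n = 0], where [M] has no lower bound. *)
have [l [l0 l2 lM]] : exists l : R, [/\ 0 < l, l <= 1 / 2 & 2 * l * `|M| / r <= 1 / 2].
  have e0 : 0 < r / 4 by rewrite divr_gt0.
  have [l [l0 l1 lM]] := small_scale (normr_ge0 M) e0.
  exists (l / 2); split; [by rewrite divr_gt0|by lra|].
  rewrite ler_pdivrMr //; lra.
have M0 : n != 0%N -> 0 <= M.
  by move=> n0; have i : 'I_n := Ordinal (n := n) (m := 0) (ltac:(by rewrite lt0n)); exact: An_ge0 (hphi i).
pose sg := l * r; have sg0 : 0 < sg by rewrite mulr_gt0.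
pose s := sg / 2; have s0 : 0 < s by rewrite divr_gt0.
have hn := nneg_cst (n := n) (ltW s0); have hr := nneg_cst (n := n) (ltW r0).
have hnsg := nneg_cst (n := n) (ltW sg0).
have sgr : sg <= r by rewrite /sg ler_piMl ?(ltW r0) //; lra.
have lip (s' eta : R) i (F G : V -> V) : 0 <= s' -> 0 <= eta ->
  (forall i, An predT (cst s') sg (fun z => F z ord0 i)) ->
  (forall i, An predT (cst s') sg (fun z => G z ord0 i)) ->
  (forall i, An predT (cst s') eta (fun z => F z ord0 i - G z ord0 i)) ->
  An predT (cst s') (eta / 2) (fun z => phi i (F z) - phi i (G z)).
  move=> s0' eta0 hF hG hFG.
  have hl := comp_lip r0 (ltW l0) l2 (hphi i) s0' eta0 hF hG hFG.
  apply: An_le hl; first exact: nneg_cst.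
  have {}M0 : 0 <= M := An_ge0 (hphi i).
  by rewrite ger0_norm // in lM; rewrite mulrC ler_wpM2l //; lra.
have phi0 i : phi i 0 = 0 by exact: An_minsize0 hr (hphi i).
pose Zs := fix Zs k : V -> V := if k is k'.+1 then fun w => \row_i (w ord0 i - phi i (Zs k' w)) else fun=> 0.
have hZ k : forall i, An predT (cst s) sg (fun z => Zs k z ord0 i).
  elim: k => [|k IH] i /=.
    apply: (An_ext (f := fun=> 0)) => [z _|]; first by rewrite mxE.
    by apply: An_const => //; rewrite nm0 ltW.
  apply: (An_ext (f := fun z => z ord0 i - (phi i (Zs k z) - phi i 0))) => [z _|].
    by rewrite !mxE phi0 subr0.
  apply: (@An_le _ _ _ _ (s + sg / 2)) => //; first by rewrite /s; lra.
  apply: An_sub; first exact: An_var.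
  apply: (lip s sg i (Zs k) (fun=> 0)) => //; try exact: ltW.
    move=> j; apply: An_const => //; by rewrite mxE nm0 ltW.
  by move=> j; apply: An_ext (IH j) => z _; rewrite mxE subr0.
have hD k : forall i, An predT (cst s) (sg * (1 / 2) ^+ k) (fun z => Zs k.+1 z ord0 i - Zs k z ord0 i).
  elim: k => [|k IH] i.
    rewrite expr0 mulr1; apply: An_ext (hZ 1%N i) => z _; by rewrite [Zs 0%N z ord0 i]mxE subr0.
  apply: (An_ext (f := fun z => - (phi i (Zs k.+1 z) - phi i (Zs k z)))) => [z _|].
    by rewrite [RHS]/= !mxE /=; ring.
  have -> : sg * (1 / 2) ^+ k.+1 = sg * (1 / 2) ^+ k / 2 by rewrite exprS; field.
  apply: An_opp; apply: lip => //; first exact: ltW.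
  by rewrite mulr_ge0 ?(ltW sg0) // exprn_ge0 // divr_ge0.
have hsum N : \sum_(k < N) sg * (1 / 2) ^+ k <= sg * 2.
  by rewrite -big_distrr /= ler_wpM2l ?(ltW sg0) // geo_half.
have [Z hZlim] := choice (fun i => @An_series_ex _ _ predT (cst s) _ _ _ (fun k => hD k i) hsum hn).
pose ZZ w : V := \row_i Z i w.
have tele N i w : \sum_(k < N) (Zs k.+1 w ord0 i - Zs k w ord0 i) = Zs N w ord0 i.
  elim: N => [|N IH]; first by rewrite big_ord0 mxE.
  by rewrite big_ord_recr /= IH addrC subrK.
have cvZ i w : inD (cst s) w -> cv (fun N => Zs N w ord0 i) (ZZ w ord0 i).
  move=> hw; rewrite mxE; have := (hZlim i).2 w hw; apply: cv_ext => N; exact: tele.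
have ZZsg w : inD (cst s) w -> inD (cst sg) (ZZ w).
  by move=> hw i; apply: cv_nm_le (cvZ i w hw) _ => N; exact: An_bound (hZ N i) hw.
have plip a b eta : inD (cst sg) a -> inD (cst sg) b -> 0 <= eta ->
    (forall i, nm (a ord0 i - b ord0 i) <= eta) -> forall i, nm (phi i a - phi i b) <= eta / 2.
  move=> ha hb eta0 hab i.
  have h1 : nneg (cst 1 : 'I_n -> R) by apply: nneg_cst.
  have := @lip 1 eta i (fun=> a) (fun=> b) ler01 eta0.
  move=> /(_ (fun j => An_const h1 isT (ha j)) (fun j => An_const h1 isT (hb j)) (fun j => An_const h1 isT (hab j))).
  by move=> /An_bound /(_ (inD0 h1)).
have maxd (a b : V) : exists eta, [/\ 0 <= eta, forall i, nm (a ord0 i - b ord0 i) <= eta &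
    forall e : R, 0 <= e -> (forall i, nm (a ord0 i - b ord0 i) <= e) -> eta <= e].
  exists (\big[Num.max/0]_i nm (a ord0 i - b ord0 i)); split.
  - by elim/big_ind: _ => // [x y x0 y0|i _]; [rewrite le_max x0|exact: nm_ge0].
  - by move=> i; exact: (le_bigmax _ (fun i => nm (a ord0 i - b ord0 i))).
  - by move=> e e0 he; elim/big_ind: _ => // x y x0 y0; rewrite ge_max x0.
have solve w : inD (cst s) w -> forall i, ZZ w ord0 i + phi i (ZZ w) = w ord0 i.
  move=> hw i; apply/eqP; rewrite -subr_eq0; apply/eqP; apply: nm_le_eps => e e0.
  have e40 : 0 < e / 4 by rewrite divr_gt0.
  have [N hN] : exists N, forall k, (N <= k)%N -> forall j, nm (Zs k w ord0 j - ZZ w ord0 j) <= e / 4.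
    have [N hN] := choice (fun j => cvZ j w hw _ e40).
    exists (\max_j N j) => k hk j; apply: hN; exact: leq_trans (leq_bigmax j) hk.
  have h1 := hN N (leqnn _); have h2 := hN N.+1 (leqnSn _) i.
  have h3 := @plip (Zs N w) (ZZ w) (e / 4) _ (ZZsg w hw) (ltW e40) h1 i.
  rewrite [Zs N.+1 w ord0 i]/= mxE in h2.
  have -> : ZZ w ord0 i + phi i (ZZ w) - w ord0 i =
     - (w ord0 i - phi i (Zs N w) - ZZ w ord0 i) - (phi i (Zs N w) - phi i (ZZ w)) by ring.
  apply: le_trans (nmB _ _) _; rewrite nmN.
  have : nm (phi i (Zs N w) - phi i (ZZ w)) <= e / 4 / 2.
    by apply: h3 => j; exact: An_bound (hZ N j) hw.
  lra.
exists ZZ; split.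
- move=> i; exists s, (sg * 2); split=> //; apply: An_ext (hZlim i).1 => z _; by rewrite mxE.
- apply/rowP => i; rewrite !mxE; have h0 := inD0 hn.
  transitivity (ZZ 0 ord0 i); first by rewrite mxE.
  apply: (cv_uniq (cvZ i 0 h0)).
  apply: (cv_ext (u := fun=> 0)); last exact: cv_cst.
  move=> N; have -> : Zs N 0 = 0; last by rewrite mxE.
  elim: N => //= N ->; apply/rowP => j; by rewrite !mxE phi0 subr0.
- by exists s; split.
- have hO i : O (fun z => z ord0 i + phi i z).
    apply: O_add; first exact: O_var.
    by exists r, M; split=> //; exact: An_weak (hphi i).
  have hO0 i : (fun z => z ord0 i + phi i z) 0 = 0 by rewrite /= mxE phi0 addr0.
  have [t [t0 /(_ _ t0 (lexx _)) ht]] := O_small_all hO hO0 s0.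
  exists (Num.min t sg); split; first by rewrite lt_min t0.
  move=> z hz; set y := \row_i _.
  have hzt : inD (cst t) z by move=> i; apply: le_trans (hz i) _; rewrite /cst ge_min lexx.
  have hzs : inD (cst sg) z by move=> i; apply: le_trans (hz i) _; rewrite /cst ge_min lexx orbT.
  have hy : inD (cst s) y by move=> i; rewrite mxE; exact: An_bound (ht i) hzt.
  (* Both [ZZ y] and [z] solve the equation with right-hand side [y], so their distance [eta] is at
     most half of itself. *)
  have [eta [eta0 h1 h2]] := maxd (ZZ y) z.
  have h3 := plip _ _ _ (ZZsg y hy) hzs eta0 h1.
  have h4 : eta <= eta / 2.
    apply: h2 => [|i]; first by rewrite divr_ge0.
    have := solve y hy i; rewrite [y ord0 i]mxE => e.
    have -> : ZZ y ord0 i - z ord0 i = - (phi i (ZZ y) - phi i z).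
      have -> : ZZ y ord0 i = z ord0 i + phi i z - phi i (ZZ y) by rewrite -e; ring.
      ring.
    by rewrite nmN.
  have eta00 : eta = 0 by lra.
  apply/rowP => i; apply/eqP; rewrite -subr_eq0 -nm_eq0 eq_le nm_ge0 andbT.
  by have := h1 i; rewrite eta00.
Qed.

Lemma inverse_function (Phi : V -> V) : (forall i, O (fun z => Phi z ord0 i)) -> Phi 0 = 0 ->
  dmat Phi \in unitmx -> exists Psi : V -> V, [/\ forall i, O (fun z => Psi z ord0 i),
    Psi 0 = 0, near0 (fun z => Phi (Psi z) = z) & near0 (fun z => Psi (Phi z) = z)].
Proof.
move=> hO P0 hu; set A := dmat Phi in hu.
pose P' z := Phi z *m invmx A.
have hO' i : O (fun z => P' z ord0 i).
  apply: (@O_ext (fun z => \sum_j Phi z ord0 j * invmx A j i)).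
    by apply: near0_all => z; rewrite mxE.
  by apply: O_sum => j; apply: O_mul => //; exact: O_const.
have P'0 : P' 0 = 0 by rewrite /P' P0 mul0mx.
have dP' i j : pd j (fun z => P' z ord0 i) 0 = (j == i)%:R.
  have hG : grad_at (fun z => P' z ord0 i) 0 (fun j => \sum_k invmx A k i * pd j (fun z => Phi z ord0 k) 0).
    apply: (@grad_at_ext _ _ (fun z => \sum_k invmx A k i * Phi z ord0 k)).
      by apply: near0_all => z; rewrite mxE; apply: eq_bigr => k _; rewrite mulrC.
    apply: grad_at_sum => k; apply: grad_at_eqd (grad_at_mul (grad_at_const (invmx A k i) 0) (Oat_grad_at ((Oat0 _).2 (hO k)))) => m.
    by rewrite mul0r addr0.
  rewrite (grad_at_pd j hG); have := congr1 (fun B : 'M[C]_n => B j i) (mulmxV hu).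
  by rewrite !mxE => <-; apply: eq_bigr => k _; rewrite mxE mulrC.
have [r [r0 [M hM]]] : exists r : R, 0 < r /\ exists M, forall i, An predT (cst r) M (fun z => P' z ord0 i).
  have P'0i i : P' 0 ord0 i = 0 by rewrite P'0 mxE.
  have [s [s0 hs]] := O_small_all hO' P'0i (@ltr01 R).
  by exists s; split=> //; exists 1; exact: hs.
have hphi i : exists g, An (minsize 2) (cst r) M g /\
   forall z, inD (cst r) z -> P' z ord0 i = z ord0 i + g z.
  have [a [g [hg _ eg]]] := An_at1 r0 (hM i); exists g; split=> // z hz.
  rewrite eg // P'0 mxE add0r; congr (_ + _).
  have hG : grad_at (fun z => P' z ord0 i) 0 a.
    have M0 := An_ge0 (hM i).
    exists (r^-1 + M / r ^+ 2); split.
      by rewrite ltr_pwDl ?invr_gt0 // divr_ge0 // exprn_ge0 // ltW.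
    move=> s h s0 hs hh.
    have m0 : 0 <= M / r ^+ 2 * s by rewrite !mulr_ge0 ?invr_ge0 ?exprn_ge0 // ltW.
    have sr : s / r <= 1 by move: hs; rewrite mulrDl [r^-1 * s]mulrC; lra.
    have hr : inD (cst r) h.
      by move=> j; apply: le_trans (hh j) _; move: sr; rewrite ler_pdivrMr // mul1r.
    rewrite add0r eg // P'0 mxE add0r.
    have -> : \sum_i h ord0 i * a i + g h - 0 - \sum_i h ord0 i * a i = g h by ring.
    have l0 : 0 <= s / r by rewrite divr_ge0 // ltW.
    have h' : inD (fun i => s / r * cst r i) h.
      by move=> j; rewrite /cst divfK ?gt_eqF //; exact: hh.
    apply: le_trans (An_bound (An_minsize (nneg_cst (ltW r0)) l0 sr hg) h') _.
    rewrite expr_div_n mulrDl mulrAC [s ^+ 2 * M]mulrC mulrAC lerDr.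
    by rewrite mulr_ge0 ?exprn_ge0 // invr_ge0 ltW.
  rewrite (bigD1 i) //= big1 => [|j ji].
    by rewrite -(grad_at_pd i hG) dP' eqxx mulr1 addr0.
  by rewrite -(grad_at_pd j hG) dP' (negPf ji) mulr0.
have [phi hphi'] := choice hphi.
have [Z [Z1 Z2 Z3 Z4]] := inverse_function_id r0 (fun i => (hphi' i).1).
have eP z : inD (cst r) z -> P' z = \row_i (z ord0 i + phi i z).
  by move=> hz; apply/rowP => i; rewrite [RHS]mxE (hphi' i).2.
pose L z : V := z *m invmx A.
have LO i : O (fun z => L z ord0 i).
  apply: (@O_ext (fun z => \sum_j z ord0 j * invmx A j i)).
    by apply: near0_all => z; rewrite mxE.
  by apply: O_sum => j; apply: O_mul; [exact: O_var|exact: O_const].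
have L0 : L 0 = 0 by rewrite /L mul0mx.
exists (fun z => Z (L z)); split.
- move=> i; apply: (O_comp (f := fun w => Z w ord0 i)) => //; rewrite L0; exact/Oat0.
- by rewrite L0 Z2.
- have hd : near0 (inD (cst r : 'I_n -> R)) by exists r.
  have k1 := near0_comp LO L0 Z3.
  have ZL0 : Z (L 0) = 0 by rewrite L0.
  have hZL i : O (fun z => Z (L z) ord0 i).
    by apply: (O_comp (f := fun w => Z w ord0 i)) => //; rewrite L0; exact/Oat0.
  have k2 := near0_comp hZL ZL0 hd.
  apply: near0_imp (near0_and k1 k2) => z [e1 e2].
  have : P' (Z (L z)) = L z by rewrite eP //; apply/rowP => i; rewrite mxE e1.
  by move=> /(congr1 (fun y => y *m A)); rewrite /P' /L !mulmxKV.
- have hd : near0 (inD (cst r : 'I_n -> R)) by exists r.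
  apply: near0_imp (near0_and Z4 hd) => z [e1 e2].
  by rewrite -[L (Phi z)]/(P' z) eP.
Qed.

End Closure.

(** * Comparison with multi-index power series *)

Section Analytic.
Variables (R : realType) (n : nat).
Notation C := (Cplx R).
Notation V := 'rV[Cplx R]_n.
Notation word := (seq 'I_n).
Notation mi := {ffun 'I_n -> nat}.
Implicit Types (z a h w : V) (f g : V -> C).

Definition expo (w : word) : mi := [ffun i => count_mem i w].
Definition wordof (m : mi) : word := flatten [seq nseq (m i) i | i <- enum 'I_n].
Definition box (N : nat) : seq mi := [seq [ffun i => m i : nat] | m : {ffun 'I_n -> 'I_N}].

Lemma RC_M (x y : R) : RC (x * y) = RC x * RC y. Proof. exact: rmorphM. Qed.
Lemma RC_X (x : R) k : RC (x ^+ k) = RC x ^+ k. Proof. exact: rmorphXn. Qed.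
Lemma RC_sum (I : Type) (s : seq I) (P : pred I) (F : I -> R) :
  RC (\sum_(i <- s | P i) F i) = \sum_(i <- s | P i) RC (F i).
Proof. exact: rmorph_sum. Qed.
Lemma RC_prod (I : Type) (s : seq I) (P : pred I) (F : I -> R) :
  RC (\prod_(i <- s | P i) F i) = \prod_(i <- s | P i) RC (F i).
Proof. exact: rmorph_prod. Qed.

Lemma prod_expo (S : comPzRingType) (F : 'I_n -> S) (w : word) :
  \prod_(i <- w) F i = \prod_i F i ^+ expo w i.
Proof.
elim: w => [|j w IH]; first by rewrite big_nil big1 // => i _; rewrite ffunE.
rewrite big_cons IH (bigD1 j) //= [RHS](bigD1 j) //= mulrA; congr (_ * _).
  by rewrite !ffunE /= eqxx exprS.
by apply: eq_bigr => i ij; rewrite !ffunE /= eq_sym (negPf ij).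
Qed.

Lemma prod_wordof (S : comPzRingType) (F : 'I_n -> S) (m : mi) :
  \prod_(i <- wordof m) F i = \prod_i F i ^+ m i.
Proof.
rewrite /wordof big_flatten /= big_map big_enum /=; apply: eq_bigr => i _.
by rewrite big_nseq; elim: (m i) => //= k ->; rewrite exprS.
Qed.

Lemma mem_box N (m : mi) : (m \in box N) = [forall i, m i < N]%N.
Proof.
apply/idP/idP => [/mapP [m' _ ->]|/forallP h]; first by apply/forallP => i; rewrite ffunE.
apply/mapP; exists [ffun i => Ordinal (h i)]; first by rewrite mem_enum.
by apply/ffunP => i; rewrite !ffunE.
Qed.

Lemma uniq_box N : uniq (box N).
Proof.
rewrite map_inj_uniq ?enum_uniq // => m m' /ffunP e; apply/ffunP => i; apply: val_inj.
by have := e i; rewrite !ffunE.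
Qed.

Lemma box_sum (T : nmodType) N (F : mi -> T) :
  \sum_(m : {ffun 'I_n -> 'I_N}) F [ffun i => m i : nat] = \sum_(m <- box N) F m.
Proof. by rewrite /box big_image. Qed.

Lemma box_perm N : perm_eq (box N.+1) (box N ++ [seq m <- box N.+1 | m \notin box N]).
Proof.
apply: uniq_perm; first exact: uniq_box.
  rewrite cat_uniq uniq_box filter_uniq ?uniq_box // andbT /=.
  by apply/hasPn => m; rewrite mem_filter => /andP[].
move=> m; rewrite mem_cat mem_filter; case: (boolP (m \in box N)) => //=.
by rewrite !mem_box => /forallP h; apply/forallP => i; rewrite ltnS ltnW ?h.
Qed.

Lemma analytic_Oat f a : analytic_at f a -> Oat f a.
Proof.
move=> [c [r0 [M [/pos_RC [r r00 ->] hM hf]]]].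
(* Convergence is given on the open polydisc of radius [r], whereas [An] speaks of a closed one;
   hence half the radius. *)
have r20 : 0 < r / 2 by rewrite divr_gt0.
have r2r : r / 2 <= r by lra.
pose T (m : mi) : C * word := (c m, wordof m).
(* The shell between two consecutive boxes. The box of size 0 is empty except for [n = 0], where
   every box consists of the empty multi-index, which must then be counted once. *)
pose p k := [seq T m | m <- box k.+1 & m \notin box k] ++ (if k == 0%N then [seq T m | m <- box 0] else [::]).
have tele (S : zmodType) (F : C * word -> S) N : (0 < N)%N ->
    \sum_(k < N) \sum_(t <- p k) F t = \sum_(m <- box N) F (T m).
  case: N => // N _; elim: N => [|N IH].
    rewrite big_ord1 /p /= big_cat !(big_map T) big_filter.
    rewrite [RHS](perm_big _ (box_perm 0)) big_cat big_filter; exact: addrC.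
  rewrite big_ord_recr /= IH.
  transitivity (\sum_(m <- box N.+1) F (T m) +
     \sum_(m <- [seq m <- box N.+2 | m \notin box N.+1]) F (T m)).
    by congr (_ + _); rewrite /p cats0 (big_map T).
  by rewrite [RHS](perm_big _ (box_perm N.+1)) big_cat.
have wT z m : wev z (wordof m) = \prod_i z ord0 i ^+ m i by exact: prod_wordof.
have nT (s : R) m : wnm (cst s) (wordof m) = \prod_i s ^+ (m : mi) i by exact: prod_wordof.
exists (r / 2), (nm M); split=> //; exists p; split.
- by move=> k; apply/allP.
- have hb N : \sum_(m <- box N) nm (T m).1 * wnm (cst (r / 2)) (T m).2 <= nm M.
    rewrite -RC_le -nmE -[`|M|]ger0_norm //.
    have := hM N; rewrite -(box_sum N (fun m => nm (T m).1 * wnm (cst (r / 2)) (T m).2)).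
    rewrite RC_sum normr_id => h.
    have h0 : 0 <= M.
      apply: le_trans h; apply: sumr_ge0 => m _; rewrite mulr_ge0 // prodr_ge0 // => i _.
      by rewrite exprn_ge0 // -(rmorph0 (@RC R)) RC_le ltW.
    rewrite ger0_norm //; apply: le_trans h; apply: ler_sum => m _.
    rewrite RC_M -nmE; apply: ler_wpM2l => //.
    rewrite nT RC_prod; apply: ler_prod => i _.
    rewrite RC_X ffunE; apply/andP; split.
      by rewrite exprn_ge0 // -(rmorph0 (@RC R)) RC_le ltW.
    by rewrite -!RC_X RC_le lerXn2r // ?nnegrE ltW.
  case=> [|N]; first by rewrite big_ord0 nm_ge0.
  by rewrite (tele _ (fun t => nm t.1 * wnm (cst (r / 2)) t.2)).
- move=> z hz; have hz' i : `|(a + z) ord0 i - a ord0 i| < RC r.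
    rewrite mxE addrC addKr nmE RC_lt; apply: le_lt_trans (hz i) _; rewrite /cst; lra.
  have /cvP h := hf _ hz'; move=> e /h [N hN]; exists N.+1 => -[//|k] hk.
  rewrite (tele _ (fun t => t.1 * wev z t.2)) //; have := hN k.+1 (ltnW hk).
  rewrite (_ : \sum_(m : {ffun 'I_n -> 'I_k.+1}) _ = \sum_(m <- box k.+1) (T m).1 * wev z (T m).2) //.
  rewrite -box_sum; apply: eq_bigr => m _; congr (_ * _); rewrite wT.
  by apply: eq_bigr => i _; rewrite ffunE mxE [a ord0 i + _]addrC addrK.
Qed.

Lemma cv_tail_le (u : nat -> C) l e N : cv u l -> (forall k, (N <= k)%N -> nm (u k) <= e) ->
  nm l <= e.
Proof.
move=> hu h; apply/ler_addgt0Pl => d d0; have [N1 hN1] := hu _ d0.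
have := hN1 _ (leq_maxl N1 N); have := h _ (leq_maxr N1 N).
by have := nm_lowB l (u (maxn N1 N)); rewrite nm_sub; lra.
Qed.

Lemma Oat_analytic f a : Oat f a -> analytic_at f a.
Proof.
move=> [r [M [r0 [p [k1 k2 k3]]]]]; have hr := nneg_cst (n := n) (ltW r0).
pose rm (m : mi) : R := \prod_i r ^+ m i.
have rm0 m : 0 < rm m by apply: prodr_gt0 => i _; exact: exprn_gt0.
have nmw (w : word) : wnm (cst r) w = rm (expo w) by exact: prod_expo.
(* The contribution of the [k]-th finite sum to the coefficient of the multi-index [m]: all words
   with the same exponents are merged. *)
pose co (m : mi) k : C := \sum_(t <- p k | expo t.2 == m) t.1.
have pB (F : C * word -> R) (q : seq (C * word)) (B : seq mi) : uniq B -> (forall t, 0 <= F t) ->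
    \sum_(m <- B) \sum_(t <- q | expo t.2 == m) F t <= \sum_(t <- q) F t.
  move=> uB F0; rewrite (exchange_big_dep xpredT) //= (bigID (fun t => expo t.2 \in B)) /=.
  rewrite [X in _ + X]big1 ?addr0 => [|t ht]; last first.
    rewrite big_seq_cond big1 // => m /andP[mB /eqP e].
    by rewrite e mB in ht.
  rewrite [X in _ <= X](bigID (fun t => expo t.2 \in B)) /=.
  rewrite -[X in X <= _]addr0; apply: lerD; last by apply: sumr_ge0.
  apply: ler_sum => t ht; rewrite big_mkcond (bigD1_seq (expo t.2)) //= eqxx.
  by rewrite big1_seq ?addr0 // => m /andP[ne _]; rewrite eq_sym (negPf ne).
have coB (B : seq mi) k : uniq B -> \sum_(m <- B) nm (co m k) * rm m <= pnm (cst r) (p k).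
  move=> uB; apply: le_trans (pB (fun t => nm t.1 * wnm (cst r) t.2) _ _ uB _); last first.
    by move=> t; rewrite mulr_ge0 ?nm_ge0 ?wnm_ge0.
  apply: ler_sum => m _.
  apply: (@le_trans _ _ ((\sum_(t <- p k | expo t.2 == m) nm t.1) * rm m)).
    by rewrite ler_wpM2r ?(ltW (rm0 m)) // nm_sum.
  by rewrite big_distrl /= le_eqVlt (_ : _ == _ = true) //; apply/eqP; apply: eq_bigr => t /eqP <-; rewrite nmw.
have coM (B : seq mi) N : uniq B -> \sum_(m <- B) (\sum_(k < N) nm (co m k)) * rm m <= M.
  move=> uB; apply: le_trans (k2 N).
  under eq_bigr do rewrite big_distrl /=.
  by rewrite exchange_big /=; apply: ler_sum => k _; exact: coB.
have hc m : exists l, cv (fun N => \sum_(k < N) co m k) l.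
  apply: (@C_series_cv _ _ (M / rm m)) => N; rewrite ler_pdivlMr //.
  by have := coM [:: m] N isT; rewrite big_seq1.
have [c hc'] := choice hc.
have unif (B : seq mi) e : 0 < e -> exists N, forall K, (N <= K)%N -> forall m, m \in B ->
    nm (\sum_(k < K) co m k - c m) <= e.
  move=> e0; elim: B => [|m B [N hN]]; first by exists 0%N.
  have [N1 hN1] := hc' m e e0; exists (maxn N N1) => K; rewrite geq_max => /andP[h1 h2] m'.
  by rewrite inE => /orP[/eqP ->|]; [exact: hN1|exact: hN].
have cM (B : seq mi) : uniq B -> \sum_(m <- B) nm (c m) * rm m <= M.
  move=> uB; apply/ler_addgt0Pl => e e0.
  pose q := 1 + \sum_(m <- B) rm m.
  have q0 : 0 < q by rewrite ltr_wpDr // sumr_ge0 // => m _; exact: ltW.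
  have [N /(_ N (leqnn _)) hN] := unif B (e / q) (divr_gt0 e0 q0).
  apply: (@le_trans _ _ (\sum_(m <- B) (e / q + \sum_(k < N) nm (co m k)) * rm m)).
    rewrite !big_seq; apply: ler_sum => m mB; rewrite ler_wpM2r ?(ltW (rm0 m)) //.
    have := hN m mB; have := nm_lowB (c m) (\sum_(k < N) co m k); rewrite nm_sub.
    have := nm_sum (index_enum 'I_N) xpredT (fun k : 'I_N => co m k); lra.
  under eq_bigr do rewrite mulrDl.
  rewrite big_split /= -big_distrr /=; apply: lerD; last exact: coM.
  rewrite mulrAC ler_pdivrMr // ler_wpM2l ?(ltW e0) //= lerDr; lra.
exists c, (RC r), (RC M); split; first by rewrite RC_gt0.
  move=> N; apply: (@le_trans _ _ (RC (\sum_(m <- box N) nm (c m) * rm m))); last first.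
    by rewrite RC_le; apply: cM; exact: uniq_box.
  rewrite -box_sum RC_sum; apply: ler_sum => m _; rewrite RC_M nmE; apply: ler_wpM2l.
    by rewrite -nmE.
  rewrite le_eqVlt (_ : _ == _ = true) // /rm RC_prod; apply/eqP; apply: eq_bigr => i _.
  by rewrite RC_X ffunE.
move=> z hz; pose y : V := z - a.
have hy : inD (cst r) y.
  by move=> i; rewrite /cst -RC_le -nmE /y !mxE; exact: ltW (hz i).
have -> : z = a + y by rewrite /y addrC subrK.
apply/cvP.
apply: (cv_ext (u := fun N => \sum_(m <- box N) c m * \prod_i y ord0 i ^+ m i)).
  move=> N; rewrite -box_sum; apply: eq_bigr => m _; congr (_ * _); apply: eq_bigr => i _.
  by rewrite ffunE (_ : (a + y) ord0 i - a ord0 i = y ord0 i) // /y !mxE; ring.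
have bc (B : seq mi) : uniq B -> cv (fun N => \sum_(k < N) pev y [seq t <- p k | expo t.2 \in B])
    (\sum_(m <- B) c m * \prod_i y ord0 i ^+ m i).
  move=> uB.
  apply: (cv_ext (u := fun N => \sum_(m <- B) (\sum_(k < N) co m k) * \prod_i y ord0 i ^+ m i)).
    move=> N; under eq_bigr do rewrite big_distrl /=.
    rewrite exchange_big /=; apply: eq_bigr => k _; rewrite /pev big_filter /co.
    under eq_bigr do rewrite big_distrl /=.
    rewrite (exchange_big_dep xpredT) //= [LHS](bigID (fun t => expo t.2 \in B)) /=.
    rewrite [X in _ + X]big1 ?addr0 => [|t ht]; last first.
      rewrite big_seq_cond big1 // => m /andP[mB /eqP e].
      by rewrite e mB in ht.
    apply: eq_bigr => t ht; rewrite big_mkcond (bigD1_seq (expo t.2)) //= eqxx.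
    rewrite [X in _ + X]big1_seq ?addr0 => [|m /andP[ne _]]; first by congr (_ * _); exact: esym (prod_expo _ _).
    by rewrite eq_sym (negPf ne).
  elim: B uB => [|m B IH] /=.
    by move=> _; apply: (cv_ext (u := fun=> 0)); rewrite ?big_nil; [move=> N; rewrite big_nil|exact: cv_cst].
  move=> /andP[_ /IH h]; rewrite big_cons.
  apply: (cv_ext (u := fun N => (\sum_(k < N) co m k) * \prod_i y ord0 i ^+ m i +
     \sum_(m <- B) (\sum_(k < N) co m k) * \prod_i y ord0 i ^+ m i)); first by move=> N; rewrite big_cons.
  by apply: cvD => //; apply: cvM; [exact: hc'|exact: cv_cst].
move=> e e0; have e20 : 0 < e / 2 by rewrite divr_gt0.
have p0 k : 0 <= pnm (cst r) (p k) by exact: pnm_ge0.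
have [N0 hN0] := series_tail p0 k2 e20.
(* Beyond [N1] the box contains every exponent that occurs before [N0], so the box sum differs from
   the series only by words in the tail. *)
have [N1 hN1] : exists N1, forall k, (k < N0)%N -> forall t, t \in p k -> forall i, (expo t.2 i < N1)%N.
  have [N1 hN1] : exists N1, forall k, (k < N0)%N -> forall t, t \in p k -> (size t.2 < N1)%N.
    elim: N0 {hN0} => [|N0 [N1 IH]]; first by exists 0%N.
    exists (maxn N1 (\max_(t <- p N0) size t.2).+1) => k; rewrite ltnS leq_eqVlt => /orP[/eqP ->|hk] t ht.
      by rewrite leq_max ltnS [X in _ || X](_ : _ = true) ?orbT //; exact: leq_bigmax_seq.
    by rewrite leq_max (IH k hk t ht).
  exists N1 => k hk t ht i; rewrite ffunE; exact: leq_ltn_trans (count_size _ _) (hN1 k hk t ht).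
exists N1 => N hN; rewrite -nmN opprB.
have hl : cv (fun K => \sum_(k < K) pev y (p k) + -1 * \sum_(k < K) pev y [seq t <- p k | expo t.2 \in box N])
   (f (a + y) - \sum_(m <- box N) c m * \prod_i y ord0 i ^+ m i).
  by rewrite -[- (\sum_(m <- box N) _)]mulN1r; apply: cvD; [exact: k3|apply: cvMl; exact: bc (uniq_box N)].
apply: (cv_tail_le hl (N := N0)) => K hK; apply: (@le_trans _ _ (e / 2)); last by lra.
apply: le_trans (hN0 K); rewrite mulN1r -sumrB.
rewrite -(big_mkord xpredT (fun k => pev y (p k) - pev y [seq t <- p k | expo t.2 \in box N])).
rewrite (@big_cat_nat _ _ _ N0) //= big_nat_cond big1 ?add0r => [|k /andP[/andP[_ hk] _]].
  apply: le_trans (nm_sum _ _ _) _; apply: ler_sum => k _.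
  rewrite /pev big_filter [X in X - _](bigID (fun t => expo t.2 \in box N)) /= addrAC subrr add0r.
  apply: le_trans (nm_sum _ _ _) _; rewrite /pnm [X in _ <= X](bigID (fun t => expo t.2 \in box N)) /=.
  rewrite -[X in X <= _]add0r; apply: lerD.
    by apply: sumr_ge0 => t _; rewrite mulr_ge0 ?nm_ge0 ?wnm_ge0.
  by apply: ler_sum => t _; rewrite nmM ler_wpM2l ?nm_ge0 ?wev_le.
rewrite (_ : [seq t <- p k | _] = p k) ?subrr //; apply/all_filterP/allP => t ht.
rewrite mem_box; apply/forallP => i; exact: leq_trans (hN1 k hk t ht i) hN.
Qed.

Lemma analyticP f a : analytic_at f a <-> Oat f a.
Proof. by split; [exact: analytic_Oat|exact: Oat_analytic]. Qed.

End Analytic.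

(** * A first-order linear differential equation *)

Section LinearEquation.
Variables (R : realType) (n : nat).
Notation C := (Cplx R).
Notation V := 'rV[Cplx R]_n.
Notation word := (seq 'I_n).
Implicit Types (z : V) (f g : V -> C).

Lemma An_grad_at_in (r s : R) M f a : 0 <= s -> s < r -> An predT (cst r) M f -> inD (cst s) a ->
  grad_at f a (fun i => pd i f a) /\ forall i, nm (pd i f a) <= M / (r - s).
Proof.
move=> s0 sr hf ha; have rs : 0 < r - s by rewrite subr_gt0.
exact: An_grad_at rs (An_recenter ha s0 (ltW sr) hf).
Qed.

(** Cauchy's estimate for the derivative is applied to the remainder of the series, whose norm tends
    to zero. *)
Lemma series_pd (r s : R) (M : nat -> R) K (f : nat -> V -> C) F i z : 0 <= s -> s < r ->
  (forall k, An predT (cst r) (M k) (f k)) -> (forall N, \sum_(k < N) M k <= K) ->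
  (forall z, inD (cst r) z -> cv (fun N => \sum_(k < N) f k z) (F z)) -> inD (cst s) z ->
  cv (fun N => \sum_(k < N) pd i (f k) z) (pd i F z).
Proof.
move=> s0 sr hf hK hF hz e e0; have rs : 0 < r - s by rewrite subr_gt0.
have r0 : 0 <= r by rewrite (le_trans s0) ?ltW.
have hr := nneg_cst (n := n) r0.
have e1 : 0 < e * (r - s) by rewrite mulr_gt0.
have M0 k : 0 <= M k := An_ge0 (hf k).
have [N0 hN0] := series_tail M0 hK e1.
exists N0 => N hN.
have hT : An predT (cst r) (e * (r - s)) (fun z => F z - \sum_(k < N) f k z).
  apply: (@An_series _ _ _ _ (fun k => M (N + k)%N) _ (fun k => f (N + k)%N)) => //.
    move=> K'; rewrite -sum_shift; apply: le_trans (hN0 (N + K')%N).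
    rewrite [X in _ <= X](@big_cat_nat _ _ _ N) ?leq_addr //= lerDr.
    by apply: sumr_ge0.
  move=> y hy; apply: (cv_ext (u := fun K' => \sum_(k < N + K') f k y + - \sum_(k < N) f k y)).
    move=> K'; rewrite -!(big_mkord xpredT (fun k => f k y)).
    by rewrite (@big_cat_nat _ _ _ N) ?leq_addr //= addrAC subrr add0r (sum_shift (fun k => f k y)).
  apply: cvD; last exact: cv_cst.
  move=> e2 /(hF y hy) [N2 hN2]; exists N2 => k hk; apply: hN2.
  by rewrite (leq_trans hk) // leq_addl.
have hFA : An predT (cst r) K F by exact: (An_series hf hK hr hF).
have [hG _] := An_grad_at_in s0 sr hFA hz.
have [_ /(_ i)] := An_grad_at_in s0 sr hT hz.
have hS := grad_at_sum (fun k : 'I_N => (An_grad_at_in s0 sr (hf k) hz).1).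
have hS' := grad_at_add hG (grad_at_mul (grad_at_const (-1) z) hS).
rewrite (@grad_at_pd _ _ _ z _ i (grad_at_ext _ hS')); last first.
  by apply: near0_all => y; ring.
rewrite mul0r addr0 mulN1r mulfK ?gt_eqF // => h1.
by rewrite nm_sub.
Qed.

Lemma grad_at_varX i0 k a : grad_at (fun z : V => z ord0 i0 ^+ k) a
  (fun i => (i == i0)%:R * k%:R * a ord0 i0 ^+ k.-1).
Proof.
elim: k => [|k IH].
  apply: (@grad_at_ext _ _ (fun=> 1)); first by apply: near0_all => z; rewrite expr0.
  by apply: grad_at_eqd (grad_at_const _ _) => i; rewrite mulr0 mul0r.
apply: (@grad_at_ext _ _ (fun z : V => z ord0 i0 * z ord0 i0 ^+ k)).
  by apply: near0_all => z; rewrite exprS.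
apply: grad_at_eqd (grad_at_mul (grad_at_var i0 a) IH) => i.
case: k {IH} => [|k] /=; first by rewrite !expr0; ring.
rewrite -[k.+2]add1n natrD exprS; ring.
Qed.

Variables (b : 'I_n -> V -> C) (a : V -> C) (i0 : 'I_n).
Definition fieldop f z : C := \sum_i b i z * pd i f z - a z * f z.

Hypothesis b1 : forall z, b i0 z = 1.

(** Because [b i0] is 1, differentiating the power of [z_i0] produces exactly one extra term. In the
    exponential series it cancels against the second term of the preceding summand. *)
Lemma fieldop_term (c : C) k g z : grad_at g z (fun i => pd i g z) ->
  fieldop (fun z => c * z ord0 i0 ^+ k * g z) z =
  c * k%:R * z ord0 i0 ^+ k.-1 * g z + c * z ord0 i0 ^+ k * fieldop g z.
Proof.
move=> hg; have hG := grad_at_mul (grad_at_mul (grad_at_const c z) (grad_at_varX i0 k z)) hg.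
have -> : fieldop (fun z => c * z ord0 i0 ^+ k * g z) z = \sum_i b i z * (c * z ord0 i0 ^+ k * pd i g z +
    c * ((i == i0)%:R * k%:R * z ord0 i0 ^+ k.-1) * g z) - a z * (c * z ord0 i0 ^+ k * g z).
  by congr (_ - _); apply: eq_bigr => i _; rewrite (grad_at_pd i hG) mul0r addr0.
rewrite /fieldop mulrBr big_distrr /= addrA; congr (_ - _); last by ring.
rewrite (_ : \sum_i _ = \sum_i (c * z ord0 i0 ^+ k * (b i z * pd i g z) +
   c * k%:R * z ord0 i0 ^+ k.-1 * g z * (b i z * (i == i0)%:R))); last first.
  by apply: eq_bigr => i _; ring.
rewrite big_split /= -big_distrr /= -big_distrr /= [X in _ + _ * X](bigD1 i0) //= eqxx b1.
rewrite [X in _ * (_ + X)]big1 ?addr0 ?mulr1 => [|i /negPf ->]; last by rewrite mulr0.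
by rewrite addrC big_distrr.
Qed.

(** Follows from the bound of [(1 + 1 / k) ^+ k] by the number e. It converts the power [k ^+ k]
    caused by [k] successive Cauchy estimates into a factorial. *)
Lemma fact_bound k : k%:R ^+ k <= expR 1 ^+ k * k`!%:R :> R.
Proof.
elim: k => [|k IH]; first by rewrite !expr0 mul1r.
case: k IH => [_|k IH].
  by rewrite !expr1 mulr1; have := expR_ge1Dx (1 : R); lra.
have k0 : 0 < k.+1%:R :> R by rewrite ltr0n.
have h1 : (k.+2%:R / k.+1%:R) ^+ k.+1 <= expR 1 :> R.
  have -> : expR 1 = expR (k.+1%:R^-1) ^+ k.+1 :> R.
    by rewrite -expRM_natl mulrC mulVf // gt_eqF.
  rewrite lerXn2r ?nnegrE ?expR_ge0 ?divr_ge0 //; apply: le_trans (expR_ge1Dx _).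
  by rewrite -[k.+2]addn1 natrD mulrDl divff ?gt_eqF // mul1r.
rewrite exprS [expR 1 ^+ _]exprS factS natrM.
have -> : k.+2%:R ^+ k.+1 = (k.+2%:R / k.+1%:R) ^+ k.+1 * k.+1%:R ^+ k.+1 :> R.
  by rewrite -exprMn divfK // gt_eqF.
have -> : expR 1 * expR 1 ^+ k.+1 * (k.+2%:R * (k.+1)`!%:R) =
   k.+2%:R * (expR 1 * (expR 1 ^+ k.+1 * (k.+1)`!%:R)) :> R by ring.
rewrite ler_wpM2l // ler_pM ?exprn_ge0 ?divr_ge0 //.
Qed.

Lemma fieldop_iter Q (r : R) (B : 'I_n -> R) A M f : 0 < r -> subQ Q -> catQ Q -> Q [::] ->
  (forall i, An Q (cst r) (B i) (b i)) -> An Q (cst r) A a -> An Q (cst r) M f ->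
  exists K : R, 0 <= K /\ forall k, An Q (cst (r / 2)) (M * K ^+ k * k`!%:R) (iter k fieldop f).
Proof.
move=> r0 sQ cQ nQ hb ha hf; have A0 := An_ge0 ha; have M0 := An_ge0 hf.
have B0 i : 0 <= B i := An_ge0 (hb i).
(* The term [A * r] absorbs the operator of order zero: a step is at most [r], so [A] is at most
   [A * r] divided by the step. *)
pose L := \sum_i B i + A * r.
have SB0 : 0 <= \sum_i B i by apply: sumr_ge0.
have L0 : 0 <= L by rewrite addr_ge0 // mulr_ge0 // ltW.
have step (s t N : R) g : 0 <= s -> s < t -> t <= r -> An Q (cst t) N g ->
    An Q (cst s) (N * (L / (t - s))) (fieldop g).
  move=> s0 st tr hg; have hs := nneg_cst (n := n) s0; have ts : 0 < t - s by rewrite subr_gt0.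
  have N0 := An_ge0 hg.
  have sr : s <= r by rewrite (le_trans (ltW st)).
  have mono X h : An Q (cst r) X h -> An Q (cst s) X h by apply: An_mono.
  apply: (@An_le _ _ _ _ (\sum_i B i * (N / (t - s)) + A * N)) => //.
    rewrite -big_distrl /= -subr_ge0.
    have -> : N * (L / (t - s)) - ((\sum_i B i) * (N / (t - s)) + A * N) =
       A * N * (r - (t - s)) / (t - s).
      by rewrite /L; field; rewrite gt_eqF.
    by rewrite divr_ge0 ?(ltW ts) // mulr_ge0 ?mulr_ge0 // subr_ge0; lra.
  apply: An_sub; last apply: An_mul => //; try exact: mono.
    apply: An_sum => // i; apply: An_mul => //; first exact: mono.
    exact: An_pd.
  by apply: An_mono hg => //; move=> i; exact: ltW.
exists (2 * L / r * expR 1); split; first by rewrite !mulr_ge0 ?invr_ge0 ?expR_ge0 // ltW.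
case=> [|k].
  rewrite expr0 mulr1 mulr1; apply: An_mono hf => //; first by apply: nneg_cst; lra.
  by move=> i; rewrite /cst; lra.
have k0 : 0 < k.+1%:R :> R by rewrite ltr0n.
pose d := r / 2 / k.+1%:R; have d0 : 0 < d by rewrite !divr_gt0.
have dk : k.+1%:R * d = r / 2 by rewrite /d mulrC divfK // gt_eqF.
have it j : (j <= k.+1)%N -> An Q (cst (r - j%:R * d)) (M * (L / d) ^+ j) (iter j fieldop f).
  elim: j => [_|j IH jk]; first by rewrite mul0r subr0 expr0 mulr1.
  have jd : j.+1%:R * d <= r / 2 by rewrite -dk ler_wpM2r ?(ltW d0) // ler_nat.
  have e : j.+1%:R * d = j%:R * d + d by rewrite -[j.+1]addn1 natrD mulrDl mul1r.
  have j0 : 0 <= j%:R * d by rewrite mulr_ge0 // ltW.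
  have h1 : 0 <= r - j.+1%:R * d by lra.
  have h2 : r - j.+1%:R * d < r - j%:R * d by lra.
  have h3 : r - j%:R * d <= r by lra.
  have := step _ _ _ _ h1 h2 h3 (IH (ltnW jk)).
  rewrite (_ : r - j%:R * d - (r - j.+1%:R * d) = d); last by rewrite e; ring.
  by rewrite exprSr [M * (_ * _)]mulrA.
have := it k.+1 (leqnn _); rewrite dk (_ : r - r / 2 = r / 2); last by field.
apply: An_le; first by apply: nneg_cst; lra.
rewrite -mulrA ler_wpM2l //.
have -> : L / d = 2 * L / r * k.+1%:R by rewrite /d; field; rewrite !gt_eqF.
have X0 : 0 <= 2 * L / r by rewrite !mulr_ge0 ?invr_ge0 // ltW.
move: X0; set X := 2 * L / r => X0; clearbody X; rewrite !exprMn -mulrA ler_wpM2l ?exprn_ge0 //.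
exact: fact_bound.
Qed.

(* F is the series \sum_k (- z_i0)^k / k! T^k f, T being [fieldop]. *)
Lemma solve_field Q f : subQ Q -> catQ Q -> Q [::] -> Q [:: i0] -> (forall i, O_ Q (b i)) -> O_ Q a ->
  O_ Q f -> exists F, [/\ O_ Q F, near0 (fun z => fieldop F z = 0) &
    near0 (fun z => z ord0 i0 = 0 -> F z = f z)].
Proof.
move=> sQ cQ nQ iQ hb ha hf.
have [r [r0 [B [A [M [hB hA hM]]]]]] : exists r : R, 0 < r /\ exists (B : 'I_n -> R) (A M : R),
   [/\ forall i, An Q (cst r) (B i) (b i), An Q (cst r) A a & An Q (cst r) M f].
  have [rb hrb] := choice hb; have [B hB] := choice hrb.
  have [ra [A [ra0 hA]]] := ha; have [rf [M [rf0 hM]]] := hf.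
  have [s [s0 hs]] : exists s, 0 < s /\ forall i, s <= rb i.
    suff [s [s0 hs]] : exists s, 0 < s /\ forall i, i \in enum 'I_n -> s <= rb i.
      by exists s; split=> // i; apply: hs; rewrite mem_enum.
    elim: (enum 'I_n) => [|i l [s [s0 hs]]]; first by exists 1.
    exists (Num.min (rb i) s); split; first by rewrite lt_min s0 (hB i).1.
    by move=> j; rewrite inE => /orP[/eqP ->|/hs h']; rewrite ge_min ?lexx // h' orbT.
  pose r := Num.min s (Num.min ra rf).
  have r0 : 0 < r by rewrite !lt_min s0 ra0.
  have rr : nneg (cst r : 'I_n -> R) by apply: nneg_cst; exact: ltW.
  exists r; split=> //; exists B, A, M; split.
  - move=> i; apply: An_mono (hB i).2 => // j; rewrite /cst /r ge_min; by rewrite hs.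
  - by apply: An_mono hA => // j; rewrite /cst /r !ge_min lexx orbT.
  - by apply: An_mono hM => // j; rewrite /cst /r !ge_min lexx !orbT.
have [K [K0 hK]] := fieldop_iter r0 sQ cQ nQ hB hA hM.
have M0 := An_ge0 hM.
(* This gives [s * K <= 1 / 4]: the series is dominated by a geometric one, and the residual term,
   which carries an extra factor [N.+1 <= 2 ^+ N], still decays like [(1 / 2) ^+ N]. *)
pose s := Num.min (r / 2) (1 / (4 * (K + 1))).
have K1 : 0 < 4 * (K + 1) by rewrite mulr_gt0 // ltr_wpDl.
have s0 : 0 < s by rewrite lt_min !divr_gt0.
have sr : s <= r / 2 by rewrite /s ge_min lexx.
have sK : s * K <= 1 / 4.
  have : s <= 1 / (4 * (K + 1)) by rewrite /s ge_min lexx orbT.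
  rewrite ler_pdivlMr // => h; have := mulr_ge0 (ltW s0) K0; lra.
have hs := nneg_cst (n := n) (ltW s0).
pose c k : C := (-1) ^+ k / k`!%:R.
have fk k : 0 < k`!%:R :> R by rewrite ltr0n fact_gt0.
have ck k : nm (c k) = (k`!%:R)^-1 by rewrite /c nmM nmX nmN nm1 expr1n mul1r nmV nm_nat.
pose t k z : C := c k * (z : V) ord0 i0 ^+ k * iter k fieldop f z.
have hit k : An Q (cst s) (M * K ^+ k * k`!%:R) (iter k fieldop f).
  by apply: An_mono (hK k).
have ht k : An Q (cst s) (M * (1 / 2) ^+ k) (t k).
  have := An_mul hs cQ (An_scale (c k) (An_exp k hs nQ cQ (An_var hs iQ))) (hit k).
  apply: An_le => //; rewrite ck /cst.
  have -> : (k`!)%:R^-1 * s ^+ k * (M * K ^+ k * (k`!)%:R) = M * (s * K) ^+ k.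
    by rewrite exprMn; field; rewrite gt_eqF.
  rewrite ler_wpM2l // lerXn2r // ?nnegrE ?divr_ge0 ?mulr_ge0 // ?(ltW s0) //; lra.
have hsum N : \sum_(k < N) M * (1 / 2) ^+ k <= M * 2.
  by rewrite -big_distrr /= ler_wpM2l // geo_half.
have [F [hF eF]] := An_series_ex ht hsum hs.
have s20 : 0 <= s / 2 by rewrite divr_ge0 // ltW.
have s2s : s / 2 < s by lra.
exists F; split; first by exists s, (M * 2).
- exists (s / 2); split; first by rewrite divr_gt0.
  move=> z hz; have hzs : inD (cst s) z by move=> i; apply: le_trans (hz i) (ltW s2s).
  have cvT : cv (fun N => \sum_(k < N) fieldop (t k) z) (fieldop F z).
    apply: (cv_ext (u := fun N => (\sum_i b i z * \sum_(k < N) pd i (t k) z) + - a z * \sum_(k < N) t k z)).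
      move=> N; rewrite mulNr big_distrr /= [RHS]sumrB; congr (_ - _).
      rewrite [RHS]exchange_big; apply: eq_bigr => i _; by rewrite big_distrr.
    rewrite /fieldop -mulNr; apply: cvD; last by apply: cvMl; exact: eF.
    apply: cv_sum => i; apply: cvMl.
    apply: (series_pd i s20 s2s (fun k => An_weak hs (ht k)) hsum eF hz).
  (* Consecutive summands cancel since [c N = - (c N.+1 * N.+1)]; only the last term with the
     highest iterate survives, and it tends to zero. *)
  have tele N : \sum_(k < N.+1) fieldop (t k) z = c N * z ord0 i0 ^+ N * iter N.+1 fieldop f z.
    have grad_ati k : grad_at (iter k fieldop f) z (fun i => pd i (iter k fieldop f) z).
      by have [] := An_grad_at_in s20 s2s (An_weak hs (hit k)) hz.
    elim: N => [|N IH].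
      by rewrite big_ord1 (fieldop_term _ _ (grad_ati 0%N)) mulr0 !mul0r add0r.
    rewrite big_ord_recr /= IH (fieldop_term _ _ (grad_ati N.+1)) /= addrA.
    rewrite -[RHS]add0r; congr (_ + _).
    have -> : c N = - (c N.+1 * N.+1%:R).
      rewrite /c exprS factS natrM; field.
      by apply/andP; split; rewrite -nm_eq0 -?(natrD _ 1) nm_nat gt_eqF // ltr0n.
    by ring.
  apply: nm_le_eps => e e0.
  have cv0 : cv (fun N => \sum_(k < N.+1) fieldop (t k) z) (fieldop F z) := cv_shift cvT.
  have hN N : nm (\sum_(k < N.+1) fieldop (t k) z) <= M * K * (1 / 2) ^+ N.
    rewrite tele (nmM (c N * _)) (nmM (c N)) ck nmX.
    have h1 := An_bound (hit N.+1) hzs.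
    have h2 : nm (z ord0 i0) ^+ N <= s ^+ N.
      by rewrite lerXn2r ?nnegrE ?nm_ge0 // ?(ltW s0) //; exact: hzs.
    apply: (@le_trans _ _ ((N`!)%:R^-1 * s ^+ N * (M * K ^+ N.+1 * (N.+1)`!%:R))).
      by apply: ler_pM => //; rewrite ?nm_ge0 ?mulr_ge0 ?invr_ge0 ?exprn_ge0 ?nm_ge0 ?ler_wpM2l ?invr_ge0 ?(ltW (fk _)).
    have -> : (N`!)%:R^-1 * s ^+ N * (M * K ^+ N.+1 * (N.+1)`!%:R) = M * K * (N.+1%:R * (s * K) ^+ N).
      by rewrite factS natrM exprMn exprS; field; rewrite gt_eqF.
    rewrite ler_wpM2l ?mulr_ge0 //.
    apply: (@le_trans _ _ (2 ^+ N * (1 / 4) ^+ N)).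
      apply: ler_pM; rewrite ?exprn_ge0 ?mulr_ge0 ?(ltW s0) //.
        by rewrite -natrX ler_nat ltn_expl.
      by rewrite lerXn2r // ?nnegrE ?divr_ge0 ?mulr_ge0 // ltW.
    by rewrite -exprMn (_ : 2 * (1 / 4) = 1 / 2 :> R) //; field.
  have [N0 hN0] : exists N0, forall N, (N0 <= N)%N -> M * K * (1 / 2) ^+ N <= e.
    have MK : 0 < M * K + 1 by rewrite ltr_wpDl // mulr_ge0.
    have := @cv_geo R (RC (1 / 2)) (1 / 2) _ _ (e / (M * K + 1)) (divr_gt0 e0 MK).
    rewrite nm_RC ger0_norm ?divr_ge0 // => /(_ _ (lexx _)) [|N0 h]; first lra.
    exists N0 => N /h; rewrite subr0 nmX nm_RC ger0_norm ?divr_ge0 // ler_pdivlMr // => h1.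
    have := exprn_ge0 N (_ : 0 <= 1 / 2 :> R); rewrite divr_ge0 // => /(_ isT); lra.
  by apply: (cv_tail_le cv0 (N := N0)) => k hk; apply: le_trans (hN k) (hN0 k hk).
- exists s; split=> // z hz z0; apply: (cv_uniq (eF z hz)) => e e0; exists 1%N => -[//|N] _.
  rewrite big_ord_recl /= big1 => [|k _].
    by rewrite /t /c /= expr0 fact0 invr1 !mulr1 mul1r addr0 subrr nm0 ltW.
  by rewrite /t z0 /= exprS !mul0r mulr0 mul0r.
Qed.

End LinearEquation.

(** * Weierstrass division and preparation *)

Section PolyC.
Variable R : realType.
Notation C := (Cplx R).
Implicit Types (p r : {poly C}) (a t : C).

Lemma poly_lip p a : exists K : R, 0 <= K /\ forall s, nm s <= 1 -> nm (p.[a + s] - p.[a]) <= K * nm s.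
Proof.
elim/poly_ind: p => [|p c [K [K0 hK]]].
  by exists 0; split=> // s _; rewrite !horner0 subrr nm0 mul0r.
exists (K * (nm a + 1) + nm p.[a]); split.
  by rewrite addr_ge0 ?nm_ge0 // mulr_ge0 // addr_ge0 ?nm_ge0.
move=> s s1; rewrite !hornerMXaddC.
have -> : p.[a + s] * (a + s) + c - (p.[a] * a + c) = (p.[a + s] - p.[a]) * (a + s) + p.[a] * s.
  by ring.
apply: le_trans (nmD _ _) _; rewrite !nmM mulrDl lerD2r mulrAC.
apply: ler_pM; rewrite ?nm_ge0 ?hK //.
by apply: le_trans (nmD _ _) _; rewrite lerD2l.
Qed.

(** The bound forces [r] to vanish at each listed root. After cancelling [t - a] the bound holds
    away from [a], and at [a] by continuity, so repeated roots are handled by the induction. *)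
Lemma poly_bounded_dvd (rs : seq C) r (rho K : R) : (forall a, a \in rs -> nm a < rho) ->
  (forall t, nm t <= rho -> nm r.[t] <= K * nm (\prod_(a <- rs) ('X - a%:P)).[t]) ->
  exists s, r = s * \prod_(a <- rs) ('X - a%:P).
Proof.
elim: rs r => [|a rs IH] r hrs hr.
  by exists r; rewrite big_nil mulr1.
have ha : nm a < rho by apply: hrs; rewrite mem_head.
have ra : root r a.
  apply/rootP/eqP; rewrite -nm_eq0 eq_le nm_ge0 andbT; apply: le_trans (hr a (ltW ha)) _.
  by rewrite big_cons hornerM hornerXsubC subrr mul0r nm0 mulr0.
have /factor_theorem [r1 er1] := ra.
set W := \prod_(a <- rs) ('X - a%:P) in IH *.
have h1 t : nm t <= rho -> t != a -> nm r1.[t] <= K * nm W.[t].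
  move=> ht ta; have := hr t ht; rewrite er1 big_cons !hornerM hornerXsubC !nmM.
  have t0 : 0 < nm (t - a) by rewrite nm_gt0 subr_eq0.
  move=> h3; rewrite -(ler_pM2l t0) mulrC; apply: le_trans h3 _.
  by rewrite mulrCA.
have h2 t : nm t <= rho -> nm r1.[t] <= K * nm W.[t].
  move=> ht; have [->|] := eqVneq t a; last exact: h1.
  have [K1 [K10 hK1]] := poly_lip r1 a; have [K2 [K20 hK2]] := poly_lip W a.
  apply/ler_addgt0Pl => e e0.
  pose q := K1 + `|K| * K2 + 1.
  have q0 : 0 < q by rewrite ltr_wpDl // addr_ge0 // mulr_ge0.
  pose s := Num.min 1 (Num.min (rho - nm a) (e / q)).
  have s0 : 0 < s by rewrite !lt_min subr_gt0 ha ltr01 divr_gt0.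
  have [s1 [s2 s3]] : s <= 1 /\ (s <= rho - nm a /\ s <= e / q).
    by rewrite /s !ge_min !lexx !orbT.
  have ns : nm (RC s) = s by rewrite nm_RC ger0_norm // ltW.
  have as_ : a + RC s != a.
    by rewrite -subr_eq0 addrAC subrr add0r -nm_eq0 ns gt_eqF.
  have asr : nm (a + RC s) <= rho by apply: le_trans (nmD _ _) _; rewrite ns; lra.
  have k0 := h1 _ asr as_.
  have k1 := hK1 (RC s); rewrite ns in k1; have {}k1 := k1 s1.
  have k2 := hK2 (RC s); rewrite ns in k2; have {}k2 := k2 s1.
  have k3 := nm_lowB r1.[a] r1.[a + RC s]; rewrite nm_sub in k3.
  have k4 := nm_lowB W.[a + RC s] W.[a].
  have k5 : K * nm W.[a + RC s] <= K * nm W.[a] + `|K| * (K2 * s).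
    rewrite -lerBlDl -mulrBr; apply: le_trans (ler_norm _) _; rewrite normrM ler_wpM2l //.
    apply: le_trans k2; rewrite ler_norml; apply/andP; split=> //.
    by have := nm_lowB W.[a] W.[a + RC s]; rewrite nm_sub; lra.
  have k6 : q * s <= e by rewrite mulrC -ler_pdivlMr.
  have : q * s = K1 * s + `|K| * (K2 * s) + s by rewrite /q; ring.
  lra.
have [s es] := IH r1 (fun b hb => hrs b (mem_behead (s := a :: rs) hb)) h2.
by exists s; rewrite big_cons er1 es -/W -mulrA [W * _]mulrC.
Qed.

Lemma prod_XsubC_monic_split (W : {poly C}) : W \is monic ->
  exists rs : seq C, W = \prod_(a <- rs) ('X - a%:P).
Proof.
move=> /monicP hW; have [rs e] := closed_field_poly_normal W; exists rs.
by rewrite e hW scale1r.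
Qed.

Lemma poly_bounded_dvdp (W r : {poly C}) (rho K : R) : W \is monic ->
  (forall a, root W a -> nm a < rho) ->
  (forall t, nm t <= rho -> nm r.[t] <= K * nm W.[t]) -> W %| r.
Proof.
move=> hW hr hb; have [rs e] := prod_XsubC_monic_split hW.
have [|t ht|s es] := @poly_bounded_dvd rs r rho K.
- by move=> a ha; apply: hr; rewrite e root_prod_XsubC.
- by rewrite -e; exact: hb.
- by apply/dvdpP; exists s; rewrite e.
Qed.

Lemma poly_order_eq0 r (d : nat) (rho K : R) : 0 < rho -> (size r <= d)%N ->
  (forall t, nm t <= rho -> nm r.[t] <= K * nm t ^+ d) -> r = 0.
Proof.
move=> r0 sr h; have : 'X^d %| r.
  apply: (@poly_bounded_dvdp _ _ rho K); first exact: monicXn.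
    by move=> a; rewrite rootE hornerXn expf_eq0 => /andP[_ /eqP ->]; rewrite nm0.
  by move=> t /h; rewrite hornerXn nmX.
by move=> /dvdp_leq; case: eqP => // _ /(_ isT); rewrite size_polyXn => /(leq_trans) /(_ sr); rewrite ltnn.
Qed.

End PolyC.

Section Ppoly.
Variable K : comNzRingType.

Definition ppoly d (a : 'I_d -> K) : {poly K} := \sum_(k < d) a k *: 'X^k.
Lemma size_ppoly d (a : 'I_d -> K) : (size (ppoly a) <= d)%N.
Proof.
apply: leq_trans (size_sum _ _ _) _; apply/bigmax_leqP => k _.
by apply: leq_trans (size_scale_leq _ _) _; rewrite size_polyXn.
Qed.
Lemma horner_ppoly d (a : 'I_d -> K) t : (ppoly a).[t] = \sum_(k < d) a k * t ^+ k.
Proof. by rewrite horner_sum; apply: eq_bigr => k _; rewrite hornerZ hornerXn. Qed.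
Lemma coef_ppoly d (a : 'I_d -> K) (k : 'I_d) : (ppoly a)`_k = a k.
Proof.
rewrite coef_sum (bigD1 k) //= coefZ coefXn eqxx mulr1 big1 ?addr0 // => j jk.
rewrite coefZ coefXn (_ : _ == _ = false) ?mulr0 //; apply/negbTE; move: jk.
by apply: contraNN => /eqP e; apply/eqP/val_inj.
Qed.

Definition Wp d (w : 'I_d -> K) : {poly K} := 'X^d + ppoly w.

Lemma Wp_monic d (w : 'I_d -> K) : Wp w \is monic.
Proof.
rewrite monicE /Wp lead_coefDl ?lead_coefXn // size_polyXn ltnS; exact: size_ppoly.
Qed.
Lemma size_Wp d (w : 'I_d -> K) : size (Wp w) = d.+1.
Proof. by rewrite /Wp size_polyDl size_polyXn // ltnS size_ppoly. Qed.
Lemma horner_Wp d (w : 'I_d -> K) t : (Wp w).[t] = t ^+ d + \sum_k w k * t ^+ k.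
Proof. by rewrite hornerD hornerXn horner_ppoly. Qed.
Lemma coef_Wp d (w : 'I_d -> K) (k : 'I_d) : (Wp w)`_k = w k.
Proof. by rewrite coefD coefXn ltn_eqF // add0r coef_ppoly. Qed.

End Ppoly.

Section Weierstrass.
Variables (R : realType) (n : nat) (i0 : 'I_n).
Notation C := (Cplx R).
Notation V := 'rV[Cplx R]_n.
Notation word := (seq 'I_n).
Implicit Types (z : V) (f g : V -> C).

Definition wt (tau eps : R) : 'I_n -> R := fun i => if i == i0 then tau else eps.
Definition noti : pred word := fun w => i0 \notin w.

Lemma nneg_wt tau eps : 0 <= tau -> 0 <= eps -> nneg (wt tau eps).
Proof. by move=> h1 h2 i; rewrite /wt; case: eqP. Qed.

Lemma catQ_noti : catQ noti.
Proof. by move=> w w' h h'; rewrite /noti mem_cat negb_or; exact/andP. Qed.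

Lemma An_head d rho M f : nneg rho -> 0 < rho i0 -> An predT rho M f ->
  exists (F : 'I_d -> V -> C) (q : V -> C),
   [/\ forall k : 'I_d, An noti rho (M / rho i0 ^+ k) (F k), An predT rho (M / rho i0 ^+ d) q
    & forall z, inD rho z -> f z = \sum_k F k z * z ord0 i0 ^+ k + z ord0 i0 ^+ d * q z].
Proof.
move=> h0 ri; elim: d M f => [|d IH] M f hf.
  exists (fun _ _ => 0), f; split=> [[]//||z hz]; first by rewrite expr0 divr1.
  by rewrite big_ord0 add0r mul1r.
have [f0 [f1 [hf0 hf1 e]]] := An_split noti h0 hf.
have [|q [hq eq]] := @An_divX _ _ _ predT rho M f1 i0 h0 ri _ hf1.
  by move=> w /andP[_ /=]; rewrite /noti negbK.
have [F [q' [hF hq' e']]] := IH _ _ hq.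
exists (fun k => if unlift ord0 k is Some j then F j else f0), q'; split.
- move=> k; case: unliftP => [j ->|->] /=; last by rewrite expr0 divr1; apply: An_mono hf0.
  by have := hF j; rewrite exprS invfM mulrA.
- by move: hq'; rewrite exprS invfM mulrA.
- move=> z hz; rewrite big_ord_recl unlift_none expr0 mulr1 e // eq // e' //.
  rewrite -addrA; congr (_ + _); rewrite mulrDr exprS mulrA; congr (_ + _).
  rewrite big_distrr /=; apply: eq_bigr => k _; rewrite liftK exprS; ring.
Qed.

(** Vanishing on the axis removes the pure powers of [z_i0]. Every remaining word contains another
    variable, and the smaller radius of that variable yields the factor [l]. *)
Lemma An_pure (tau l : R) M h : 0 < tau -> 0 <= l -> l <= 1 -> An predT (cst tau) M h ->
  (forall t, nm t <= tau -> h (t *: 'e_i0) = 0) -> An predT (wt tau (l * tau)) (l * M) h.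
Proof.
move=> t0 l0 l1 hh hz; have h0 := nneg_cst (n := n) (ltW t0).
have [h1 [h2 [k1 k2 e]]] := An_split (all (pred1 i0)) h0 hh.
have lt : l * tau <= tau by rewrite ler_piMl // ltW.
have hw : nneg (wt tau (l * tau)) by apply: nneg_wt; rewrite ?mulr_ge0 // ltW.
have wle i : wt tau (l * tau) i <= cst tau i by rewrite /wt /cst; case: eqP.
apply: (An_ext (f := h2)).
  move=> z hzz; have zt : inD (cst tau) z by move=> i; apply: le_trans (hzz i) (wle i).
  have zt' : inD (cst tau) (z ord0 i0 *: 'e_i0).
    move=> i; rewrite !mxE eqxx /=; case: eqP => _; last by rewrite mulr0 nm0 ltW.
    by rewrite mulr1; exact: zt.
  rewrite e // (_ : h1 z = 0) ?add0r //.
  have <- : h1 (z ord0 i0 *: 'e_i0) = h1 z.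
    apply: (An_congr _ k1) => // w /andP[_ /allP hall]; apply: eq_big_seq => i /hall /eqP ->.
    by rewrite !mxE !eqxx mulr1.
  have := e _ zt'; rewrite hz; last exact: zt.
  rewrite (@An_lin1 _ _ _ _ _ h2 (z ord0 i0 *: 'e_i0) 0 z _ k2) ?mul0r ?addr0 //.
  move=> w /andP[_ /allPn [i iw ii]]; rewrite mul0r /wev (perm_big _ (perm_to_rem iw)) big_cons /=.
  have ii' : i != i0 := ii.
  by rewrite !mxE eqxx (negPf ii') mulr0 mul0r.
apply: An_mono (An_shrink hw wle l0 _ k2) => // w /andP[_ /allPn [i iw ii]].
rewrite /wnm !(perm_big _ (perm_to_rem iw)) !big_cons /= {1}/wt (negPf (ii : i != i0)) -mulrA ler_wpM2l //.
rewrite {1}/cst ler_wpM2l ?(ltW t0) //; exact: wnm_mono.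
Qed.

Lemma inD_line (tau : R) t : 0 <= tau -> nm t <= tau -> inD (cst tau) (t *: 'e_i0 : V).
Proof.
move=> h0 ht i; rewrite !mxE eqxx /=; case: eqP => _; first by rewrite mulr1.
by rewrite mulr0 nm0.
Qed.

(** Here [h] is the part of degree below [d] in [z_i0]. On the axis it is a polynomial of degree
    below [d] bounded by a multiple of [t ^+ d], hence zero; the leading coefficient of [f] along
    the axis is then that of [T], so [T] is a unit. *)
Lemma hasord_unitpart f d (r M : R) : 0 < r -> An predT (cst r) M f -> hasord f 'e_i0 d ->
  exists (h T : V -> C), [/\ exists M', An predT (cst r) M' h, O T, T 0 != 0,
   forall t, nm t <= r -> h (t *: 'e_i0) = 0 &
   forall z, inD (cst r) z -> f z = h z + z ord0 i0 ^+ d * T z].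
Proof.
move=> r0 hf [c [K [e [c0 e0 hc]]]]; have h0 := nneg_cst (n := n) (ltW r0).
have [F [T [hF hT eF]]] := An_head d h0 r0 hf.
pose h z := \sum_k F k z * z ord0 i0 ^+ k.
have hh : An predT (cst r) (\sum_(k < d) M / r ^+ k * r ^+ k) h.
  apply: An_sum => // k; apply: An_mul => //; first exact: An_weak (hF k).
  by apply: An_exp => //; exact: An_var.
have OT : O T by exists r, (M / r ^+ d).
have Fl k t : nm t <= r -> F k (t *: 'e_i0) = F k 0.
  move=> ht; apply: (An_congr _ (hF k)); [|exact: inD_line (ltW r0) ht|exact: inD0].
  move=> w hw; rewrite /wev; apply: eq_big_seq => i iw; rewrite !mxE eqxx /=.
  case: eqP => [ii|_]; last by rewrite mulr0.
  by move: hw; rewrite /noti -ii iw.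
have pF t : nm t <= r -> h (t *: 'e_i0) = (ppoly (fun k => F k 0)).[t].
  move=> ht; rewrite horner_ppoly; apply: eq_bigr => k _; rewrite Fl // !mxE !eqxx mulr1 //.
have lE t : nm t <= r -> f (t *: 'e_i0) = h (t *: 'e_i0) + t ^+ d * T (t *: 'e_i0).
  move=> ht; rewrite (eF _ (inD_line (ltW r0) ht)).
  have el : (t *: 'e_i0 : V) ord0 i0 = t by rewrite !mxE !eqxx mulr1.
  by rewrite -/(h _) el.
have MT t : nm t <= r -> nm (T (t *: 'e_i0)) <= M / r ^+ d.
  by move=> ht; exact: An_bound hT (inD_line (ltW r0) ht).
pose m := Num.min 1 (Num.min r e).
have m0 : 0 < m by rewrite !lt_min ltr01 r0 e0.
have [m1 [mr me]] : m <= 1 /\ (m <= r /\ m <= e) by rewrite /m !ge_min !lexx !orbT.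
clearbody m.
have p0 : ppoly (fun k => F k 0) = 0.
  apply: (@poly_order_eq0 _ _ d m (nm c + `|K| + M / r ^+ d)) => //; first exact: size_ppoly.
  move=> t tm; have tr := le_trans tm mr; have te := le_trans tm me.
  have := hc t te; rewrite -pF //.
  have -> : h (t *: 'e_i0) = (f (t *: 'e_i0) - c * t ^+ d) + c * t ^+ d - t ^+ d * T (t *: 'e_i0).
    by rewrite lE //; ring.
  move=> h1; apply: le_trans (nmB _ _) _; rewrite !mulrDl; apply: lerD.
    rewrite addrC; apply: le_trans (nmD _ _) _; rewrite addrC nmM nmX addrC lerD2l.
    apply: le_trans h1 _; rewrite exprS mulrA ler_wpM2r ?exprn_ge0 ?nm_ge0 //.
    apply: (@le_trans _ _ (`|K| * nm t)); first by rewrite ler_wpM2r ?nm_ge0 // ler_norm.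
    by rewrite ler_piMr // (le_trans tm).
  by rewrite nmM nmX mulrC ler_wpM2r ?exprn_ge0 ?nm_ge0 // MT.
exists h, T; split=> //; first by eexists; exact: hh.
- apply/eqP => T0; have nc : 0 < nm c by rewrite nm_gt0.
  have nc2 : 0 < nm c / 2 by rewrite divr_gt0.
  have [s [s0 hs]] := O_cont OT nc2.
  pose x := Num.min (Num.min m s) (nm c / 4 / (`|K| + 1)).
  have x0 : 0 < x by rewrite !lt_min m0 s0 !divr_gt0 // ltr_wpDl.
  have [xm [xs xK]] : x <= m /\ (x <= s /\ x <= nm c / 4 / (`|K| + 1)).
    by rewrite /x !ge_min !lexx !orbT.
  have nx : nm (RC x) = x by rewrite nm_RC ger0_norm // ltW.
  have := hc (RC x); rewrite nx => /(_ (le_trans xm me)).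
  rewrite lE ?nx ?(le_trans xm) // pF ?nx ?(le_trans xm) // p0 horner0 add0r.
  have := hs _ (inD_line (ltW s0) (_ : nm (RC x) <= s)); rewrite nx T0 subr0 => /(_ xs) hT0.
  rewrite -[c * _]mulrC -mulrBr nmM nmX nx exprS mulrA [X in _ <= X]mulrC.
  rewrite ler_pM2l ?exprn_gt0 // => hK.
  have := nm_lowB c (T (RC x *: 'e_i0)); rewrite nm_sub.
  have K10 : 0 < `|K| + 1 by rewrite ltr_wpDl.
  have : x * (`|K| + 1) <= nm c / 4 by rewrite -ler_pdivlMr.
  have := ler_wpM2r (ltW x0) (ler_norm K); lra.
- by move=> t ht; rewrite pF // p0 horner0.
Qed.

Definition AnX Q rho f := exists M, An Q rho M f.

(** Division on a fixed polydisc: quotient and remainder live where the dividend does, so several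
    dividends can share one polydisc. *)
Definition divides_at rho f d := forall F, AnX predT rho F -> exists (q : V -> C) (r : 'I_d -> V -> C),
  [/\ AnX predT rho q, forall k, AnX noti rho (r k) &
   forall z, inD rho z -> F z = q z * f z + \sum_k r k z * z ord0 i0 ^+ k].

(** With [f = h + z_i0 ^+ d * T], dividing by [z_i0 ^+ d * T] instead of [f] leaves the error
    [- (q / T) * h]. As [h] vanishes on the axis, its norm is small once [eps] is small compared
    with [tau]; the error is then at most half the dividend, and iteration gives convergent series
    for quotient and remainder. *)
Lemma weierstrass_division f d : O f -> hasord f 'e_i0 d -> exists tau0 : R, 0 < tau0 /\
  forall tau, 0 < tau -> tau <= tau0 -> exists eps0 : R, 0 < eps0 /\
  forall eps, 0 < eps -> eps <= eps0 -> divides_at (wt tau eps) f d.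
Proof.
move=> [r [M [r0 hf]]] ho.
have [h [T [[Mh hh] OT T0 h0 eT]]] := hasord_unitpart r0 hf ho.
have [s [Kv [s0 hv]]] := O_inv OT T0.
have [s' [s'0 hT0]] := O_neq0 OT T0.
have Mh0 := An_ge0 hh; have Kv0 := An_ge0 hv.
pose tau0 := Num.min r (Num.min s s').
have t00 : 0 < tau0 by rewrite !lt_min r0 s0.
have [tr [ts ts']] : tau0 <= r /\ (tau0 <= s /\ tau0 <= s') by rewrite /tau0 !ge_min !lexx !orbT.
exists tau0; split=> // tau tau0' tt0.
have td : 0 < tau ^+ d by exact: exprn_gt0.
have [l [l0 l1 lM]] : exists l : R, [/\ 0 < l, l <= 1 & l * (Kv * Mh) <= tau ^+ d / 2].
  by apply: small_scale; rewrite ?mulr_ge0 // divr_gt0.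
exists (l * tau); split=> [|eps e0 el]; first by rewrite mulr_gt0.
set rho := wt tau eps.
have hr : nneg rho by apply: nneg_wt; exact: ltW.
have elt : eps <= tau by apply: le_trans el _; rewrite ler_piMl // ltW.
have rt i : rho i <= tau by rewrite /rho /wt; case: eqP.
have rho0 : rho i0 = tau by rewrite /rho /wt eqxx.
have hhr : An predT rho (l * Mh) h.
  have hht : An predT (cst tau) Mh h.
    apply: An_mono hh => //; first exact: nneg_cst (ltW tau0').
    by move=> i; rewrite /cst (le_trans tt0).
  have := An_pure tau0' (ltW l0) l1 hht (fun t ht => h0 t (le_trans ht (le_trans tt0 tr))).
  by apply: An_mono => // i; rewrite /rho /wt; case: eqP.
have hvr : An predT rho Kv (fun z => (T z)^-1).
  by apply: An_mono hv => // i; rewrite /cst (le_trans (rt i)) // (le_trans tt0).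
have inr z : inD rho z -> [/\ inD (cst r) z & T z != 0].
  move=> hz; split; first by move=> i; apply: le_trans (hz i) _; rewrite /cst (le_trans (rt i)) // (le_trans tt0).
  by apply: hT0 => i; apply: le_trans (hz i) _; rewrite /cst (le_trans (rt i)) // (le_trans tt0).
have step (x : (V -> C) * R) : exists y : (('I_d -> V -> C) * (V -> C)) * (V -> C),
    An predT rho x.2 x.1 -> [/\ forall k : 'I_d, An noti rho (x.2 / tau ^+ k) (y.1.1 k),
      An predT rho (x.2 / tau ^+ d * Kv) y.1.2, An predT rho (x.2 / 2) y.2 &
      forall z, inD rho z -> x.1 z = y.1.2 z * f z + \sum_k y.1.1 k z * z ord0 i0 ^+ k + y.2 z].
  have [hx|hx] := pselect (An predT rho x.2 x.1); last by exists ((fun _ _ => 0), fun=> 0, fun=> 0).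
  have ri0 : 0 < rho i0 by rewrite rho0.
  have [F [q [hF hq e]]] := An_head d hr ri0 hx; rewrite rho0 in hF hq.
  have x0 := An_ge0 hx.
  exists (F, fun z => q z * (T z)^-1, fun z => - (q z * (T z)^-1 * h z)) => _ /=.
  have hqv := An_mul hr (fun _ _ _ _ => isT) hq hvr.
  split=> //.
    apply: An_le (An_opp (An_mul hr (fun _ _ _ _ => isT) hqv hhr)) => //.
    have -> : x.2 / tau ^+ d * Kv * (l * Mh) = x.2 / tau ^+ d * (l * (Kv * Mh)) by ring.
    have -> : x.2 / 2 = x.2 / tau ^+ d * (tau ^+ d / 2) by field; rewrite gt_eqF.
    by rewrite ler_wpM2l // divr_ge0 // ltW.
  move=> z hz; have [hz1 Tz] := inr z hz; rewrite e // eT //; by field.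
have [st hst] := choice step.
move=> F [MF hF].
pose X j := iter j (fun x : (V -> C) * R => ((st x).2, x.2 / 2)) (F, MF).
have MF0 := An_ge0 hF.
have hX j : An predT rho (X j).2 (X j).1 /\ (X j).2 = MF * (1 / 2) ^+ j.
  elim: j => [|j [IH1 IH2]]; first by rewrite /X /= expr0 mulr1.
  have [_ _ h3 _] := hst _ IH1; split; first exact: h3.
  by rewrite /= IH2 exprS; ring.
have half N : \sum_(k < N) MF * (1 / 2) ^+ k <= MF * 2.
  by rewrite -big_distrr /= ler_wpM2l // geo_half.
have hq j : An predT rho (MF * (1 / 2) ^+ j / tau ^+ d * Kv) (st (X j)).1.2.
  by have [h1 e1] := hX j; have [_ h3 _ _] := hst _ h1; rewrite -e1.
have hrk (k : 'I_d) j : An noti rho (MF * (1 / 2) ^+ j / tau ^+ k) ((st (X j)).1.1 k).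
  by have [h1 e1] := hX j; have [/(_ k) h3 _ _ _] := hst _ h1; rewrite -e1.
have sq N : \sum_(j < N) MF * (1 / 2) ^+ j / tau ^+ d * Kv <= MF * 2 / tau ^+ d * Kv.
  rewrite -!big_distrl /=; apply: ler_wpM2r => //.
  by apply: ler_wpM2r; [rewrite invr_ge0 ltW|exact: half].
have sr (k : 'I_d) N : \sum_(j < N) MF * (1 / 2) ^+ j / tau ^+ k <= MF * 2 / tau ^+ k.
  rewrite -!big_distrl /=.
  by apply: ler_wpM2r; [rewrite invr_ge0 exprn_ge0 // ltW|exact: half].
have [q [hqA eq]] := An_series_ex hq sq hr.
have [rk hrkA] := choice (fun k => An_series_ex (hrk k) (sr k) hr).
exists q, rk; split.
- by eexists; exact: hqA.
- by move=> k; eexists; exact: (hrkA k).1.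
- move=> z hz.
  have tele N : F z = (\sum_(j < N) (st (X j)).1.2 z) * f z +
     \sum_(k < d) (\sum_(j < N) (st (X j)).1.1 k z) * z ord0 i0 ^+ k + (X N).1 z.
    elim: N => [|N IH].
      by rewrite !big_ord0 mul0r add0r big1 ?add0r // => k _; rewrite big_ord0 mul0r.
    rewrite {1}IH; have [h1 _] := hX N; have [_ _ _ e4] := hst _ h1; rewrite (e4 z hz).
    have -> : \sum_(k < d) (\sum_(j < N.+1) (st (X j)).1.1 k z) * z ord0 i0 ^+ k =
      \sum_(k < d) (\sum_(j < N) (st (X j)).1.1 k z) * z ord0 i0 ^+ k +
      \sum_(k < d) (st (X N)).1.1 k z * z ord0 i0 ^+ k.
      by rewrite -big_split; apply: eq_bigr => k _; rewrite big_ord_recr /= mulrDl.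
    rewrite big_ord_recr /= mulrDl; ring.
  apply: (cv_uniq (u := fun N => F z)); first exact: cv_cst.
  apply: (cv_ext (u := fun N => (\sum_(j < N) (st (X j)).1.2 z) * f z +
     \sum_(k < d) (\sum_(j < N) (st (X j)).1.1 k z) * z ord0 i0 ^+ k + (X N).1 z)).
    by move=> N; rewrite -tele.
  rewrite -[X in cv _ X]addr0; apply: cvD; first apply: cvD.
  + by apply: cvM; [exact: eq|exact: cv_cst].
  + by apply: cv_sum => k; apply: cvM; [exact: (hrkA k).2|exact: cv_cst].
  + have hb N : nm ((X N).1 z) <= MF * (1 / 2) ^+ N.
      by have [h1 e1] := hX N; rewrite -e1; exact: An_bound h1 hz.
    move=> e e'; have MF1 : 0 < MF + 1 by rewrite ltr_wpDl.
    have := @cv_geo R (RC (1 / 2)) (1 / 2) _ _ (e / (MF + 1)) (divr_gt0 e' MF1).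
    rewrite nm_RC ger0_norm ?divr_ge0 // => /(_ _ (lexx _)) [|N0 hN0]; first lra.
    exists N0 => N /hN0; rewrite !subr0 nmX nm_RC ger0_norm ?divr_ge0 // ler_pdivlMr // => h1.
    apply: le_trans (hb N) _.
    have := exprn_ge0 N (_ : 0 <= 1 / 2 :> R); rewrite divr_ge0 // => /(_ isT); lra.
Qed.

Lemma noti_const (rho : 'I_n -> R) M f t : nneg rho -> An noti rho M f -> nm t <= rho i0 ->
  f (t *: 'e_i0) = f 0.
Proof.
move=> h0 hf ht; apply: (An_congr _ hf); last exact: inD0.
  move=> w hw; rewrite /wev; apply: eq_big_seq => i iw; rewrite !mxE eqxx /=.
  case: eqP => [ii|_]; last by rewrite mulr0.
  by move: hw; rewrite /noti -ii iw.
by move=> i; rewrite !mxE eqxx /=; case: eqP => [->|_]; rewrite ?mulr1 // mulr0 nm0.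
Qed.

Lemma weierstrass_preparation f d (eta : R) : O f -> hasord f 'e_i0 d -> 0 < eta -> exists tau eps : R,
  [/\ 0 < tau <= eta, 0 < eps <= eta, divides_at (wt tau eps) f d &
  exists (w : 'I_d -> V -> C) (u : V -> C),
  [/\ AnX predT (wt tau eps) u, forall k, AnX noti (wt tau eps) (w k),
   forall k, w k 0 = 0,
   exists m : R, 0 < m /\ forall z, inD (wt tau eps) z ->
     m <= nm (u z) /\ f z * u z = z ord0 i0 ^+ d + \sum_k w k z * z ord0 i0 ^+ k &
   forall z, inD (wt tau eps) z -> forall t, t ^+ d + \sum_k w k z * t ^+ k = 0 -> nm t < tau]].
Proof.
move=> Of ho eta0; have [c [K [e [c0 e0 hc]]]] := ho.
have [tau0 [t00 hdiv]] := weierstrass_division Of ho.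
have [eps0 [eps00 hdiv0]] := hdiv tau0 t00 (lexx _).
have {}hdiv0 := hdiv0 eps0 eps00 (lexx _).
set rho := wt tau0 eps0 in hdiv0.
have hr : nneg rho by apply: nneg_wt; exact: ltW.
have [|u [r [[Mu hu] hrr eF]]] := hdiv0 (fun z => z ord0 i0 ^+ d).
  by exists (rho i0 ^+ d); apply: An_exp => //; exact: An_var.
have ri0 : rho i0 = tau0 by rewrite /rho /wt eqxx.
have lin t : nm t <= tau0 -> inD rho (t *: 'e_i0 : V).
  move=> ht i; rewrite !mxE eqxx /= /rho /wt; case: eqP => _; first by rewrite mulr1.
  by rewrite mulr0 nm0 ltW.
have rc k t : nm t <= tau0 -> r k (t *: 'e_i0) = r k 0.
  by move=> ht; have [Mr hk] := hrr k; apply: noti_const hk _ => //; rewrite ri0.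
have e1 t : nm t <= tau0 -> t ^+ d = u (t *: 'e_i0) * f (t *: 'e_i0) + (ppoly (fun k => r k 0)).[t].
  move=> ht; have := eF _ (lin t ht); rewrite (_ : (t *: 'e_i0 : V) ord0 i0 = t); last by rewrite !mxE !eqxx mulr1.
  by move=> ->; rewrite horner_ppoly; congr (_ + _); apply: eq_bigr => k _; rewrite rc.
pose m := Num.min 1 (Num.min tau0 e).
have m0 : 0 < m by rewrite !lt_min ltr01 t00 e0.
have [m1 [mt me]] : m <= 1 /\ (m <= tau0 /\ m <= e) by rewrite /m !ge_min !lexx !orbT.
clearbody m.
have fb t : nm t <= m -> nm (f (t *: 'e_i0)) <= (nm c + `|K|) * nm t ^+ d.
  move=> tm; have := hc t (le_trans tm me) => h1.
  have -> : f (t *: 'e_i0) = c * t ^+ d + (f (t *: 'e_i0) - c * t ^+ d) by ring.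
  apply: le_trans (nmD _ _) _; rewrite mulrDl nmM nmX lerD2l; apply: le_trans h1 _.
  rewrite exprS mulrA ler_wpM2r ?exprn_ge0 ?nm_ge0 //.
  apply: (@le_trans _ _ (`|K| * nm t)); first by rewrite ler_wpM2r ?nm_ge0 // ler_norm.
  by rewrite ler_piMr // (le_trans tm).
have Mu0 := An_ge0 hu.
have p0 : ppoly (fun k => r k 0) = 0.
  apply: (@poly_order_eq0 _ _ d m (1 + Mu * (nm c + `|K|))) => //; first exact: size_ppoly.
  move=> t tm; have h1 := e1 t (le_trans tm mt).
  have -> : (ppoly (fun k => r k 0)).[t] = t ^+ d - u (t *: 'e_i0) * f (t *: 'e_i0) by rewrite h1; ring.
  apply: le_trans (nmB _ _) _; rewrite mulrDl mul1r nmX lerD2l nmM -mulrA.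
  apply: ler_pM; [exact: nm_ge0|exact: nm_ge0| |exact: fb].
  exact: An_bound hu (lin t (le_trans tm mt)).
have r00 k : r k 0 = 0 by rewrite -(coef_ppoly (fun k => r k 0)) p0 coef0.
have rho_pos i : 0 < rho i by rewrite /rho /wt; case: eqP.
have u0 : u 0 != 0.
  apply/eqP => u0; have Ku : 0 < nm c + `|K| by rewrite ltr_pwDl // nm_gt0.
  have /(_ (1 / 2 / (nm c + `|K|))) := An_cont rho_pos hu.
  rewrite !divr_gt0 // => /(_ isT) [s [s0 hs]].
  pose x := Num.min m s; have x0 : 0 < x by rewrite lt_min m0 s0.
  have [xm xs] : x <= m /\ x <= s by split; rewrite ge_min lexx ?orbT.
  have nx : nm (RC x) = x by rewrite nm_RC ger0_norm // ltW.
  have := hs _ (inD_line (ltW s0) (_ : nm (RC x) <= s)); rewrite nx => /(_ xs); rewrite u0 subr0 => ub.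
  have := e1 (RC x); rewrite nx => /(_ (le_trans xm mt)); rewrite p0 horner0 addr0.
  move=> /(congr1 (@nm R)); rewrite nmM nmX nx => h1.
  have := fb (RC x); rewrite nx => /(_ xm) h2.
  have := ler_pM (nm_ge0 _) (nm_ge0 _) ub h2; rewrite -h1 mulrA divfK ?gt_eqF //.
  have : 0 < x ^+ d by exact: exprn_gt0.
  lra.
have un : 0 < nm (u 0) / 2 by rewrite divr_gt0 ?nm_gt0.
have hs : near0 (fun z => nm (u 0) / 2 <= nm (u z)).
  apply: near0_imp (An_cont rho_pos hu un) => z; rewrite -!nm_gt0 in u0 *.
  by have := nm_lowB (u 0) (u z); rewrite nm_sub; lra.
have [s [s0 hs1]] := hs.
pose tau := Num.min eta (Num.min tau0 s).
have tau_0 : 0 < tau by rewrite !lt_min eta0 t00 s0.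
have [te [tt0 ts]] : tau <= eta /\ (tau <= tau0 /\ tau <= s) by rewrite /tau !ge_min !lexx !orbT.
have [eps1 [eps10 hdiv1]] := hdiv tau tau_0 tt0.
(* If all coefficients are at most [tau ^+ d / S], a root with [tau <= nm t] would satisfy
   [nm t ^+ d <= nm t ^+ d * (S - 1) / S], which is absurd. *)
pose S := 1 + \sum_(k < d) tau ^+ k.
have S0 : 0 < S by rewrite ltr_wpDr // sumr_ge0 // => k _; rewrite exprn_ge0 // ltW.
have td : 0 < tau ^+ d by exact: exprn_gt0.
have hw : near0 (fun z => forall k, nm (r k z) <= tau ^+ d / S).
  apply: near0_fin => k; have [Mr hk] := hrr k.
  apply: near0_imp (An_cont rho_pos (An_weak hr hk) (divr_gt0 td S0)) => z.
  by rewrite r00 subr0.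
have [s2 [s20 hs2]] := hw.
pose eps := Num.min (Num.min eta eps0) (Num.min s (Num.min eps1 s2)).
have eps_0 : 0 < eps by rewrite !lt_min eta0 eps00 s0 eps10 s20.
have [ee [ee0 [es [e_1 es2]]]] : eps <= eta /\ (eps <= eps0 /\ (eps <= s /\ (eps <= eps1 /\ eps <= s2))).
  by rewrite /eps !ge_min !lexx !orbT.
have hr' : nneg (wt tau eps) by apply: nneg_wt; exact: ltW.
have le' i : wt tau eps i <= rho i by rewrite /rho /wt; case: eqP.
have les i : wt tau eps i <= s by rewrite /wt; case: eqP.
exists tau, eps; split; [by rewrite tau_0|by rewrite eps_0|exact: hdiv1|].
exists (fun k z => - r k z), u; split.
- by exists Mu; apply: An_mono hu.
- by move=> k; have [Mr hk] := hrr k; exists Mr; apply: An_opp; apply: An_mono hk.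
- by move=> k; rewrite r00 oppr0.
- exists (nm (u 0) / 2); split=> // z hz; split; first by apply: hs1 => i; apply: le_trans (hz i) (les i).
  have hz' : inD rho z by move=> i; apply: le_trans (hz i) (le' i).
  rewrite (eF z hz'); under [X in _ = _ + X]eq_bigr do rewrite mulNr.
  by rewrite sumrN addrK mulrC.
- move=> z hz t ht; rewrite ltNge; apply/negP => tt.
  pose z' : V := \row_i (if i == i0 then 0 else z ord0 i).
  have hz' : inD rho z by move=> i; apply: le_trans (hz i) (le' i).
  have hz'' : inD rho z'.
    by move=> i; rewrite mxE; case: eqP => _; rewrite ?nm0 // ltW.
  have rz k : r k z = r k z'.
    have [Mr hk] := hrr k; apply: (An_congr _ hk) => // w hw'; apply: eq_big_seq => i iw.
    rewrite mxE; case: eqP => [ii|//]; by move: hw'; rewrite /noti -ii iw.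
  have rb k : nm (r k z) <= tau ^+ d / S.
    rewrite rz; apply: hs2 => i; rewrite mxE; case: eqP => [_|ni]; first by rewrite nm0 ltW.
    by apply: le_trans (hz i) _; rewrite /wt; case: eqP.
  have t0 : 0 < nm t by exact: lt_le_trans tt.
  have : nm t ^+ d <= \sum_(k < d) tau ^+ d / S * nm t ^+ k.
    have -> : nm t ^+ d = nm (\sum_(k < d) r k z * t ^+ k).
      rewrite -nmX; congr nm; move: ht; under eq_bigr do rewrite mulNr.
      by rewrite sumrN => /eqP; rewrite subr_eq0 => /eqP.
    apply: le_trans (nm_sum _ _ _) _; apply: ler_sum => k _.
    by rewrite nmM nmX ler_wpM2r ?exprn_ge0 ?nm_ge0.
  have : \sum_(k < d) tau ^+ d / S * nm t ^+ k <= \sum_(k < d) nm t ^+ d / S * tau ^+ k.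
    apply: ler_sum => k _; rewrite mulrAC [X in _ <= X]mulrAC ler_wpM2r ?invr_ge0 ?(ltW S0) //.
    have kd : (k <= d)%N by exact: ltnW.
    have ed (y : R) : y ^+ d = y ^+ (d - k) * y ^+ k by rewrite -exprD subnK.
    rewrite !ed -!mulrA [tau ^+ k * _]mulrC ler_wpM2r ?mulr_ge0 ?exprn_ge0 ?nm_ge0 ?(ltW tau_0) //.
    by rewrite lerXn2r // ?nnegrE ?nm_ge0 // ltW.
  move=> h1 h2; have := le_trans h2 h1; rewrite -big_distrr /=.
  have -> : \sum_(i < d) tau ^+ i = S - 1 by rewrite /S addrC addKr.
  rewrite mulrAC ler_pdivlMr // ler_pM2l ?exprn_gt0 //; lra.
Qed.

End Weierstrass.

(** * Divisibility of germs *)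

Section GermDivision.
Variables (R : realType) (n : nat).
Notation C := (Cplx R).
Notation V := 'rV[Cplx R]_n.
Implicit Types (z v : V) (f g h a b : V -> C).

Definition gdvd a f := exists b, O b /\ near0 (fun z => f z = a z * b z).
(** By [O_inv], the condition [a 0 != 0] says that the germ [a] is a unit. *)
Definition gred f := forall a, O a -> gdvd (fun z => a z * a z) f -> a 0 != 0.
Definition gcop f g := forall a, O a -> gdvd a f -> gdvd a g -> a 0 != 0.
Definition gzero f := near0 (fun z => f z = 0).

Lemma gdvd_ext a a' f f' : near0 (fun z => a z = a' z) -> near0 (fun z => f z = f' z) ->
  gdvd a f -> gdvd a' f'.
Proof.
move=> h1 h2 [b [Ob h3]]; exists b; split=> //.
by apply: near0_imp (near0_and h1 (near0_and h2 h3)) => z [<- [<-]].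
Qed.
Lemma gdvd_mulr a f g : O g -> gdvd a f -> gdvd a (fun z => f z * g z).
Proof.
move=> Og [c [Oc h1]]; exists (fun z => c z * g z); split; first exact: O_mul.
by apply: near0_imp h1 => z ->; rewrite mulrA.
Qed.
Lemma gdvd_add a f g : gdvd a f -> gdvd a g -> gdvd a (fun z => f z + g z).
Proof.
move=> [c [Oc h1]] [e [Oe h2]]; exists (fun z => c z + e z); split; first exact: O_add.
by apply: near0_imp (near0_and h1 h2) => z [-> ->]; rewrite mulrDr.
Qed.
Lemma gdvd_unit a f : O a -> O f -> a 0 != 0 -> gdvd a f.
Proof.
move=> Oa Of a0; exists (fun z => (a z)^-1 * f z); split.
  by apply: O_mul => //; exact: O_inv.
by apply: near0_imp (O_neq0 Oa a0) => z az; rewrite mulrA mulfV // mul1r.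
Qed.

Lemma gcancel a f g : O a -> O f -> O g -> ~ gzero a -> near0 (fun z => a z * f z = a z * g z) ->
  near0 (fun z => f z = g z).
Proof.
move=> Oa Of Og a0 h.
have [//||] := O_domain Oa (O_sub Of Og); last by apply: near0_imp => z /eqP; rewrite subr_eq0 => /eqP.
  by apply: near0_imp h => z e; rewrite mulrBr e subrr.
by [].
Qed.

Lemma gzero_mul f g : O f -> O g -> gzero (fun z => f z * g z) -> gzero f \/ gzero g.
Proof. exact: O_domain. Qed.

Lemma gred_nz f : gred f -> ~ gzero f.
Proof.
move=> hf f0; have := hf (fun=> 0) (O_const _ 0).
rewrite eqxx => h; suff : false by []; apply: h.
exists (fun=> 0); split; first exact: O_const.
by apply: near0_imp f0 => z ->; rewrite mulr0.
Qed.

Lemma An_O (rho : 'I_n -> R) M f : (forall i, 0 < rho i) -> An predT rho M f -> O f.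
Proof.
move=> hr hf; have : near0 (fun z : V => forall i, nm (z ord0 i) <= rho i).
  by apply: near0_fin => i; exists (rho i); split=> // z; apply.
move=> [s [s0 hs]]; exists s, M; split=> //; apply: An_mono hf => //.
  exact: nneg_cst (ltW s0).
move=> i; have hh : inD (cst s) (const_mx (RC s) : V).
  by move=> j; rewrite mxE nm_RC (ger0_norm (ltW s0)).
by have := hs _ hh i; rewrite mxE nm_RC (ger0_norm (ltW s0)).
Qed.

Lemma exists_dir f : O f -> ~ gzero f -> exists v d, hasord f v d.
Proof.
move=> [r [M [r0 hf]]] nz.
have [z [hz fz]] : exists z, inD (fun i => 1 / 2 * cst r i) z /\ f z != 0.
  apply: contrapT => h; apply: nz; exists (1 / 2 * r); split; first by rewrite mulr_gt0.
  by move=> z hz; apply/eqP; apply/negPn/negP => fz; apply: h; exists z.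
have h0 : 0 <= 1 / 2 :> R by lra.
have h1 : 1 / 2 < 1 :> R by lra.
have [|] := An_line (nneg_cst (ltW r0)) hf h0 h1 hz.
  by move=> /(_ 1); rewrite nm1 scale1r => /(_ (lexx _)) e; rewrite e eqxx in fz.
by move=> [d [c [K [c0 h]]]]; exists z, d, c, K, 1.
Qed.

Section LinearChange.
Variables (v : V) (i0 : 'I_n).
Hypothesis v0 : v ord0 i0 != 0.
(** The linear map fixing the other basis vectors and sending ['e_i0] to [v]: it makes a germ
    regular in [z_i0] when it has finite order along [v]. *)
Definition line_change z : V := z + z ord0 i0 *: (v - 'e_i0).
Definition line_change_inv z : V := z - (z ord0 i0 / v ord0 i0) *: (v - 'e_i0).

Lemma line_changeK z : line_change_inv (line_change z) = z.
Proof.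
rewrite /line_change_inv /line_change; set w := v - _.
have wi : w ord0 i0 = v ord0 i0 - 1 by rewrite !mxE !eqxx.
clearbody w; have -> : (z + z ord0 i0 *: w) ord0 i0 = z ord0 i0 * v ord0 i0 by rewrite !mxE wi; ring.
by rewrite mulfK // addrK.
Qed.
Lemma line_change_invK z : line_change (line_change_inv z) = z.
Proof.
rewrite /line_change_inv /line_change; set w := v - _.
have wi : w ord0 i0 = v ord0 i0 - 1 by rewrite !mxE !eqxx.
clearbody w; have -> : (z - (z ord0 i0 / v ord0 i0) *: w) ord0 i0 = z ord0 i0 / v ord0 i0.
  by rewrite !mxE wi; field.
by rewrite subrK.
Qed.
Lemma line_change_line t : line_change (t *: 'e_i0) = t *: v.
Proof.
rewrite /line_change; have -> : (t *: 'e_i0 : V) ord0 i0 = t by rewrite !mxE !eqxx mulr1.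
by rewrite scalerBr addrC subrK.
Qed.
Lemma O_line_change i : O (fun z => line_change z ord0 i).
Proof.
apply: (@O_ext _ _ (fun z => z ord0 i + z ord0 i0 * (v - 'e_i0) ord0 i)).
  by apply: near0_all => z; rewrite !mxE.
by apply: O_add; [exact: O_var|apply: O_mul; [exact: O_var|exact: O_const]].
Qed.
Lemma O_line_change_inv i : O (fun z => line_change_inv z ord0 i).
Proof.
apply: (@O_ext _ _ (fun z => z ord0 i - z ord0 i0 * (v ord0 i0)^-1 * (v - 'e_i0) ord0 i)).
  by apply: near0_all => z; rewrite !mxE.
apply: O_sub; [exact: O_var|apply: O_mul; [apply: O_mul|]]; [exact: O_var| |]; exact: O_const.
Qed.
Lemma Lch0 : line_change 0 = 0. Proof. by rewrite /line_change mxE scale0r addr0. Qed.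
Lemma Lch'0 : line_change_inv 0 = 0. Proof. by rewrite /line_change_inv mxE mul0r scale0r subr0. Qed.
End LinearChange.

Lemma O_sub_map f (F : V -> V) : (forall i, O (fun z => F z ord0 i)) -> F 0 = 0 -> O f ->
  O (fun z => f (F z)).
Proof. by move=> hF F0 hf; apply: O_comp => //; rewrite F0; exact/Oat0. Qed.

Lemma regular_change f : O f -> ~ gzero f -> f 0 = 0 -> exists (L L' : V -> V) (i0 : 'I_n) d,
  [/\ (forall i, O (fun z => L z ord0 i)) /\ L 0 = 0, (forall i, O (fun z => L' z ord0 i)) /\ L' 0 = 0,
   forall z, L' (L z) = z, forall z, L (L' z) = z & hasord (fun z => f (L z)) 'e_i0 d].
Proof.
move=> Of nz f0; have [v [d hv]] := exists_dir Of nz.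
have [i0 vi] : exists i0, v ord0 i0 != 0.
  apply: contrapT => h; have v0 : v = 0.
    by apply/rowP => i; rewrite mxE; apply/eqP/negPn/negP => vi; apply: h; exists i.
  have [e [e0 /(_ (RC e))]] := hasord_nz hv; rewrite nm_RC ger0_norm ?(ltW e0) // v0 scaler0 f0 eqxx.
  by rewrite -nm_eq0 nm_RC ger0_norm ?(ltW e0) // gt_eqF // => /(_ (lexx _) isT).
exists (line_change v i0), (line_change_inv v i0), i0, d; split.
- by split; [exact: O_line_change|exact: Lch0].
- by split; [exact: O_line_change_inv|exact: Lch'0].
- exact: line_changeK.
- exact: line_change_invK.
- have [c [K [e [c0 e0 h]]]] := hv; exists c, K, e; split=> // t /h.
  by rewrite line_change_line.
Qed.

Section Transport.
Variables (L L' : V -> V).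
Hypotheses (LO : forall i, O (fun z => L z ord0 i)) (L0 : L 0 = 0).
Hypotheses (LO' : forall i, O (fun z => L' z ord0 i)) (L0' : L' 0 = 0).
Hypotheses (LK : forall z, L' (L z) = z) (LK' : forall z, L (L' z) = z).

Lemma gdvd_back a f : gdvd a (fun z => f (L z)) -> gdvd (fun z => a (L' z)) f.
Proof.
move=> [b [Ob h]]; exists (fun z => b (L' z)); split; first exact: O_sub_map.
by apply: near0_imp (near0_comp LO' L0' h) => z; rewrite LK'.
Qed.
Lemma gred_change f : gred f -> gred (fun z => f (L z)).
Proof.
move=> hf a Oa /gdvd_back h; rewrite -L0'; apply: (hf (fun z => a (L' z))) => //.
exact: O_sub_map.
Qed.
Lemma gcop_change f g : gcop f g -> gcop (fun z => f (L z)) (fun z => g (L z)).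
Proof.
move=> hf a Oa /gdvd_back h /gdvd_back h'; rewrite -L0'; apply: (hf (fun z => a (L' z))) => //.
exact: O_sub_map.
Qed.
End Transport.

Definition upd (i0 : 'I_n) z t : V := \row_i (if i == i0 then t else z ord0 i).

Lemma updE i0 z t : upd i0 z t ord0 i0 = t. Proof. by rewrite mxE eqxx. Qed.

Lemma noti_upd i0 (rho : 'I_n -> R) f z t : AnX (noti i0) rho f -> inD rho z ->
  inD rho (upd i0 z t) -> f (upd i0 z t) = f z.
Proof.
move=> [M hf] h1 h2; apply: (An_congr _ hf) => // w hw; apply: eq_big_seq => i iw.
by rewrite mxE; case: eqP => [ii|//]; move: hw; rewrite /noti -ii iw.
Qed.

Lemma inD_upd i0 (tau eps : R) z t : inD (wt i0 tau eps) z -> nm t <= tau ->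
  inD (wt i0 tau eps) (upd i0 z t).
Proof.
by move=> hz ht i; rewrite mxE /wt; case: eqP => ii //; have := hz i; rewrite /wt; case: eqP.
Qed.

Lemma ppoly_dvd_eq0 d (r w : 'I_d -> C) : Wp w %| ppoly r -> forall k, r k = 0.
Proof.
move=> hd k; rewrite -(coef_ppoly r k); suff -> : ppoly r = 0 by rewrite coef0.
apply/eqP/negPn/negP => r0; have := dvdp_leq r0 hd; rewrite size_Wp => /leq_trans/(_ (size_ppoly r)).
by rewrite ltnn.
Qed.

(* The bound forces the Weierstrass remainder of f modulo q to vanish, with
   multiplicity, at the roots of the Weierstrass polynomial of q. *)
Lemma bounded_gdvd f q (K : R) : O f -> O q -> ~ gzero q ->
  near0 (fun z => nm (f z) <= K * nm (q z)) -> gdvd q f.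
Proof.
move=> Of Oq nz hb; have [q0|q0] := eqVneq (q 0) 0; last exact: gdvd_unit.
have [L [L' [i0 [d [[LO L0] [LO' L0'] LK LK' ho]]]]] := regular_change Oq nz q0.
have OqL : O (fun z => q (L z)) := O_sub_map LO L0 Oq.
have [r [M [r0 hf]]] := O_sub_map LO L0 Of.
have [r' [r'0 hb']] := near0_comp LO L0 hb.
have m0 : 0 < Num.min r r' by rewrite lt_min r0.
have [tau [eps [/andP[t0 tm] /andP[e0 em] hdiv hW]]] := weierstrass_preparation OqL ho m0.
have [w [u [[Mu hu] hw w0 [m [m0' hu']] hroot]]] := hW.
set rho := wt i0 tau eps in hdiv hu hw hu' hroot.
have rho0 i : 0 < rho i by rewrite /rho /wt; case: eqP.
have rle i : rho i <= Num.min r r' by rewrite /rho /wt; case: eqP.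
have hr : nneg rho by move=> i; exact: ltW.
have [|s [rk [[Ms hs] hrk eF]]] := hdiv (fun z => f (L z)).
  exists M; apply: An_mono hf => // i; apply: le_trans (rle i) _; by rewrite ge_min lexx.
have Os : O s := An_O rho0 hs.
have Ms0 := An_ge0 hs.
suff rz z : inD rho z -> forall k, rk k z = 0.
  exists (fun z => s (L' z)); split; first exact: O_sub_map.
  have [e [e_0 he]] : near0 (fun z : V => forall i, nm (z ord0 i) <= rho i).
    by apply: near0_fin => i; exists (rho i); split=> // z; apply.
  have hn : near0 (fun z => f (L z) = q (L z) * s z).
    exists e; split=> // z /he hz; rewrite (eF z hz) big1 ?addr0 1?mulrC // => k _.
    by rewrite rz // mul0r.
  by apply: near0_imp (near0_comp LO' L0' hn) => z; rewrite LK'.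
move=> hz; apply: (@ppoly_dvd_eq0 d (fun k => rk k z) (fun k => w k z)).
apply: (@poly_bounded_dvdp _ _ _ tau ((K + Ms) / m)); first exact: Wp_monic.
  by move=> a /rootP; rewrite horner_Wp => /hroot; apply.
move=> t ht; have hy := inD_upd hz ht; set y := upd i0 z t in hy.
have yt : y ord0 i0 = t by exact: updE.
have wy k : w k y = w k z by exact: noti_upd (hw k) hz hy.
have ry k : rk k y = rk k z by exact: noti_upd (hrk k) hz hy.
have e1 : (ppoly (fun k => rk k z)).[t] = f (L y) - s y * q (L y).
  rewrite (eF y hy) addrC addKr horner_ppoly yt; apply: eq_bigr => k _; by rewrite ry.
have [mu e2] := hu' y hy.
have e3 : (Wp (fun k => w k z)).[t] = q (L y) * u y.
  rewrite e2 horner_Wp yt; congr (_ + _); apply: eq_bigr => k _; by rewrite wy.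
rewrite e1 e3 nmM.
have h1 : nm (f (L y)) <= K * nm (q (L y)).
  by apply: hb' => i; apply: le_trans (hy i) (le_trans (rle i) _); rewrite ge_min lexx orbT.
have h2 : nm (s y * q (L y)) <= Ms * nm (q (L y)).
  by rewrite nmM ler_wpM2r ?nm_ge0 // (An_bound hs hy).
apply: le_trans (nmB _ _) _; apply: le_trans (lerD h1 h2) _.
have K0 : 0 <= (K + Ms) * nm (q (L y)).
  by rewrite mulrDl; have := nm_ge0 (f (L y)); have := nm_ge0 (s y * q (L y)); lra.
rewrite -mulrDl mulrAC ler_pdivlMr // mulrA.
by apply: ler_wpM2l.
Qed.

End GermDivision.

(** * The coefficient ring of Weierstrass polynomials *)

Section AnRing.
Variables (R : realType) (n : nat) (i0 : 'I_n) (tau eps : {posnum R}).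
Notation rho := (wt i0 tau%:num eps%:num).
Notation C := (Cplx R).
Notation V := 'rV[Cplx R]_n.
Implicit Types (z : V) (f g : V -> C).

Let rho_gt0 i : 0 < rho i. Proof. by rewrite /wt; case: ifP. Qed.

Definition inO z := forall i, nm (z ord0 i) < rho i.

(* Functions are set to zero off the open polydisc so that equality of functions
   is equality on the polydisc. *)
Definition ringP f := (exists g, AnX (noti i0) rho g /\ forall z, inO z -> f z = g z) /\
  forall z, ~ inO z -> f z = 0.

Record anring := AnRing { aval :> V -> C; avalP : ringP aval }.

Lemma aval_inj : injective aval.
Proof. by move=> [f hf] [g hg] /= e; subst g; congr AnRing; exact: Prop_irrelevance. Qed.
Lemma aval_eq (f g : anring) : (forall z, inO z -> f z = g z) -> f = g.
Proof.
move=> h; apply: aval_inj; apply/funext => z; have [/h //|hz] := pselect (inO z).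
by rewrite (avalP f).2 // (avalP g).2.
Qed.

HB.instance Definition _ := gen_eqMixin anring.
HB.instance Definition _ := gen_choiceMixin anring.

Let hr : nneg rho. Proof. by move=> i; exact: ltW. Qed.

Definition restr f z : C := if `[< inO z >] then f z else 0.
Lemma restrE f z : inO z -> restr f z = f z.
Proof. by move=> hz; rewrite /restr asboolT. Qed.
Lemma restr_ringP f : AnX (noti i0) rho f -> ringP (restr f).
Proof.
move=> hf; split; first by exists f; split=> // z; exact: restrE.
by move=> z hz; rewrite /restr asboolF.
Qed.
Definition toA f (hf : AnX (noti i0) rho f) : anring := AnRing (restr_ringP hf).

Lemma ringP_add (f g : anring) : ringP (fun z => f z + g z).
Proof.
case: f g => [f [[f' [[M hf] ef]] f0]] [g [[g' [[M' hg] eg]] g0]] /=; split.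
  exists (fun z => f' z + g' z); split; first by exists (M + M'); exact: An_add.
  by move=> z hz; rewrite ef // eg.
by move=> z hz; rewrite f0 // g0 // addr0.
Qed.
Lemma ringP_mul (f g : anring) : ringP (fun z => f z * g z).
Proof.
case: f g => [f [[f' [[M hf] ef]] f0]] [g [[g' [[M' hg] eg]] g0]] /=; split.
  exists (fun z => f' z * g' z); split; first by exists (M * M'); apply: An_mul => //; exact: catQ_noti.
  by move=> z hz; rewrite ef // eg.
by move=> z hz; rewrite f0 // mul0r.
Qed.
Lemma ringP_opp (f : anring) : ringP (fun z => - f z).
Proof.
case: f => [f [[f' [[M hf] ef]] f0]] /=; split.
  exists (fun z => - f' z); split; first by exists M; exact: An_opp.
  by move=> z hz; rewrite ef.
by move=> z hz; rewrite f0 // oppr0.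
Qed.
Lemma AnX_const c : AnX (noti i0) rho (fun=> c).
Proof. by exists (nm c); exact: An_const. Qed.

Definition aadd (f g : anring) : anring := AnRing (ringP_add f g).
Definition amul (f g : anring) : anring := AnRing (ringP_mul f g).
Definition aopp (f : anring) : anring := AnRing (ringP_opp f).
Definition azero := toA (AnX_const 0).
Definition aone := toA (AnX_const 1).

Lemma azeroE z : azero z = 0. Proof. by rewrite /azero /= /restr; case: ifP. Qed.
Lemma aoneE z : inO z -> aone z = 1. Proof. by move=> hz; rewrite /aone /= restrE. Qed.

Lemma aaddA : associative aadd. Proof. by move=> f g h; apply: aval_eq => z _ /=; rewrite addrA. Qed.
Lemma aaddC : commutative aadd. Proof. by move=> f g; apply: aval_eq => z _ /=; rewrite addrC. Qed.
Lemma aadd0 : left_id azero aadd. Proof. by move=> f; apply: aval_eq => z _; change (azero z + f z = f z); rewrite azeroE add0r. Qed.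
Lemma aaddN : left_inverse azero aopp aadd.
Proof. by move=> f; apply: aval_eq => z _; rewrite azeroE /= addNr. Qed.
HB.instance Definition _ := GRing.isZmodule.Build anring aaddA aaddC aadd0 aaddN.

Lemma amulA : associative amul. Proof. by move=> f g h; apply: aval_eq => z _ /=; rewrite mulrA. Qed.
Lemma amulC : commutative amul. Proof. by move=> f g; apply: aval_eq => z _ /=; rewrite mulrC. Qed.
Lemma amul1 : left_id aone amul. Proof. by move=> f; apply: aval_eq => z hz; change (aone z * f z = f z); rewrite aoneE // mul1r. Qed.
Lemma amulD : left_distributive amul aadd.
Proof. by move=> f g h; apply: aval_eq => z _ /=; rewrite mulrDl. Qed.
Lemma inO0 : inO 0. Proof. by move=> i; rewrite mxE nm0. Qed.
Lemma aone_neq0 : aone != azero.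
Proof.
apply/eqP => /(congr1 (fun f : anring => f 0)); rewrite aoneE ?azeroE; last exact: inO0.
by move/eqP; rewrite oner_eq0.
Qed.
HB.instance Definition _ := GRing.Zmodule_isComNzRing.Build anring amulA amulC amul1 amulD aone_neq0.

Lemma avalD (f g : anring) z : (f + g) z = f z + g z. Proof. by []. Qed.
Lemma avalM (f g : anring) z : (f * g) z = f z * g z. Proof. by []. Qed.
Lemma aval0 z : (0 : anring) z = 0. Proof. exact: azeroE. Qed.
Lemma aval1 z : inO z -> (1 : anring) z = 1. Proof. exact: aoneE. Qed.

(** Units are decided classically. The purpose is to reach the integral domain interface, over which
    divisibility, gcds and Bezout relations of polynomials are available up to nonzero scalars. *)
Definition aunit : pred anring := fun f : anring => `[< exists g : anring, g * f = 1 >].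
Definition ainv (f : anring) : anring :=
  if pselect (exists g : anring, g * f = 1) is left h then projT1 (cid h) else f.
Lemma amulV : {in aunit, left_inverse 1 ainv *%R}.
Proof. by move=> f /asboolP h; rewrite /ainv; case: pselect => // h'; case: cid. Qed.
Lemma aunitP (f g : anring) : g * f = 1 -> aunit f.
Proof. by move=> h; apply/asboolP; exists g. Qed.
Lemma ainv_out : {in [predC aunit], ainv =1 id}.
Proof. by move=> f /asboolPn h; rewrite /ainv; case: pselect. Qed.
HB.instance Definition _ := GRing.ComNzRing_hasMulInverse.Build anring amulV aunitP ainv_out.

(** The identity theorem needs the point in a strictly smaller closed polydisc. *)
Lemma inO_lam z : inO z -> exists l : R, [/\ 0 <= l, l < 1 & inD (fun i => l * rho i) z].
Proof.
move=> hz; suff [l [l0 l1 hl]] : exists l : R, [/\ 0 <= l, l < 1 &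
    forall i, i \in enum 'I_n -> nm (z ord0 i) <= l * rho i].
  by exists l; split=> // i; apply: hl; rewrite mem_enum.
elim: (enum 'I_n) => [|i s [l [l0 l1 hl]]]; first by exists 0.
exists (Num.max l (nm (z ord0 i) / rho i)); split; first by rewrite le_max l0.
  by rewrite gt_max l1 ltr_pdivrMr // mul1r hz.
move=> j; rewrite inE => /orP[/eqP ->|/hl h].
  by rewrite -ler_pdivrMr // le_max lexx orbT.
by apply: le_trans h _; rewrite ler_wpM2r // le_max lexx.
Qed.

Lemma near0_inO (P : V -> Prop) : (forall z, inO z -> P z) -> near0 P.
Proof.
move=> h; have : near0 (fun z : V => forall i, nm (z ord0 i) < rho i).
  apply: near0_fin => i; exists (rho i / 2); split; first by rewrite divr_gt0.
  by move=> z /(_ i); rewrite /cst; have := rho_gt0 i; lra.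
by apply: near0_imp.
Qed.

Lemma aval_O (f : anring) : O f.
Proof.
have [[g [[M hg] eg]] _] := avalP f; apply: (@O_ext _ _ g).
  by apply: near0_inO => z hz; rewrite eg.
exact: An_O rho_gt0 (An_weak hr hg).
Qed.

Lemma aval_gzero (f : anring) : gzero f -> f = 0.
Proof.
move=> f0; apply: aval_eq => z hz; rewrite aval0.
have [[g [[M hg] eg]] _] := avalP f; rewrite eg //.
have [l [l0 l1 hl]] := inO_lam hz; apply: (An_ident hr (An_weak hr hg) l0 l1 hl).
have := near0_and f0 (near0_inO eg : near0 (fun z => f z = g z)).
by apply: near0_imp => y [<-].
Qed.

Lemma anring_integral (f g : anring) : f * g = 0 -> (f == 0) || (g == 0).
Proof.
move=> h; have : near0 (fun z => f z * g z = 0).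
  by apply: near0_all => z; rewrite -avalM h aval0.
by move=> /(O_domain (aval_O f) (aval_O g)) [] /aval_gzero ->; rewrite eqxx ?orbT.
Qed.
HB.instance Definition _ := GRing.ComUnitRing_isIntegral.Build anring anring_integral.

Section Eval.
Variables (z : V) (hz : inO z).
(** The membership proof is an argument because evaluation preserves 1 only at points of the
    polydisc. *)
Definition evd (_ : inO z) (f : anring) : C := f z.
Lemma ev_zmod : zmod_morphism (evd hz). Proof. by []. Qed.
Lemma ev_monoid : monoid_morphism (evd hz).
Proof. by split=> //; exact: aval1. Qed.
HB.instance Definition _ := GRing.isZmodMorphism.Build anring C (evd hz) ev_zmod.
HB.instance Definition _ := GRing.isMonoidMorphism.Build anring C (evd hz) ev_monoid.
End Eval.

Definition pz z (hz : inO z) (P : {poly anring}) : {poly C} := map_poly (evd hz) P.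

Lemma pzM z (hz : inO z) P Q : pz hz (P * Q) = pz hz P * pz hz Q. Proof. exact: rmorphM. Qed.
Lemma pzD z (hz : inO z) P Q : pz hz (P + Q) = pz hz P + pz hz Q. Proof. exact: rmorphD. Qed.
Lemma pzZ z (hz : inO z) c P : pz hz (c *: P) = c z *: pz hz P. Proof. exact: map_polyZ. Qed.
Lemma pzC z (hz : inO z) c : pz hz c%:P = (c z)%:P. Proof. exact: map_polyC. Qed.
Lemma coef_pz z (hz : inO z) P k : (pz hz P)`_k = P`_k z. Proof. exact: coef_map. Qed.
Lemma pz_deriv z (hz : inO z) P : pz hz P^`() = (pz hz P)^`(). Proof. by rewrite /pz deriv_map. Qed.
Lemma pz_monic z (hz : inO z) P : P \is monic -> pz hz P \is monic.
Proof. exact: monic_map. Qed.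

Definition pf (P : {poly anring}) z : C := \sum_(k < size P) P`_k z * z ord0 i0 ^+ k.

Lemma pfE P z (hz : inO z) : pf P z = (pz hz P).[z ord0 i0].
Proof.
rewrite (@horner_coef_wide _ (size P)); last exact: size_poly.
by apply: eq_bigr => k _; rewrite coef_pz.
Qed.

End AnRing.

(** * Gauss's lemma *)

Section PolyRoots.
Variable R : realType.
Notation C := (Cplx R).

Lemma coef_prod_XsubC_bound (rs : seq C) (T : R) : 0 <= T -> (forall a, a \in rs -> nm a <= T) ->
  forall k, nm (\prod_(a <- rs) ('X - a%:P))`_k <= (1 + T) ^+ size rs.
Proof.
move=> T0; elim: rs => [|a rs IH] hT k.
  by rewrite big_nil coefC expr0; case: eqP => _; rewrite ?nm1 ?nm0.
have {}IH := IH (fun b hb => hT b (@mem_behead _ (a :: rs) b hb)).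
rewrite big_cons mulrC mulrBr coefB coefMX coefMC [size _]/= exprS mulrDl mul1r.
apply: le_trans (nmB _ _) _; apply: lerD.
  by case: eqP => _; rewrite ?nm0 ?exprn_ge0 ?addr_ge0.
by rewrite nmM mulrC ler_pM ?nm_ge0 // hT // mem_head.
Qed.

Lemma cauchy_root_bound (W : {poly C}) (d : nat) (M : R) a : W \is monic -> size W = d.+1 ->
  0 <= M -> (forall k, nm W`_k <= M) -> root W a -> nm a <= 1 + M * d%:R.
Proof.
move=> hW sW M0 hM /rootP; rewrite horner_coef sW big_ord_recr /=.
have -> : W`_d = 1 by move/monicP: hW; rewrite lead_coefE sW.
rewrite mul1r => /eqP; rewrite addr_eq0 => /eqP e.
have {e}: nm a ^+ d <= \sum_(i < d) M * nm a ^+ i.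
  rewrite -nmX -nmN -e; apply: le_trans (nm_sum _ _ _) _; apply: ler_sum => i _.
  by rewrite nmM nmX ler_wpM2r ?exprn_ge0 ?nm_ge0.
case: d sW => [|d] _; first by rewrite expr0 big_ord0 ler10.
move=> h; rewrite leNgt; apply/negP => a1.
have n1 : 1 <= nm a by apply: le_trans (ltW a1); rewrite lerDl mulr_ge0.
have : nm a ^+ d.+1 <= (M * d.+1%:R) * nm a ^+ d.
  apply: le_trans h _; rewrite -mulrA [_ * nm a ^+ d]mulrC mulrA.
  rewrite -[d.+1 in leRHS]card_ord mulr_natr -sumr_const; apply: ler_sum => i _.
  by rewrite ler_wpM2l // ler_weXn2l // -ltnS.
rewrite exprS ler_pM2r; last by rewrite exprn_gt0 // (lt_le_trans ltr01).
by move=> h'; move: a1; rewrite ltNge (le_trans h') // lerDr ler01.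
Qed.

(** The roots of [p] are among those of [P], so Cauchy's root bound controls the elementary
    symmetric functions of the roots of [p]. *)
Lemma dvdp_coef_bound (P p : {poly C}) (d : nat) (M : R) : P \is monic -> size P = d.+1 -> 0 <= M ->
  (forall k, nm P`_k <= M) -> p %| P ->
  forall k, nm p`_k <= (2 + M * d%:R) ^+ d * nm (lead_coef p).
Proof.
move=> hP sP M0 hM hp k; have P0 : P != 0 := monic_neq0 hP.
have p0 : p != 0 by apply: contraNneq P0 => e; move: hp; rewrite e dvd0p.
have [rs e] := closed_field_poly_normal p.
have s0 : size (\prod_(z <- rs) ('X - z%:P)) = (size rs).+1 by rewrite size_prod_XsubC.
have T0 : 0 <= 1 + M * d%:R by rewrite addr_ge0 ?mulr_ge0.
have hr a : a \in rs -> nm a <= 1 + M * d%:R.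
  move=> ha; apply: cauchy_root_bound hP sP M0 hM _.
  have /dvdpP[q ->] := hp; rewrite rootM e rootZ ?lead_coef_eq0 //.
  by rewrite root_prod_XsubC ha orbT.
have srs : (size rs <= d)%N.
  rewrite -ltnS -s0 -sP; apply: dvdp_leq P0 _.
  by apply: dvdp_trans hp; rewrite [X in _ %| X]e dvdpZr ?lead_coef_eq0.
rewrite {1}e coefZ nmM mulrC ler_wpM2r ?nm_ge0 //.
apply: le_trans (coef_prod_XsubC_bound T0 hr k) _.
rewrite addrA (_ : 1 + 1 = 2) //; apply: ler_weXn2l => //.
have : 0 <= M * d%:R by rewrite mulr_ge0.
lra.
Qed.

Lemma poly_eq_near (p q : {poly C}) (e : R) : 0 < e -> (forall t, nm t <= e -> p.[t] = q.[t]) -> p = q.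
Proof.
move=> e0 h; apply/eqP; rewrite -subr_eq0; apply/eqP.
apply: (@poly_order_eq0 _ _ (size (p - q)) e 0) => // t ht.
by rewrite hornerD hornerN h // subrr nm0 mul0r.
Qed.

End PolyRoots.

Section Gauss.
Variables (R : realType) (n : nat) (i0 : 'I_n) (tau eps : {posnum R}).
Notation C := (Cplx R).
Notation V := 'rV[Cplx R]_n.
Notation rho := (wt i0 tau%:num eps%:num).
Notation A := (anring i0 tau eps).
Notation inO := (inO i0 tau eps).
Implicit Types (z : V) (f g : A) (P G w B : {poly A}).

Lemma inO_inD z : inO z -> inD rho z.
Proof. by move=> hz i; apply: ltW; apply: hz. Qed.

Lemma inO_upd z t : inO z -> nm t < tau%:num -> inO (upd i0 z t).
Proof.
by move=> hz ht i; rewrite mxE /wt; case: eqP => ii //; have := hz i; rewrite /wt; case: eqP.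
Qed.

Lemma aval_upd f z t : inO z -> nm t < tau%:num -> f (upd i0 z t) = f z.
Proof.
move=> hz ht; have [[g [hg e]] _] := avalP f; have hu := inO_upd hz ht.
by rewrite !e //; apply: noti_upd hg _ _; exact: inO_inD.
Qed.

Lemma aval_bound f : exists M : R, 0 <= M /\ forall z, nm (f z) <= M.
Proof.
have [[g [[M hg] e]] f0] := avalP f; exists M; split; first exact: An_ge0 hg.
move=> z; have [hz|hz] := pselect (inO z); last by rewrite f0 // nm0 (An_ge0 hg).
by rewrite e // (An_bound hg) //; exact: inO_inD.
Qed.

Lemma coef_bound P : exists M : R, 0 <= M /\ forall k z, nm (P`_k z) <= M.
Proof.
have [M hM] := choice (fun k => aval_bound P`_k).
exists (\sum_(k < size P) M k); split; first by apply: sumr_ge0 => k _; have [] := hM k.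
move=> k z; case: (ltnP k (size P)) => hk.
  rewrite (bigD1 (Ordinal hk)) //= -[leLHS]addr0; apply: lerD; first by have [] := hM k.
  by apply: sumr_ge0 => j _; have [] := hM j.
by rewrite nth_default // aval0 nm0; apply: sumr_ge0 => j _; have [] := hM j.
Qed.

Lemma anz f : f != 0 -> ~ gzero f.
Proof. by move=> /eqP f0 /aval_gzero. Qed.

Lemma O_upd0 (f : V -> C) : O f -> O (fun z => f (upd i0 z 0)).
Proof.
move=> Of; apply: (O_sub_map (F := fun z => upd i0 z 0)) => // [i|].
  apply: (O_ext (f := fun z => if i == i0 then 0 else z ord0 i)).
    by apply: near0_all => z; rewrite mxE.
  by case: eqP => _; [exact: O_const|exact: O_var].
by apply/rowP => i; rewrite !mxE; case: eqP.
Qed.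
Lemma near0_upd0 (Q : V -> Prop) : near0 Q -> near0 (fun z => Q (upd i0 z 0)).
Proof.
apply: (near0_comp (F := fun z => upd i0 z 0)) => // [i|].
  apply: (O_ext (f := fun z => if i == i0 then 0 else z ord0 i)).
    by apply: near0_all => z; rewrite mxE.
  by case: eqP => _; [exact: O_const|exact: O_var].
by apply/rowP => i; rewrite !mxE; case: eqP.
Qed.

(* A factor of a monic polynomial becomes monic after division by its leading
   coefficient: its roots are bounded, hence so are the quotients of its
   coefficients by the leading one, and bounded quotients are holomorphic. *)
Lemma gauss_monic (c : A) P w B : P \is monic -> c != 0 -> c *: P = w * B ->
  exists a : nat -> V -> C, [/\ forall k, O (a k),
    forall k z t, a k (upd i0 z t) = a k z,
    forall k, near0 (fun z => w`_k z = lead_coef w z * a k z) &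
    near0 (fun z => a (size w).-1 z = 1)].
Proof.
move=> hP c0 e; have [M [M0 hM]] := coef_bound P.
have P0 : P != 0 := monic_neq0 hP.
have e1 : lead_coef w * lead_coef B = c by rewrite -lead_coefM -e lead_coefZ (monicP hP) mulr1.
have lw0 : lead_coef w != 0 by apply: contraNneq c0 => h; rewrite -e1 h mul0r.
have [d sP] : exists d, size P = d.+1 by exists (size P).-1; rewrite prednK // size_poly_gt0.
have q0 : ~ gzero (fun z => c z * lead_coef w z).
  by apply: (@anz (c * lead_coef w)); rewrite mulf_neq0.
(* The factor [c] makes the estimate trivial where [c] vanishes. Elsewhere the leading coefficient
   of [w] is nonzero and the specialised [w] divides the specialised monic polynomial. *)
have hb k z : inO z -> nm (c z * w`_k z) <= (2 + M * d%:R) ^+ d * nm (c z * lead_coef w z).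
  move=> hz; have [cz|cz] := eqVneq (c z) 0; first by rewrite cz !mul0r nm0 mulr0.
  have lz : lead_coef w z != 0.
    by apply: contraNneq cz => h; rewrite -e1 avalM h mul0r.
  rewrite !nmM mulrCA ler_wpM2l ?nm_ge0 //.
  have -> : lead_coef w z = lead_coef (pz hz w) by rewrite lead_coef_map_eq.
  rewrite -(coef_pz hz); apply: (@dvdp_coef_bound _ (pz hz P)) => //.
  - exact: pz_monic.
  - by rewrite size_map_poly_id0 // (monicP hP) rmorph1 oner_eq0.
  - by move=> j; rewrite coef_pz.
  - by rewrite -(dvdpZr _ _ cz) -pzZ e pzM dvdp_mulr.
have hd k : gdvd (fun z => c z * lead_coef w z) (fun z => c z * w`_k z).
  apply: bounded_gdvd q0 _; try by apply: O_mul; exact: aval_O.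
  by apply: (near0_inO (i0 := i0) (tau := tau) (eps := eps)) => z hz; apply: hb.
have {hd}hd k : exists a, O a /\ near0 (fun z => w`_k z = lead_coef w z * a z).
  have [a [Oa ha]] := hd k; exists a; split=> //.
  apply: (gcancel (aval_O c)); [exact: aval_O|apply: O_mul => //; exact: aval_O|exact: anz|].
  by apply: near0_imp ha => z ->; rewrite mulrA.
have [a ha] := choice hd.
(* The coefficients of [w] do not involve [z_i0]; setting [z_i0] to 0 gives the quotients the same
   property. *)
have hu k : near0 (fun z => w`_k z = lead_coef w z * a k (upd i0 z 0)).
  have := near0_upd0 (ha k).2; have := @near0_inO _ _ i0 tau eps inO (fun _ h => h).
  move=> h1 h2; apply: near0_imp (near0_and h1 h2) => z [hz].
  by rewrite !aval_upd // nm0.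
exists (fun k z => a k (upd i0 z 0)); split => //.
- by move=> k; apply: O_upd0; have [] := ha k.
- by move=> k z t; congr (a k _); apply/rowP => i; rewrite !mxE; case: eqP.
- apply: (gcancel (aval_O (lead_coef w))); last 1 first.
  + have := hu (size w).-1; have h1 := @near0_inO _ _ i0 tau eps inO (fun _ h => h).
    by move=> h2; apply: near0_imp (near0_and h1 h2) => z [hz <-]; rewrite mulr1 lead_coefE.
  + by apply: O_upd0; have [] := ha (size w).-1.
  + exact: O_const.
  + exact: anz.
Qed.

Definition wf (m : nat) (a : nat -> V -> C) z : C := \sum_(k < m) a k z * z ord0 i0 ^+ k.

Lemma O_wf m a : (forall k, O (a k)) -> O (wf m a).
Proof.
move=> ha; apply: O_sum => k; apply: O_mul => //.
by apply: O_exp; exact: O_var.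
Qed.

Lemma pf_monic w a : (forall k, near0 (fun z => w`_k z = lead_coef w z * a k z)) ->
  near0 (fun z => pf w z = lead_coef w z * wf (size w) a z).
Proof.
move=> h; have := @near0_fin _ _ 'I_(size w) _ (fun k : 'I_(size w) => h k).
apply: near0_imp => z hz; rewrite /pf /wf mulr_sumr; apply: eq_bigr => k _.
by rewrite hz mulrA.
Qed.

Lemma pfM P G z : inO z -> pf (P * G) z = pf P z * pf G z.
Proof. by move=> hz; rewrite !(pfE _ hz) pzM hornerM. Qed.
Lemma pfZ c P z : inO z -> pf (c *: P) z = c z * pf P z.
Proof. by move=> hz; rewrite !(pfE _ hz) pzZ hornerZ. Qed.

Lemma O_pf P : O (pf P).
Proof.
apply: O_sum => k; apply: O_mul; first exact: aval_O.
by apply: O_exp; exact: O_var.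
Qed.

Lemma near0_inO' : near0 inO.
Proof. exact: (@near0_inO _ _ i0 tau eps inO (fun _ h => h)). Qed.

(** The cofactor [B] is made monic too; the two leading coefficients multiply to [c], which
    cancels. *)
Lemma gauss_dvd (c : A) P w B m a : P \is monic -> c != 0 -> c *: P = w * B ->
  (forall k, O (a k)) ->
  near0 (fun z => pf w z = lead_coef w z * wf m a z) -> gdvd (wf m a) (pf P).
Proof.
move=> hP c0 e Oa hw; have [|b [Ob _ hb _]] := @gauss_monic c P B w hP c0; first by rewrite mulrC.
have e1 : lead_coef w * lead_coef B = c by rewrite -lead_coefM -e lead_coefZ (monicP hP) mulr1.
exists (wf (size B) b); split; first exact: O_wf.
apply: (gcancel (aval_O c)); [exact: O_pf|by apply: O_mul; exact: O_wf|exact: anz|].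
apply: near0_imp (near0_and near0_inO' (near0_and hw (pf_monic hb))) => z [hz [h1 h2]].
by rewrite -pfZ // e pfM // h1 h2 -e1 avalM; ring.
Qed.

Lemma gauss_sqr_dvd (c : A) P w B m a : P \is monic -> c != 0 -> c *: P = w * w * B ->
  (forall k, O (a k)) ->
  near0 (fun z => pf w z = lead_coef w z * wf m a z) ->
  gdvd (fun z => wf m a z * wf m a z) (pf P).
Proof.
move=> hP c0 e Oa hw; have [|b [Ob _ hb _]] := @gauss_monic c P B (w * w) hP c0; first by rewrite mulrC.
have e1 : lead_coef w * lead_coef w * lead_coef B = c.
  by rewrite -!lead_coefM -e lead_coefZ (monicP hP) mulr1.
exists (wf (size B) b); split; first exact: O_wf.
apply: (gcancel (aval_O c)); [exact: O_pf| |exact: anz|].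
  by apply: O_mul; [apply: O_mul|]; exact: O_wf.
apply: near0_imp (near0_and near0_inO' (near0_and hw (pf_monic hb))) => z [hz [h1 h2]].
by rewrite -pfZ // e !pfM // h1 h2 -e1 !avalM; ring.
Qed.

Lemma updE0 t : upd i0 0 t = t *: 'e_i0 :> V.
Proof.
apply/rowP => i; rewrite !mxE eqxx /=; case: eqP => _; first by rewrite mulr1.
by rewrite mulr0.
Qed.

Lemma wf_line m a t : (forall k z t, a k (upd i0 z t) = a k z) ->
  wf m a (t *: 'e_i0) = (\poly_(k < m) a k 0).[t].
Proof.
move=> hu; rewrite horner_poly; apply: eq_bigr => k _.
by rewrite -updE0 hu !mxE eqxx.
Qed.

Lemma near0_line (Q : V -> Prop) : near0 Q -> exists e : R, 0 < e /\ forall t, nm t <= e -> Q (t *: 'e_i0).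
Proof.
move=> [s [s0 h]]; exists s; split=> // t ht; apply: h.
by apply: inD_line => //; exact: ltW.
Qed.

(** On the axis [P] specialises to ['X^d], and the monic form of [w] to a nonconstant divisor of it,
    whose only root is 0. *)
Lemma gauss_nonunit (c : A) P w B d : P \is monic -> c != 0 -> c *: P = w * B ->
  size P = d.+1 -> (forall k, (k < d)%N -> P`_k 0 = 0) -> (1 < size w)%N ->
  exists a, [/\ forall k, O (a k), 
    near0 (fun z => pf w z = lead_coef w z * wf (size w) a z) & wf (size w) a 0 = 0].
Proof.
move=> hP c0 e sP P0 sw; have [a [Oa ua ha la]] := gauss_monic hP c0 e.
have [|b [Ob ub hb _]] := @gauss_monic c P B w hP c0; first by rewrite mulrC.
exists a; split=> //; first exact: pf_monic.
have e1 : lead_coef w * lead_coef B = c by rewrite -lead_coefM -e lead_coefZ (monicP hP) mulr1.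
have hf : near0 (fun z => pf P z = wf (size w) a z * wf (size B) b z).
  apply: (gcancel (aval_O c)); [exact: O_pf|by apply: O_mul; exact: O_wf|exact: anz|].
  apply: near0_imp (near0_and near0_inO' (near0_and (pf_monic ha) (pf_monic hb))) => z [hz [h1 h2]].
  by rewrite -pfZ // e pfM // h1 h2 -e1 avalM; ring.
set p1 := \poly_(k < size w) a k 0; set p2 := \poly_(k < size B) b k 0.
have ep : p1 * p2 = 'X^d.
  have [e' [e'0 hl]] := near0_line (near0_and hf near0_inO').
  apply: (poly_eq_near e'0) => t /hl [h hz]; rewrite hornerM -!wf_line // -h (pfE _ hz).
  have i00 : inO 0 by exact: inO0.
  have -> : pz hz P = 'X^d.
    apply/polyP => k; rewrite coef_pz -updE0 aval_upd //; last first.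
      by have := hz i0; rewrite !mxE !eqxx mulr1 /wt eqxx.
    rewrite coefXn; case: (ltngtP k d) => hk; first by rewrite P0.
      by rewrite nth_default ?aval0 // sP.
    have -> : P`_k = 1 by rewrite hk; move/monicP: hP; rewrite lead_coefE sP.
    by rewrite aval1.
  by rewrite hornerXn !mxE !eqxx mulr1 -hornerXn.
have s1 : size p1 = size w.
  rewrite size_poly_eq // (near0_0 la); exact: oner_neq0.
have [|x hx] := closed_rootP p1 _; first by rewrite s1; case: (size w) sw => [|[]].
have x0 : x = 0.
  have : ('X^d : {poly C}).[x] = 0 by rewrite -ep hornerM (rootP hx) mul0r.
  by rewrite hornerXn => /eqP; rewrite expf_eq0 => /andP[_ /eqP].
move: hx; rewrite x0 => /rootP; rewrite /p1 -wf_line // scale0r.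
by [].
Qed.

End Gauss.

(** * Germs vanishing on a reduced hypersurface *)

Section WeierstrassPoly.
Variables (R : realType) (n : nat) (i0 : 'I_n) (tau eps : {posnum R}).
Notation C := (Cplx R).
Notation V := 'rV[Cplx R]_n.
Notation A := (anring i0 tau eps).
Notation inO := (inO i0 tau eps).
Variables (d : nat) (w : 'I_d -> A).
Hypothesis w0 : forall k, w k 0 = 0.
Notation P := (Wp w).
Variables (f u : V -> C).
Hypotheses (Of : O f) (Ou : O u) (u0 : u 0 != 0).
Hypothesis fuP : near0 (fun z => f z * u z = pf P z).

Lemma gdvd_pf a : gdvd a (pf P) -> gdvd a f.
Proof.
move=> h; have h' := gdvd_mulr (O_inv Ou u0) h.
apply: gdvd_ext _ _ h'; first by apply: near0_all.
apply: near0_imp (near0_and fuP (O_neq0 Ou u0)) => z [<- uz].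
by rewrite mulfK.
Qed.

Lemma Wp_lt k : (k < d)%N -> P`_k 0 = 0.
Proof. by move=> hk; rewrite -(w0 (Ordinal hk)) -(coef_Wp w (Ordinal hk)). Qed.

(** A repeated factor over the coefficient ring would give, by Gauss's lemma, a nonunit germ whose
    square divides [f]. The condition on derivatives of nonconstant factors holds in characteristic
    zero. *)
Lemma Wp_separable : gred f -> separable_poly P.
Proof.
move=> hf; apply/separable_polyP; split.
  move=> p q pqP; rewrite coprimep_def; apply/negPn/negP => sg; set g := gcdp p q in sg *.
  have pq0 : p * q != 0.
    by apply: contraTneq (pqP) => ->; rewrite dvd0p monic_neq0 // Wp_monic.
  have p0 : p != 0 by apply: contraNneq pq0 => ->; rewrite mul0r.
  have g0 : g != 0 by rewrite gcdp_eq0 (negbTE p0).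
  have sg1 : (1 < size g)%N by move: g0 sg; rewrite -size_poly_gt0; case: (size g) => [|[]].
  have : g * g %| P by apply: dvdp_trans pqP; rewrite dvdp_mul ?dvdp_gcdl ?dvdp_gcdr.
  case/Pdiv.Idomain.dvdpP => -[c B] /= c0 e.
  have e1 : c *: P = g * g * B by rewrite e mulrC.
  have [|a [Oa ha a0]] := gauss_nonunit (B := g * B) (Wp_monic w) c0 _ (size_Wp w) Wp_lt sg1.
    by rewrite e1 mulrA.
  have := hf _ (O_wf i0 (size g) Oa) (gdvd_pf (gauss_sqr_dvd (Wp_monic w) c0 e1 Oa ha)).
  by rewrite a0 eqxx.
move=> p pP sp; apply/eqP => dp; have p0 : p != 0 by rewrite -size_poly_gt0 (ltn_trans _ sp).
have [m sm] : exists m, size p = m.+2 by case: (size p) sp => [|[|m]] // _; exists m.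
have : p^`()`_m = 0 by rewrite dp coef0.
rewrite coef_deriv => e.
case/eqP: p0; apply/eqP; rewrite -lead_coef_eq0 lead_coefE sm; apply/eqP/aval_eq => z hz.
have : evd hz p`_m.+1 *+ m.+1 = 0 by rewrite -rmorphMn e rmorph0.
by move/eqP; rewrite mulrn_eq0 aval0 => /eqP.
Qed.

(** A nonconstant common factor would give a nonunit germ dividing [f], and also [g], since [g] and
    [G] agree modulo [f]. *)
Lemma Wp_coprime (G : {poly A}) g s : G \is monic -> O s -> gcop g f ->
  near0 (fun z => g z = pf G z + s z * f z) -> coprimep P G.
Proof.
move=> hG Os hc hg; rewrite coprimep_def; apply/negPn/negP => sq; set q := gcdp P G in sq *.
have q0 : q != 0 by rewrite gcdp_eq0 negb_and monic_neq0 ?Wp_monic.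
have sq1 : (1 < size q)%N by move: q0 sq; rewrite -size_poly_gt0; case: (size q) => [|[]].
have /Pdiv.Idomain.dvdpP[[c B] /= c0 e] : q %| P by exact: dvdp_gcdl.
have /Pdiv.Idomain.dvdpP[[c' B'] /= c'0 e'] : q %| G by exact: dvdp_gcdr.
rewrite mulrC in e; rewrite mulrC in e'.
have [a [Oa ha a0]] := gauss_nonunit (Wp_monic w) c0 e (size_Wp w) Wp_lt sq1.
have hP := gdvd_pf (gauss_dvd (Wp_monic w) c0 e Oa ha).
have hG' := gauss_dvd hG c'0 e' Oa ha.
have hgg : gdvd (wf i0 (size q) a) g.
  have h1 := gdvd_add hG' (gdvd_mulr Os hP).
  apply: gdvd_ext _ _ h1; first exact: near0_all.
  by apply: near0_imp hg => z ->; rewrite mulrC.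
by have := hc _ (O_wf i0 (size q) Oa) hgg hP; rewrite a0 eqxx.
Qed.

Lemma pz_Wp z (hz : inO z) : pz hz P = Wp (fun k => w k z).
Proof.
rewrite /pz /Wp /ppoly rmorphD /= map_polyXn rmorph_sum /=; congr (_ + _).
by apply: eq_bigr => k _; rewrite map_polyZ /= map_polyXn.
Qed.

Lemma pz_ppoly (r : 'I_d -> A) z (hz : inO z) : pz hz (ppoly r) = ppoly (fun k => r k z).
Proof.
rewrite /pz /ppoly rmorph_sum /=.
by apply: eq_bigr => k _; rewrite map_polyZ /= map_polyXn.
Qed.

(* Off the zeros of the two resultants the roots of P are simple and are not
   zeros of G, so r vanishes there and has degree less than that of P. *)
Lemma remainder_eq0 (G : {poly A}) (r : 'I_d -> A) : separable_poly P -> coprimep P G ->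
  (forall z (hz : inO z) t, root (pz hz P) t -> (pz hz G).[t] != 0 -> (pz hz (ppoly r)).[t] = 0) ->
  forall k, r k = 0.
Proof.
rewrite separable_poly.unlock => /Pdiv.Idomain.Bezout_coprimepP [[U1 U2] /= hU] /Pdiv.Idomain.Bezout_coprimepP [[V1 V2] /= hV] hr k.
have [c0 c00 e0] : exists2 c, c != 0 & U1 * P + U2 * P^`() = c%:P.
  by move: hU; rewrite -size_poly_eq1 => /size_poly1P.
have [c1 c10 e1] : exists2 c, c != 0 & V1 * P + V2 * G = c%:P.
  by move: hV; rewrite -size_poly_eq1 => /size_poly1P.
suff e : c0 * c1 * r k = 0.
  by move/eqP: e; rewrite !mulf_eq0 (negbTE c00) (negbTE c10) => /eqP.
apply: aval_eq => z hz; rewrite aval0 !avalM.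
have [->|z0] := eqVneq (c0 z) 0; first by rewrite !mul0r.
have [->|z1] := eqVneq (c1 z) 0; first by rewrite mulr0 mul0r.
suff -> : r k z = 0 by rewrite mulr0.
have := @ppoly_dvd_eq0 _ d (fun k => r k z) (fun k => w k z) _ k; apply.
rewrite -(pz_Wp hz) -(pz_ppoly r hz).
have [rs e] := prod_XsubC_monic_split (pz_monic hz (Wp_monic w)).
have urs : uniq rs.
  rewrite -separable_prod_XsubC -e separable_poly.unlock; apply/Bezout_coprimepP.
  exists (pz hz U1, pz hz U2) => /=.
  by rewrite -pz_deriv -!pzM -pzD e0 pzC polyC_eqp1.
rewrite e; apply: uniq_roots_dvdp; last by rewrite uniq_rootsE.
apply/allP => t ht; have tP : root (pz hz P) t by rewrite e root_prod_XsubC.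
apply/rootP; apply: (hr z hz t tP); apply: contraNneq z1 => G0.
have := congr1 (fun p => (pz hz p).[t]) e1.
by rewrite pzD !pzM hornerD !hornerM (rootP tP) G0 pzC hornerC !mulr0 addr0 => <-.
Qed.
End WeierstrassPoly.

Section Null.
Variables (R : realType) (n : nat).
Notation C := (Cplx R).
Notation V := 'rV[Cplx R]_n.
Implicit Types (z : V) (f g h F : V -> C).

Lemma O_An_small f : O f -> exists r : R, 0 < r /\ forall rho : 'I_n -> R, nneg rho ->
  (forall i, rho i <= r) -> AnX predT rho f.
Proof.
by move=> [r [M [r0 hf]]]; exists r; split=> // rho hr hl; exists M; apply: An_mono hf.
Qed.

(** One polydisc serves to prepare [h] and to divide both [g] and [F] by it, so that all the
    polynomials involved have coefficients in the same ring. *)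
Lemma null_dvd_regular g h F i0 d : O g -> O h -> O F -> hasord h 'e_i0 d -> gred h -> gcop g h ->
  near0 (fun z => h z = 0 -> g z * F z = 0) -> gdvd h F.
Proof.
move=> Og Oh OF ho hred hcop hz.
have [rg [rg0 hrg]] := O_An_small Og; have [rF [rF0 hrF]] := O_An_small OF.
have [s [s0 hs]] := hz; pose eta := Num.min s (Num.min rg rF).
have eta0 : 0 < eta by rewrite !lt_min s0 rg0.
have [tau [eps [/andP[t0 tm] /andP[e0 em] hdiv hW]]] := weierstrass_preparation Oh ho eta0.
case: hW => w [u [[Mu hu] hw w0 [m [m0 hm]] hroot]].
have rho0 : nneg (wt i0 tau eps) by apply: nneg_wt; exact: ltW.
have rhop i : 0 < wt i0 tau eps i by rewrite /wt; case: ifP.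
have rhol i : wt i0 tau eps i <= eta by rewrite /wt; case: ifP.
have [|q1 [r1 [[Mq1 hq1] hr1 eg]]] := hdiv g.
  by apply: hrg => // i; apply: le_trans (rhol i) _; rewrite !ge_min lexx orbT.
have [|q2 [r2 [[Mq2 hq2] hr2 eF]]] := hdiv F.
  by apply: hrF => // i; apply: le_trans (rhol i) _; rewrite !ge_min lexx !orbT.
pose tau' := PosNum t0; pose eps' := PosNum e0.
pose wA k : anring i0 tau' eps' := @toA _ _ i0 tau' eps' _ (hw k).
pose gA k : anring i0 tau' eps' := @toA _ _ i0 tau' eps' _ (hr1 k).
pose FA k : anring i0 tau' eps' := @toA _ _ i0 tau' eps' _ (hr2 k).
have wAE k z : inO i0 tau' eps' z -> wA k z = w k z by exact: restrE.
have gAE k z : inO i0 tau' eps' z -> gA k z = r1 k z by exact: restrE.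
have FAE k z : inO i0 tau' eps' z -> FA k z = r2 k z by exact: restrE.
have hin z : inO i0 tau' eps' z -> inD (wt i0 tau eps) z by exact: inO_inD.
have wA0 k : wA k 0 = 0 by rewrite wAE ?w0 //; exact: inO0.
clearbody wA gA FA.
have Ou : O u := An_O rhop hu.
have Oq1 : O q1 := An_O rhop hq1.
have u0 : u 0 != 0.
  have [h0 _] := hm 0 (inD0 rho0).
  by rewrite -nm_gt0; apply: lt_le_trans h0.
have pW z : inO i0 tau' eps' z -> h z * u z = pf (Wp wA) z.
  move=> hz'; have [_ ->] := hm z (hin z hz'); rewrite (pfE _ hz') pz_Wp horner_Wp.
  by congr (_ + _); apply: eq_bigr => k _; rewrite wAE.
have fuP : near0 (fun z => h z * u z = pf (Wp wA) z).
  by apply: near0_imp (near0_inO' i0 tau' eps').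
have hsep := Wp_separable wA0 Ou u0 fuP hred.
(* The remainder of [g] plus the Weierstrass polynomial of [h]: the class modulo [h] is unchanged,
   and the sum is monic, as Gauss's lemma requires. *)
pose G := Wp (fun k => wA k + gA k).
have pG z : inO i0 tau' eps' z -> g z = pf G z + (q1 z - u z) * h z.
  move=> hz'; rewrite (eg z (hin z hz')) mulrBl [u z * _]mulrC pW // !(pfE _ hz') !pz_Wp !horner_Wp.
  have -> : \sum_(k < d) (wA k + gA k) z * z ord0 i0 ^+ k =
     \sum_(k < d) wA k z * z ord0 i0 ^+ k + \sum_k r1 k z * z ord0 i0 ^+ k.
    by rewrite -big_split; apply: eq_bigr => k _; rewrite avalD mulrDl /= -gAE.
  by ring.
have hcopP : coprimep (Wp wA) G.
  apply: (Wp_coprime wA0 Ou u0 fuP (g := g) (s := fun z => q1 z - u z)) => //.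
  - exact: Wp_monic.
  - exact: O_sub.
  - by apply: near0_imp (near0_inO' i0 tau' eps').
have F0 : forall k, FA k = 0.
  apply: (remainder_eq0 hsep hcopP) => z hz' t tP Gt.
  have tt : nm t < tau.
    apply: hroot (hin z hz') _ _; move/rootP: tP; rewrite pz_Wp horner_Wp => e.
    by rewrite -[RHS]e; congr (_ + _); apply: eq_bigr => k _; rewrite wAE.
  (* The point [y] over [z] with [z_i0 = t] lies on [h = 0] and off [g = 0]. Hence [F y = 0], which
     says that the remainder of [F] vanishes at [t]. *)
  have hy := inO_upd hz' tt; set y := upd i0 z t in hy.
  have yt : y ord0 i0 = t by rewrite mxE eqxx.
  have ev (a : anring i0 tau' eps') : a y = a z by apply: aval_upd.
  have pzy (p : {poly anring i0 tau' eps'}) : pz hy p = pz hz' p.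
    by apply/polyP => k; rewrite !coef_pz ev.
  have hy0 : h y = 0.
    have := pW y hy; rewrite (pfE _ hy) pzy yt (rootP tP) => /eqP; rewrite mulf_eq0.
    case/orP => /eqP // uy; have [] := hm y (hin y hy); rewrite uy nm0 => h1.
    by have := lt_le_trans m0 h1; rewrite ltxx.
  have gy : g y != 0 by rewrite pG // hy0 mulr0 addr0 (pfE _ hy) pzy yt.
  have : g y * F y = 0.
    apply: hs hy0; move=> i; apply: le_trans (hin y hy i) _; apply: le_trans (rhol i) _.
    by rewrite ge_min lexx.
  move/eqP; rewrite mulf_eq0 (negbTE gy) => /eqP Fy.
  rewrite -pzy pz_ppoly horner_ppoly; have := eF y (hin y hy).
  rewrite Fy hy0 mulr0 add0r => e; rewrite [RHS]e.
  by apply: eq_bigr => k _; rewrite FAE // yt.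
exists q2; split; first exact: An_O rhop hq2.
apply: near0_imp (near0_inO' i0 tau' eps') => z hz'.
rewrite (eF z (hin z hz')) big1 ?addr0 1?mulrC // => k _.
by rewrite -FAE // F0 aval0 mul0r.
Qed.

Lemma null_dvd g h F : O g -> O h -> O F -> gred h -> gcop g h ->
  near0 (fun z => h z = 0 -> g z * F z = 0) -> gdvd h F.
Proof.
move=> Og Oh OF hr hc hz; have [h0|h0] := eqVneq (h 0) 0; last exact: gdvd_unit.
have [L [L' [i0 [d [[LO L0] [LO' L0'] LK LK' ho]]]]] := regular_change Oh (gred_nz hr) h0.
have := @null_dvd_regular (fun z => g (L z)) (fun z => h (L z)) (fun z => F (L z)) i0 d
  (O_sub_map LO L0 Og) (O_sub_map LO L0 Oh) (O_sub_map LO L0 OF) ho.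
move=> /(_ (gred_change LO' L0' LK' hr) (gcop_change LO' L0' LK' hc)).
move=> /(_ (near0_comp LO L0 hz)) /(gdvd_back LO' L0' LK') [b [Ob hb]]; exists b; split=> //.
by apply: near0_imp hb => z; rewrite LK'.
Qed.

Lemma gcop_sym f g : gcop f g -> gcop g f.
Proof. by move=> h a Oa ha hb; apply: h. Qed.

Lemma gred_null_dvd h F : O h -> O F -> gred h -> near0 (fun z => h z = 0 -> F z = 0) -> gdvd h F.
Proof.
move=> Oh OF hr hz; apply: (null_dvd (O_const _ 1) Oh OF hr).
  move=> a Oa [b [Ob hb]] _; have := near0_0 hb.
  by apply: contra_eq_neq => ->; rewrite mul0r oner_eq0.
by apply: near0_imp hz => z e /e ->; rewrite mulr0.
Qed.

Lemma gred_assoc h h' : O h -> O h' -> gred h -> gred h' -> near0 (fun z => h z = 0 <-> h' z = 0) ->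
  exists u, [/\ O u, u 0 != 0 & near0 (fun z => h' z = u z * h z)].
Proof.
move=> Oh Oh' hr hr' e.
have [|b [Ob hb]] := gred_null_dvd Oh Oh' hr; first by apply: near0_imp e => z [].
have [|b' [Ob' hb']] := gred_null_dvd Oh' Oh hr'; first by apply: near0_imp e => z [].
exists b; split=> //; last by apply: near0_imp hb => z ->; rewrite mulrC.
have : near0 (fun z => b z * b' z = 1).
  apply: (gcancel Oh) => //; [exact: O_mul|exact: O_const|exact: gred_nz|].
  by apply: near0_imp (near0_and hb hb') => z [e1 e2]; rewrite mulrA -e1 -e2 mulr1.
by move/near0_0; apply: contra_eq_neq => ->; rewrite mul0r eq_sym oner_eq0.
Qed.

(** If [g h = a a b], then [a b] vanishes wherever [g] or [h] does, so both divide it, and by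
    coprimality so does their product. Cancelling [a b] leaves an inverse of [a]. *)
Lemma gred_mul g h : O g -> O h -> gred g -> gred h -> gcop g h -> gred (fun z => g z * h z).
Proof.
move=> Og Oh hg hh hc a Oa [b [Ob e]].
have Oab := O_mul Oa Ob.
have ab z : a z * a z * b z = 0 -> a z * b z = 0.
  by move/eqP; rewrite !mulf_eq0 => /orP[/orP[]|] /eqP ->; rewrite ?mul0r ?mulr0.
have [|k [Ok hk]] := gred_null_dvd Oh Oab hh.
  by apply: near0_imp e => z e hz; apply: ab; rewrite -e hz mulr0.
have [|l [Ol hl]] := gred_null_dvd Og Oab hg.
  by apply: near0_imp e => z e hz; apply: ab; rewrite -e hz mul0r.
have [|m [Om hm]] := null_dvd Og Oh Ol hh hc.
  apply: near0_imp (near0_and hk hl) => z [e1 e2] hz.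
  by rewrite -e2 e1 hz mul0r.
have nz : ~ gzero (fun z => a z * b z).
  move=> ab0; case: (gzero_mul Og Oh); [|exact: gred_nz|exact: gred_nz].
  by apply: near0_imp (near0_and ab0 e) => z [h1 ->]; rewrite -mulrA h1 mulr0.
have : near0 (fun z => a z * m z = 1).
  apply: (gcancel Oab) nz _; [exact: O_mul|exact: O_const|].
  apply: near0_imp (near0_and e (near0_and hl hm)) => z [h1 [h2 h3]].
  have -> : a z * b z * (a z * m z) = a z * a z * b z * m z by ring.
  by rewrite -h1 mulr1 h2 h3; ring.
by move/near0_0; apply: contra_eq_neq => ->; rewrite mul0r eq_sym oner_eq0.
Qed.
End Null.

(** * Vector fields *)

Section Calculus.
Variables (R : realType) (n : nat).
Notation C := (Cplx R).
Notation V := 'rV[Cplx R]_n.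
Notation word := (seq 'I_n).
Implicit Types (z : V) (f g : V -> C) (J : {set 'I_n}).

Lemma near0_shift (P : V -> Prop) : near0 P -> near0 (fun a => near0 (fun h => P (a + h))).
Proof.
move=> [r [r0 hr]]; exists (r / 2); split; first by rewrite divr_gt0.
move=> a ha; exists (r / 2); split; first by rewrite divr_gt0.
move=> h hh; apply: hr => i; rewrite mxE; apply: le_trans (nmD _ _) _.
by apply: le_trans (lerD (ha i) (hh i)) _; rewrite /cst; lra.
Qed.

Lemma near0_grad_at f : O f -> near0 (fun a => grad_at f a (fun i => pd i f a)).
Proof. by move=> /O_Oat; apply: near0_imp => a; exact: Oat_grad_at. Qed.

Lemma pd_near f g i : O f -> near0 (fun z => f z = g z) -> near0 (fun z => pd i f z = pd i g z).
Proof.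
move=> Of e; apply: near0_imp (near0_and (near0_grad_at Of) (near0_shift e)) => a [h1 h2].
by rewrite (grad_at_pd i (grad_at_ext h2 h1)).
Qed.

Lemma pd_add i f g : O f -> O g -> near0 (fun z => pd i (fun z => f z + g z) z = pd i f z + pd i g z).
Proof.
move=> Of Og; apply: near0_imp (near0_and (near0_grad_at Of) (near0_grad_at Og)) => a [h1 h2].
exact: grad_at_pd (grad_at_add h1 h2).
Qed.

Lemma pd_mul i f g : O f -> O g ->
  near0 (fun z => pd i (fun z => f z * g z) z = f z * pd i g z + pd i f z * g z).
Proof.
move=> Of Og; apply: near0_imp (near0_and (near0_grad_at Of) (near0_grad_at Og)) => a [h1 h2].
exact: grad_at_pd (grad_at_mul h1 h2).
Qed.

Lemma pd_var i j z : pd i (fun z : V => z ord0 j) z = (i == j)%:R.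
Proof. exact: grad_at_pd (grad_at_var j z). Qed.

Lemma pd_comp i f (F : V -> V) : O f -> (forall j, O (fun z => F z ord0 j)) -> F 0 = 0 ->
  near0 (fun z => pd i (fun z => f (F z)) z = \sum_j pd j f (F z) * pd i (fun z => F z ord0 j) z).
Proof.
move=> Of OF F0; have h1 := near0_comp OF F0 (near0_grad_at Of).
have h2 := near0_fin (fun j => near0_grad_at (OF j)).
by apply: near0_imp (near0_and h1 h2) => a [k1 k2]; exact: grad_at_pd (grad_at_comp k2 k1).
Qed.

Lemma dmat_comp (F G : V -> V) : (forall j, O (fun z => F z ord0 j)) -> F 0 = 0 ->
  (forall j, O (fun z => G z ord0 j)) -> G 0 = 0 -> dmat (fun z => G (F z)) = dmat F *m dmat G.
Proof.
move=> OF F0 OG G0; apply/matrixP => j i; rewrite [LHS]mxE [RHS]mxE.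
rewrite (near0_0 (pd_comp j (OG i) OF F0)) F0.
by apply: eq_bigr => k _; rewrite [LHS]mulrC; congr (_ * _); rewrite /dmat mxE.
Qed.

Lemma dmat_near (F G : V -> V) : (forall j, O (fun z => F z ord0 j)) -> near0 (fun z => F z = G z) ->
  dmat F = dmat G.
Proof.
move=> OF e; apply/matrixP => j i; rewrite [LHS]mxE [RHS]mxE; apply: near0_0 (pd_near j (OF i) _).
by apply: near0_imp e => z ->.
Qed.

Lemma dmat_id : dmat (fun z : V => z) = 1%:M.
Proof. by apply/matrixP => j i; rewrite [LHS]mxE [RHS]mxE pd_var. Qed.

(* b, seen as the vector field \sum_i b_i d/dx_i, acting on f *)
Definition dv (b : 'I_n -> V -> C) f z : C := \sum_i b i z * pd i f z.

Lemma O_dv b f : (forall i, O (b i)) -> O f -> O (dv b f).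
Proof. by move=> Ob Of; apply: O_sum => i; apply: O_mul => //; exact: O_pd. Qed.

Lemma dv_near b f g : O f -> near0 (fun z => f z = g z) -> near0 (fun z => dv b f z = dv b g z).
Proof.
move=> Of e; apply: near0_imp (near0_fin (fun i => pd_near i Of e)) => z h.
by apply: eq_bigr => i _; rewrite h.
Qed.

Lemma dv_mul b f g : O f -> O g ->
  near0 (fun z => dv b (fun z => f z * g z) z = f z * dv b g z + dv b f z * g z).
Proof.
move=> Of Og; apply: near0_imp (near0_fin (fun i => pd_mul i Of Og)) => z h.
rewrite /dv mulr_sumr mulr_suml -big_split /=; apply: eq_bigr => i _.
by rewrite h mulrDr mulrCA; congr (_ + _); rewrite mulrA.
Qed.

Lemma dv_comp b f (F : V -> V) : O f -> (forall j, O (fun z => F z ord0 j)) -> F 0 = 0 ->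
  near0 (fun z => dv b (fun z => f (F z)) z = \sum_j pd j f (F z) * dv b (fun z => F z ord0 j) z).
Proof.
move=> Of OF F0; apply: near0_imp (near0_fin (fun i => pd_comp i Of OF F0)) => z h.
rewrite /dv; under [RHS]eq_bigr do rewrite mulr_sumr.
rewrite exchange_big /=; apply: eq_bigr => i _; rewrite h mulr_sumr.
by apply: eq_bigr => j _; rewrite mulrCA.
Qed.

(** Independence of the variables in [J] appears in three forms: series in words avoiding [J],
    invariance under [pr J], and vanishing derivatives. [off_pr], [pd0_pr] and [off_pd] pass between
    them. *)
Definition offw J : pred word := all (fun i => i \notin J).
Definition pr J z : V := \row_i (if i \in J then 0 else z ord0 i).

Lemma pr0 J : pr J 0 = 0.
Proof. by apply/rowP => i; rewrite !mxE; case: ifP. Qed.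
Lemma O_pr J i : O (fun z => pr J z ord0 i).
Proof.
apply: (@O_ext _ _ (fun z => if i \in J then 0 else z ord0 i)).
  by apply: near0_all => z; rewrite mxE.
by case: (i \in J); [exact: O_const|exact: O_var].
Qed.
Lemma subQ_off J : subQ (offw J).
Proof. by move=> w w' s /allP h; apply/allP => i /(mem_subseq s)/h. Qed.
Lemma catQ_off J : catQ (offw J).
Proof. by move=> w w' h1 h2; rewrite /offw all_cat; apply/andP. Qed.

Lemma inD_pr J (rho : 'I_n -> R) z : nneg rho -> inD rho z -> inD rho (pr J z).
Proof. by move=> h0 hz i; rewrite mxE; case: ifP => _ //; rewrite nm0. Qed.

Lemma off_pr J f : O_ (offw J) f -> near0 (fun z => f (pr J z) = f z).
Proof.
move=> [r [M [r0 hf]]]; exists r; split=> // z hz; have h0 := nneg_cst (n := n) (ltW r0).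
apply: (An_congr _ hf _ hz); last exact: inD_pr.
move=> w /allP hw; apply: eq_big_seq => i /hw /negbTE iJ; by rewrite mxE iJ.
Qed.

Lemma O_off J f : O f -> O_ (offw J) (fun z => f (pr J z)).
Proof.
move=> [r [M [r0 hf]]]; exists r, M; split=> //; have h0 := nneg_cst (n := n) (ltW r0).
have [f1 [f2 [h1 h2 e]]] := An_split (offw J) h0 hf.
apply: (An_ext _ h1) => z hz; rewrite e ?inD_pr //; last exact: inD_pr.
have -> : f2 (pr J z) = 0.
  rewrite (@An_lin1 _ _ _ _ _ _ (pr J z) 0 (pr J z) _ h2) ?mul0r //; try exact: inD_pr.
  move=> w /andP[_ /allPn[i iw /negPn iJ]]; rewrite mul0r.
  by apply/eqP; rewrite /wev prodf_seq_eq0; apply/hasP; exists i; rewrite //= mxE iJ eqxx.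
rewrite addr0; apply: (An_congr _ h1); [|by []|exact: inD_pr].
by move=> w /allP hw; apply: eq_big_seq => i /hw /negbTE iJ; rewrite mxE iJ.
Qed.

(* Constancy along the J-directions: N steps of size 1/N change f by O(1/N). *)
Lemma pd0_pr J f : O f -> near0 (fun z => forall i, i \in J -> pd i f z = 0) ->
  near0 (fun z => f (pr J z) = f z).
Proof.
move=> [r [M [r0 hf]]] [s [s0 hs]].
pose e := Num.min s (r / 2); have e0 : 0 < e by rewrite lt_min s0 divr_gt0.
have er : e <= r / 2 by rewrite ge_min lexx orbT.
have es : e <= s by rewrite ge_min lexx.
exists e; split=> // z hz.
have re0 : 0 < r - e by have := er; lra.
set K := (r - e)^-1 + M / (r - e) ^+ 2.
have hK a : inD (cst e) a -> grad_at_bound K f a (fun i => pd i f a).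
  move=> ha; have [] // := An_grad_at_bound re0 (An_recenter ha (ltW e0) _ hf).
  by have := er; lra.
have [K0 _] := hK z hz.
pose a (N k : nat) : V := pr J z + (k%:R / N.+1%:R) *: (z - pr J z).
have ha N k : (k <= N.+1)%N -> inD (cst e) (a N k).
  move=> kN i; rewrite !mxE; case: ifP => _; last by rewrite subrr mulr0 addr0.
  rewrite add0r subr0 nmM -[_ / _]/(k%:R / N.+1%:R : C).
  have -> : nm (k%:R / N.+1%:R : C) = k%:R / N.+1%:R by rewrite nmM nmV !nm_nat.
  apply: le_trans (hz i); rewrite ler_piMl ?nm_ge0 // ler_pdivrMr ?ltr0n // mul1r ler_nat //.
have step N k : (k < N.+1)%N -> K * (e / N.+1%:R) <= 1 ->
    nm (f (a N k.+1) - f (a N k)) <= K * (e / N.+1%:R) ^+ 2.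
  move=> kN KN; have [_ h] := hK _ (ha N k (ltnW kN)).
  have eN : 0 <= e / N.+1%:R by rewrite divr_ge0 // ltW.
  pose h' : V := N.+1%:R^-1 *: (z - pr J z).
  have hh : inD (cst (e / N.+1%:R)) h'.
    move=> i; rewrite !mxE; case: ifP => _; last by rewrite subrr mulr0 nm0.
    by rewrite subr0 nmM nmV nm_nat mulrC ler_wpM2r ?invr_ge0.
  have := h _ h' eN KN hh; rewrite big1 => [|i _]; last first.
    case: (boolP (i \in J)) => iJ; last by rewrite !mxE (negbTE iJ) subrr mulr0 mul0r.
    rewrite (hs (a N k)) ?mulr0 // => j; apply: le_trans (ha N k (ltnW kN) j) _.
    exact: es.
  rewrite subr0; suff -> : a N k + h' = a N k.+1 by [].
  by rewrite /a /h' -addrA -scalerDl -[k.+1]addn1 natrD mulrDl div1r.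
have tele N : K * (e / N.+1%:R) <= 1 -> nm (f z - f (pr J z)) <= K * e ^+ 2 / N.+1%:R.
  move=> KN; have -> : f z - f (pr J z) = \sum_(k < N.+1) (f (a N k.+1) - f (a N k)).
    rewrite -(big_mkord xpredT (fun k => f (a N k.+1) - f (a N k))) telescope_sumr //.
    by rewrite /a divff ?pnatr_eq0 // mul0r scale0r addr0 scale1r addrCA subrr addr0.
  apply: le_trans (nm_sum _ _ _) _; apply: (@le_trans _ _ (\sum_(k < N.+1) K * (e / N.+1%:R) ^+ 2)).
    by apply: ler_sum => k _; exact: step.
  rewrite sumr_const card_ord -[leLHS]mulr_natr expr_div_n.
  rewrite [leLHS](_ : _ = K * e ^+ 2 / N.+1%:R) //.
  have : (N.+1%:R : R) != 0 by rewrite pnatr_eq0.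
  by move: (N.+1%:R : R) => x x0; field.
apply/esym/eqP; rewrite -subr_eq0 -nm_eq0; apply/eqP.
apply: le_anti; rewrite nm_ge0 andbT; apply/ler_addgt0Pr => d d0; rewrite add0r.
have [N hN] : exists N : nat, K * e <= N.+1%:R /\ K * e ^+ 2 / d <= N.+1%:R.
  have hN1 := ltW (archi_boundP (mulr_ge0 (ltW K0) (ltW e0))).
  have h3 : 0 <= K * e ^+ 2 / d.
    by rewrite !mulr_ge0 ?invr_ge0 ?exprn_ge0 //; apply: ltW.
  have hN2 := ltW (archi_boundP h3).
  exists (Num.bound (K * e) + Num.bound (K * e ^+ 2 / d))%N; split.
    by apply: le_trans hN1 _; rewrite ler_nat leqW // leq_addr.
  by apply: le_trans hN2 _; rewrite ler_nat leqW // leq_addl.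
have [h1 h2] := hN; apply: le_trans (tele N _) _.
  by rewrite mulrA ler_pdivrMr ?ltr0n // mul1r.
by rewrite ler_pdivrMr ?ltr0n // [leRHS]mulrC -ler_pdivrMr.
Qed.

End Calculus.

(** * Straightening logarithmic vector fields *)

Local Opaque pd.

Section Straighten.
Variables (R : realType) (n : nat).
Notation C := (Cplx R).
Notation V := 'rV[Cplx R]_n.
Implicit Types (z : V) (f : V -> C) (J : {set 'I_n}).

Definition biholo (Phi Psi : V -> V) :=
  [/\ (forall i, O (fun z => Phi z ord0 i)) /\ Phi 0 = 0,
      (forall i, O (fun z => Psi z ord0 i)) /\ Psi 0 = 0,
      near0 (fun z => Phi (Psi z) = z) & near0 (fun z => Psi (Phi z) = z)].

Lemma O_map f (F : V -> V) : (forall i, O (fun z => F z ord0 i)) /\ F 0 = 0 -> O f -> O (fun z => f (F z)).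
Proof. by move=> [OF F0]; apply: O_sub_map. Qed.

Lemma near0_map (P : V -> Prop) (F : V -> V) : (forall i, O (fun z => F z ord0 i)) /\ F 0 = 0 ->
  near0 P -> near0 (fun z => P (F z)).
Proof. by move=> [OF F0]; apply: near0_comp. Qed.

Lemma biholo_id : biholo (fun z => z) (fun z => z).
Proof. by split; (try by split=> // i; exact: O_var); apply: near0_all. Qed.

Lemma biholo_comp Phi Psi Y Y' : biholo Phi Psi -> biholo Y Y' ->
  biholo (fun z => Y (Phi z)) (fun z => Psi (Y' z)).
Proof.
move=> [hP hP' e1 e2] [hY hY' e3 e4]; split.
- by split=> [i|]; [apply: (O_map (f := fun z => Y z ord0 i) hP); apply: hY.1|rewrite hP.2 hY.2].
- by split=> [i|]; [apply: (O_map (f := fun z => Psi z ord0 i) hY'); apply: hP'.1|rewrite hY'.2 hP'.2].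
- by apply: near0_imp (near0_and e3 (near0_map hY' e1)) => z [h1 h2]; rewrite h2.
- by apply: near0_imp (near0_and e2 (near0_map hP e4)) => z [h1 h2]; rewrite h2.
Qed.

Lemma off_pd J f j : O f -> near0 (fun z => f (pr J z) = f z) -> j \in J -> near0 (fun z => pd j f z = 0).
Proof.
move=> Of e jJ; have Op : O (fun z => f (pr J z)) := O_sub_map (O_pr R J) (pr0 R J) Of.
apply: near0_imp (near0_and (pd_near j Op e) (pd_comp j Of (O_pr R J) (pr0 R J))) => z [<- ->].
apply: big1 => k _; rewrite (_ : pd j _ z = 0) ?mulr0 //; case: (boolP (k \in J)) => kJ.
  have -> : (fun z => pr J z ord0 k) = (fun=> 0) by apply/funext => y; rewrite mxE kJ.
  exact: grad_at_pd (grad_at_const _ _).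
have -> : (fun z => pr J z ord0 k) = (fun z => z ord0 k) by apply/funext => y; rewrite mxE (negbTE kJ).
by rewrite pd_var; case: eqP jJ kJ => // -> ->.
Qed.

Lemma sum_pick (F G : 'I_n -> C) j : (forall i, G i = (i == j)%:R) -> \sum_i F i * G i = F j.
Proof.
move=> hG; rewrite (bigD1 j) //= hG eqxx mulr1 big1 ?addr0 // => i ij.
by rewrite hG (negbTE ij) mulr0.
Qed.

Section OneField.
Variables (J : {set 'I_n}) (i0 : 'I_n) (b : 'I_n -> V -> C) (c f : V -> C).
Hypotheses (i0J : i0 \notin J) (Ob : forall i, O (b i)) (b0 : b i0 0 != 0) (Oc : O c) (Of : O f).
Hypothesis flatJ : near0 (fun z => forall j, j \in J -> pd j f z = 0).
Hypothesis logb : near0 (fun z => dv b f z = c z * f z).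
Notation Q := (offw J).

(** The field is divided by its component along [i0], its coefficients are frozen on the slice where
    the variables in [J] vanish, and its components in [J] are dropped. As [f] does not depend on
    these variables, the field stays logarithmic; the coefficients now avoid [J], so straightening
    preserves what was achieved before. *)
Let b' i : V -> C := if i == i0 then fun=> 1 else if i \in J then fun=> 0 else
  fun z => b i (pr J z) * (b i0 (pr J z))^-1.
Let c' z : C := c (pr J z) * (b i0 (pr J z))^-1.

Let O_cstQ (a : C) : O_ Q ((fun=> a) : V -> C).
Proof. by exists 1, (nm a); split=> //; exact: An_const. Qed.

Let Ob' i : O_ Q (b' i).
Proof.
rewrite /b'; case: (i == i0); first exact: O_cstQ.
case: (i \in J); first exact: O_cstQ.
by apply: (@O_off R n J (fun z => b i z * (b i0 z)^-1)); apply: O_mul => //; exact: O_inv.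
Qed.
Let Oc' : O_ Q c'.
Proof. by apply: (@O_off R n J (fun z => c z * (b i0 z)^-1)); apply: O_mul => //; exact: O_inv. Qed.
Let OQ_O (g : V -> C) : O_ Q g -> O g.
Proof. by move=> [r [M [r0 h]]]; exists r, M; split=> //; apply: An_weak h; exact: nneg_cst (ltW r0). Qed.

Let logb' : near0 (fun z => dv b' f z = c' z * f z).
Proof.
have hp : (forall i, O (fun z => pr J z ord0 i)) /\ pr J 0 = 0 :> V by split; [exact: O_pr|exact: pr0].
have e := pd0_pr Of flatJ; have Op := OQ_O (O_off J Of).
have h0 (i : 'I_n) : near0 (fun z => pd i f z = pd i f (pr J z)).
  have k1 := pd_near i Op e.
  have k2 := off_pr (O_pdQ i (@subQ_off n J) (O_off J Of)).
  apply: near0_imp (near0_and k1 (near0_and k2 (near0_map hp k1))) => z [a1 [a2 a3]].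
  by move: a1 a2 a3; move: (pd _ _ _) (pd _ _ _) (pd _ _ _) (pd _ _ _) => p1 p2 p3 p4 <- <-.
have h1 := near0_fin h0.
have h2 := near0_map hp logb; have h3 := near0_map hp (O_neq0 (Ob i0) b0).
apply: near0_imp (near0_and h1 (near0_and h2 (near0_and h3 (near0_and e flatJ)))).
move=> z [k1 [k2 [k3 [k4 k5]]]]; rewrite /c' -k4 mulrAC -k2 /dv mulr_suml.
apply: eq_bigr => i _; rewrite -k1 mulrAC; rewrite /b'; case: eqP => [->|_]; first by rewrite mulfV.
by case: (boolP (i \in J)) => [/k5 ->|//]; rewrite !mulr0.
Qed.

(** For [i] outside [J] and different from [i0] this is a first integral of [b'] equal to [z_i] on
    the hyperplane [z_i0 = 0], from [solve_field] with zero potential; the remaining coordinates are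
    kept. *)
Let newcoord i : exists F : V -> C, [/\ O F, near0 (fun z => dv b' F z = (i == i0)%:R),
  near0 (fun z => z ord0 i0 = 0 -> F z = z ord0 i),
  (forall j, j \in J -> near0 (fun z => pd j F z = (j == i)%:R)) &
  i = i0 -> F = fun z => z ord0 i].
Proof.
have dvv z k : dv b' (fun z => z ord0 k) z = b' k z.
  rewrite /dv (bigD1 k) //= pd_var eqxx mulr1 big1 ?addr0 // => j jk.
  by rewrite pd_var (negbTE jk) mulr0.
case: (boolP ((i == i0) || (i \in J))) => hi.
  exists (fun z => z ord0 i); split=> //; first exact: O_var.
  - apply: near0_all => z; rewrite dvv /b'; case: eqP hi => //= _ ->; by [].
  - exact: near0_all.
  - by move=> j _; apply: near0_all => z; rewrite pd_var.
move: hi; rewrite negb_or => /andP[ii iJ].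
have hx : O_ Q (fun z : V => z ord0 i).
  by exists 1, 1; split=> //; apply: An_var => //; rewrite /offw /= iJ.
have [|||F [OF h1 h2]] := @solve_field _ _ b' (fun=> 0) i0 _ Q (fun z => z ord0 i) (@subQ_off n J) (@catQ_off n J) _ _ Ob' (O_cstQ 0) hx => //.
- by move=> z; rewrite /b' eqxx.
- by rewrite /offw /= i0J.
exists F; split=> //.
- exact: OQ_O.
- by apply: near0_imp h1 => z; rewrite /fieldop mul0r subr0 (negbTE ii).
- move=> j jJ; apply: near0_imp (off_pd (OQ_O OF) (off_pr OF) jJ) => z ->.
  by case: eqP iJ jJ => // -> /negbTE ->.
- by move=> e; rewrite e eqxx in ii.
Qed.

(** In the coordinates [F] the field [b'] becomes the coordinate field of [i0]. A solution [U] of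
    [b' U = c' U] with value 1 on the hyperplane has the same logarithmic derivative as [f], so
    [f / U] is constant along the field. *)
Lemma straighten_field : exists (Y Y' : V -> V) (U : V -> C), [/\ biholo Y Y', O U, U 0 != 0 &
  near0 (fun z => forall j, j \in i0 |: J -> pd j (fun z => f (Y' z) * (U (Y' z))^-1) z = 0)].
Proof.
have [F hF] := choice newcoord; pose Y z : V := \row_i F i z.
have YE i : (fun z => Y z ord0 i) = F i by apply/funext => z; rewrite mxE.
have OY i : O (fun z => Y z ord0 i) by rewrite YE; have [] := hF i.
have Y0 : Y 0 = 0.
  apply/rowP => i; rewrite !mxE; have [_ _ h _ _] := hF i.
  by have := near0_0 h; rewrite !mxE; apply.
have dY : dmat Y \in unitmx.
  (* The new coordinates agree with the old ones on [z_i0 = 0], so [N] lives in row [i0] off the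
     diagonal. Thus [N *m N = 0], and [1%:M - N] is the inverse. *)
  pose N := dmat Y - 1%:M.
  have hN j i : N j i = if (j == i0) && (i != i0) then N j i else 0.
    have e : N j i = pd j (F i) 0 - (j == i)%:R by rewrite 3!mxE YE mxE.
    case: ifP => // h; rewrite e; have [_ _ h3 _ h5] := hF i.
    have [ii|ii] := eqVneq i i0; first by rewrite (h5 ii) pd_var subrr.
    have ji : j != i0 by move: h; rewrite ii andbT => ->.
    have [s [s0 hs]] := h3.
    rewrite (pd_line (f := fun z => z ord0 i) s0 (grad_at_var i 0)) ?subrr // => t ht.
    rewrite add0r; apply/esym/hs; first exact: inD_line (ltW s0) ht.
    by rewrite !mxE eqxx [i0 == j]eq_sym (negbTE ji) mulr0.
  have NN : N *m N = 0.
    apply/matrixP => j i; rewrite [LHS]mxE [RHS]mxE; apply: big1 => k _.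
    rewrite [N j k]hN; case: ifP => [/andP[_ /negbTE h]|_]; last by rewrite mul0r.
    by rewrite [N k i]hN h mulr0.
  have e : dmat Y = 1%:M + N by rewrite /N addrC subrK.
  suff /mulmx1_unit[] : dmat Y *m (1%:M - N) = 1%:M by [].
  by rewrite e mulmxDl mul1mx mulmxBr mulmx1 NN subr0 subrK.
have [Y' [OY' Y'0 e1 e2]] := inverse_function OY Y0 dY.
have hY : (forall i, O (fun z => Y z ord0 i)) /\ Y 0 = 0 by [].
have hY' : (forall i, O (fun z => Y' z ord0 i)) /\ Y' 0 = 0 by [].
have [|||U [OQU hU1 hU2]] := @solve_field _ _ b' c' i0 _ Q (fun=> 1) (@subQ_off n J) (@catQ_off n J) _ _ Ob' Oc' (O_cstQ 1) => //.
- by move=> z; rewrite /b' eqxx.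
- by rewrite /offw /= i0J.
have OU := OQ_O OQU.
have U0 : U 0 != 0 by have := near0_0 hU2; rewrite mxE => ->.
exists Y, Y', U; split=> //.
pose k z := f z * (U z)^-1; have Ok : O k by apply: O_mul => //; exact: O_inv.
have ek : near0 (fun z => k z * U z = f z).
  by apply: near0_imp (O_neq0 OU U0) => z h; rewrite mulfVK.
have OkU := O_mul Ok OU.
have dk : near0 (fun z => dv b' k z = 0).
  apply: near0_imp (near0_and (dv_near b' OkU ek) (near0_and (dv_mul b' Ok OU)
    (near0_and logb' (near0_and hU1 (near0_and ek (O_neq0 OU U0)))))) => z [h1 [h2 [h3 [h4 [h5 h6]]]]].
  apply: (mulIf h6); rewrite mul0r; have e4 : dv b' U z = c' z * U z by apply/eqP; rewrite -subr_eq0; apply/eqP.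
  have := h2; rewrite h1 h3 e4 -h5 => e; apply: (addrI (k z * (c' z * U z))); rewrite -e addr0.
  by rewrite mulrCA.
have pk j : j \in J -> near0 (fun z => pd j k z = 0).
  move=> jJ; have hU := off_pd OU (off_pr OQU) jJ.
  apply: near0_imp (near0_and (pd_near j OkU ek) (near0_and (pd_mul j Ok OU)
    (near0_and flatJ (near0_and hU (O_neq0 OU U0))))) => z [h1 [h2 [h3 [h4 h6]]]].
  by apply: (mulIf h6); rewrite mul0r; move: h2; rewrite h1 (h3 j jJ) h4 mulr0 add0r.
have OF := O_map hY' Ok.
have eF : near0 (fun z => k (Y' (Y z)) = k z) by apply: near0_imp e2 => z ->.
(* A field [bb] with [bb (F i) = (i == j)] is the [j]-th coordinate field of the new coordinates.
   This is applied to [b'] for [i0] and to the old coordinate field for [j] in [J]. *)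
have chain (bb : 'I_n -> V -> C) (j : 'I_n) : near0 (fun z => dv bb k z = 0) ->
    near0 (fun z => forall i : 'I_n, dv bb (F i) z = (i == j)%:R) ->
    near0 (fun z => pd j (fun z => k (Y' z)) z = 0).
  move=> h1 h2; have OFY := O_map hY OF.
  have : near0 (fun z => pd j (fun z => k (Y' z)) (Y z) = 0).
    apply: near0_imp (near0_and h1 (near0_and h2 (near0_and (dv_near bb OFY eF) (dv_comp bb OF OY Y0)))).
    move=> z [k1 [k2 [k3 k4]]]; have k5 (i : 'I_n) : dv bb (fun z => Y z ord0 i) z = (i == j)%:R by rewrite YE.
    have k6 := sum_pick (fun i => pd i (fun z => k (Y' z)) (Y z)) k5.
    exact: etrans (esym k6) (etrans (esym k4) (etrans k3 k1)).
  by move=> h; apply: near0_imp (near0_and e1 (near0_map hY' h)) => z [->].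
apply: near0_fin => j; case: (boolP (j \in i0 |: J)) => [|_]; last exact: near0_all.
rewrite in_setU1 => hj; suff : near0 (fun z => pd j (fun z => k (Y' z)) z = 0).
  by apply: near0_imp => z.
case/orP: hj => [/eqP ->|jJ].
  by apply: (chain b') => //; apply: near0_fin => i; have [] := hF i.
have dvd g z : dv (fun i _ => (i == j)%:R) g z = pd j g z.
  rewrite /dv (bigD1 j) //= eqxx mul1r big1 ?addr0 // => i ij.
  by rewrite (negbTE ij) mul0r.
apply: (chain (fun i _ => (i == j)%:R)).
  by apply: near0_imp (pk j jJ) => z; rewrite dvd.
apply: near0_fin => i; have [_ _ _ h _] := hF i.
by apply: near0_imp (h j jJ) => z; rewrite dvd eq_sym.
Qed.
End OneField.

Definition flat f J (Phi Psi : V -> V) (u : V -> C) := [/\ biholo Phi Psi, O u, u 0 != 0 &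
  near0 (fun z => forall j, j \in J -> pd j (fun z => u (Psi z) * f (Psi z)) z = 0)].

Definition logf (b : 'I_n -> V -> C) f := exists c, O c /\ near0 (fun z => dv b f z = c z * f z).

(** The logarithmic field is transported to the coordinates already found, where its component along
    [i0] is nonzero at the origin, and straightened there. *)
Lemma flat_step f J Phi Psi u b i0 : O f -> flat f J Phi Psi u -> (forall i, O (b i)) -> logf b f ->
  i0 \notin J -> dv b (fun z => Phi z ord0 i0) 0 != 0 ->
  exists Phi' Psi' u', flat f (i0 |: J) Phi' Psi' u'.
Proof.
move=> Of [hB Ou u0 hfl] Ob [c [Oc hc]] iJ hb; have [hP hP' e1 e2] := hB.
pose ft z := u (Psi z) * f (Psi z).
have Ouf := O_mul Ou Of.
have Oft : O ft := O_map hP' Ouf.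
pose bt i z := dv b (fun z => Phi z ord0 i) (Psi z).
have Obt i : O (bt i) by apply: (O_map (f := dv b (fun z => Phi z ord0 i)) hP'); apply: O_dv => //; exact: hP.1.
(* Multiplying by the unit [u] adds the logarithmic derivative of [u] to the cofactor. *)
pose c1 z := c z + dv b u z * (u z)^-1.
have Oc1 : O c1 by apply: O_add => //; apply: O_mul; [exact: O_dv|exact: O_inv].
have e3 : near0 (fun z => ft (Phi z) = u z * f z).
  by apply: near0_imp e2 => z h; rewrite /ft h.
have h1 : near0 (fun z => \sum_j pd j ft (Phi z) * dv b (fun z => Phi z ord0 j) z = c1 z * (u z * f z)).
  have k1 := dv_near b (O_map hP Oft) e3.
  apply: near0_imp (near0_and k1 (near0_and (dv_comp b Oft hP.1 hP.2)
    (near0_and (dv_mul b Ou Of) (near0_and hc (O_neq0 Ou u0))))) => z [a1 [a2 [a3 [a4 a5]]]].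
  rewrite (etrans (esym a2) (etrans a1 a3)) a4 /c1 mulrDl mulrCA; congr (_ + _).
  by rewrite mulrA (divfK a5).
have h2 : near0 (fun z => dv bt ft z = c1 (Psi z) * ft z).
  apply: near0_imp (near0_and e1 (near0_map hP' h1)) => z [a1 a2].
  rewrite /ft -[RHS]a2 a1 /dv /bt; apply: eq_bigr => i _; exact: mulrC.
have bt0 : bt i0 0 != 0 by rewrite /bt hP'.2.
have [Y [Y' [U [hY OU U0 hk]]]] := straighten_field iJ Obt bt0 (O_map hP' Oc1) Oft hfl h2.
have [hY1 hY' e4 e5] := hY.
exists (fun z => Y (Phi z)), (fun z => Psi (Y' z)), (fun z => u z * (U (Phi z))^-1).
have OUP := O_map hP OU.
have UP0 : U (Phi 0) != 0 by rewrite hP.2.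
split; first exact: biholo_comp.
- by apply: O_mul => //; exact: O_inv.
- by rewrite mulf_neq0 ?invr_eq0.
have e6 : near0 (fun z => ft (Y' z) * (U (Y' z))^-1 =
    u (Psi (Y' z)) * (U (Phi (Psi (Y' z))))^-1 * f (Psi (Y' z))).
  by apply: near0_imp (near0_map hY' e1) => z h; rewrite h /ft mulrAC.
have OF : O (fun z => ft (Y' z) * (U (Y' z))^-1).
  by apply: (O_map (f := fun z => ft z * (U z)^-1) hY'); apply: O_mul => //; exact: O_inv.
apply: near0_imp (near0_and (near0_fin (fun j => pd_near j OF e6)) hk) => z [a1 a2] j jJ.
by rewrite -a1 a2.
Qed.

(** A logarithmic field with a nonzero component outside [J] enlarges [J], so the process stops. At
    the end the differentials of the coordinates outside [J] annihilate every logarithmic field at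
    the origin. *)
Lemma flat_max f : O f -> exists J Phi Psi u, flat f J Phi Psi u /\
  forall b, (forall i, O (b i)) -> logf b f -> forall i, i \notin J -> dv b (fun z => Phi z ord0 i) 0 = 0.
Proof.
move=> Of; suff gen m : forall J Phi Psi u, (n - #|J| < m)%N -> flat f J Phi Psi u ->
    exists J Phi Psi u, flat f J Phi Psi u /\ forall b, (forall i, O (b i)) -> logf b f ->
    forall i, i \notin J -> dv b (fun z => Phi z ord0 i) 0 = 0.
  apply: (gen n.+1 finset.set0 (fun z => z) (fun z => z) (fun=> 1)); first by rewrite ltnS leq_subr.
  split; [exact: biholo_id|exact: O_const|exact: oner_neq0|].
  by apply: near0_all => z j; rewrite finset.in_set0.
elim: m => // m IH J Phi Psi u hm hfl.
have [h|] := pselect (forall b, (forall i, O (b i)) -> logf b f -> forall i, i \notin J ->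
  dv b (fun z => Phi z ord0 i) 0 = 0); first by exists J, Phi, Psi, u.
move=> /existsNP[b] /not_implyP[Ob] /not_implyP[lb] hN.
have [i [iJ /eqP hb]] : exists i, i \notin J /\ dv b (fun z => Phi z ord0 i) 0 <> 0.
  apply: contrapT => h; apply: hN => i iJ; apply: contrapT => hb; apply: h; by exists i.
have [Phi' [Psi' [u' h']]] := flat_step Of hfl Ob lb iJ hb.
apply: IH h'; rewrite cardsU1 iJ; have := max_card (mem (i |: J)).
rewrite cardsU1 iJ card_ord add1n => hJ; rewrite subnS.
by move: hm; rewrite ltnS; apply: leq_trans; rewrite prednK // subn_gt0.
Qed.

End Straighten.

(** * Splitting the coordinates *)

Section SplitCoords.
Variable K : fieldType.

Lemma split_rows k r n (F : 'M[K]_(k, n)) (G : 'M[K]_(r, n)) (T D1 D2 : 'M[K]_n) :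
  (k + r = n)%N -> row_full (col_mx (F *m T) G) -> (D1 <= F)%MS -> (D2 <= G)%MS ->
  exists E1 E2 : 'M[K]_n, [/\ E1 *m T + E2 \in unitmx,
    forall i j : 'I_n, (k <= i)%N -> E1 i j = 0, forall i j : 'I_n, (i < k)%N -> E2 i j = 0,
    exists X, D1 = X *m E1 & exists Y, D2 = Y *m E2].
Proof.
move=> e; subst n => hf /submxP[X hX] /submxP[Y hY].
exists (col_mx F 0), (col_mx 0 G); split.
- by rewrite mul_col_mx mul0mx add_col_mx addr0 add0r -row_full_unit.
- move=> i j ik; rewrite mxE; case: splitP => l il; last by rewrite mxE.
  by move: ik; rewrite il leqNgt ltn_ord.
- move=> i j ik; rewrite mxE; case: splitP => l il; first by rewrite mxE.
  by move: ik; rewrite il ltnNge leq_addr.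
- by exists (row_mx X 0); rewrite mul_row_col mulmx0 addr0.
- by exists (row_mx 0 Y); rewrite mul_row_col mulmx0 add0r.
Qed.

(** [D1] and [D2] project onto the coordinates that each germ uses, and [T] compares the two charts.
    Independent row spaces can share one basis, its first [k] rows coming from [D1]; the rows are
    distributed over [E1] and [E2] with complementary supports. *)
Lemma split_coords n (T D1 D2 : 'M[K]_n) : T \in unitmx -> (D1 *m T :&: D2 = 0)%MS ->
  D1 != 0 -> D2 != 0 -> exists (k : nat) (E1 E2 : 'M[K]_n), (0 < k < n)%N /\ [/\ E1 *m T + E2 \in unitmx,
    forall i j : 'I_n, (k <= i)%N -> E1 i j = 0, forall i j : 'I_n, (i < k)%N -> E2 i j = 0,
    exists X, D1 = X *m E1 & exists Y, D2 = Y *m E2].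
Proof.
move=> uT h0 D10 D20; set k := \rank D1; pose F : 'M[K]_(k, n) := row_base D1.
have eF : (F *m T :=: D1 *m T)%MS by apply: eqmxMr; exact: eq_row_base.
(* A complement of the sum is given to the second family, so that the two families together span the
   whole space. *)
pose R := ((D1 *m T + D2)^C + D2)%MS.
have rF : \rank (D1 *m T) = k by rewrite mxrankMfree // row_free_unit.
have full : (D1 *m T + R :=: 1%:M)%MS.
  apply/eqmxP; rewrite submx1 /= /R [X in (_ + X)%MS]addsmxC addsmxA; apply: submx_full.
  exact: addsmx_compl_full.
have rR : (\rank R <= n - k)%N.
  apply: leq_trans (mxrank_adds_leqif _ _) _.
  rewrite mxrank_compl mxrank_disjoint_sum // rF.
  have := rank_leq_col (D1 *m T + D2)%MS; rewrite mxrank_disjoint_sum // rF; lia.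
have nk : (n <= k + \rank R)%N.
  by have := mxrank_adds_leqif (D1 *m T) R; rewrite full mxrank1 rF => -[].
have kn : (k <= n)%N := rank_leq_row D1.
have e : (k + \rank R = n)%N by lia.
have r0 : (0 < \rank R)%N.
  apply: leq_trans (mxrankS (addsmxSr _ D2)); by rewrite lt0n mxrank_eq0.
have k0 : (0 < k)%N by rewrite lt0n mxrank_eq0.
have [|||E1 [E2 hE]] := @split_rows k (\rank R) n F (row_base R) T D1 D2 e.
- by rewrite -sub1mx -addsmxE (adds_eqmx eF (eq_row_base R)) full.
- by rewrite eq_row_base.
- by rewrite eq_row_base addsmxSr.
by exists k, E1, E2; split=> //; lia.
Qed.

(** The rows of [A] are the fields tangent to the first germ, and those of [1%:M - A] the fields
    tangent to the second. A covector common to both families is annihilated by [A^T] and by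
    [(1%:M - A)^T], hence by their sum, the identity. *)
Lemma split_fields n (T Q M1 M2 D1 D2 A : 'M[K]_n) : Q *m M2 = 1%:M -> M1 \in unitmx -> T = Q *m M1 ->
  D1^T = D1 -> D2^T = D2 -> A *m M1 *m D1 = 0 -> (1%:M - A) *m M2 *m D2 = 0 -> D1 != 0 -> D2 != 0 ->
  exists (k : nat) (E1 E2 : 'M[K]_n), (0 < k < n)%N /\ [/\ E1 *m T^T + E2 \in unitmx,
    forall i j : 'I_n, (k <= i)%N -> E1 i j = 0, forall i j : 'I_n, (i < k)%N -> E2 i j = 0,
    exists X, D1 = X *m E1 & exists Y, D2 = Y *m E2].
Proof.
move=> QM uM1 T0 tD1 tD2 A1 A2 D10 D20; have [uQ uM2] := mulmx1_unit QM.
have uT : T^T \in unitmx by rewrite unitmx_tr T0 unitmx_mul uQ.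
have eT : T^T *m M2^T = M1^T.
  by rewrite -trmx_mul T0 mulmxA (mulmx1C QM) mul1mx.
apply: split_coords => //; set W := (_ :&: _)%MS.
have /submxP[X1 hX1] : (W <= D1 *m T^T)%MS by exact: capmxSl.
have /submxP[X2 hX2] : (W <= D2)%MS by exact: capmxSr.
have w1 : W *m M2^T *m A^T = 0.
  rewrite hX1 -[X1 *m _ *m _]mulmxA -[D1 *m _ *m _]mulmxA eT.
  by rewrite -tD1 -!mulmxA -!trmx_mul A1 trmx0 mulmx0.
have w2 : W *m M2^T *m (1%:M - A)^T = 0.
  by rewrite hX2 -tD2 -!mulmxA -!trmx_mul A2 trmx0 mulmx0.
have : W *m M2^T = 0.
  have -> : W *m M2^T = W *m M2^T *m ((1%:M - A)^T + A^T).
    by rewrite -linearD /= subrK trmx1 mulmx1.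
  by rewrite mulmxDr w1 w2 addr0.
move/(congr1 (mulmx^~ (invmx M2^T))); rewrite /= mulmxK ?unitmx_tr // mul0mx.
by [].
Qed.

End SplitCoords.

(** * Splitting two germs by one system of coordinates *)

Section GermSplit.
Variables (R : realType) (n : nat).
Notation C := (Cplx R).
Notation V := 'rV[Cplx R]_n.
Implicit Types (z : V) (g h f : V -> C) (J : {set 'I_n}).

Definition offmx J : 'M[C]_n := \matrix_(i, j) ((i == j) && (i \notin J))%:R.

Lemma mul_offmx J m (A : 'M[C]_(m, n)) i j : (A *m offmx J) i j = if j \in J then 0 else A i j.
Proof.
rewrite mxE (bigD1 j) //= mxE eqxx big1 ?addr0 => [|k kj]; last by rewrite mxE (negbTE kj) mulr0.
by case: (j \in J); rewrite ?mulr0 ?mulr1.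
Qed.
Lemma mul_offmx_eq0 J m (A : 'M[C]_(m, n)) : (forall i j, j \notin J -> A i j = 0) -> A *m offmx J = 0.
Proof.
move=> h; apply/matrixP => i j; rewrite mul_offmx [RHS]mxE.
by case: (boolP (j \in J)) => // /h.
Qed.
Lemma pr_offmx J z : z *m offmx J = pr J z.
Proof. by apply/rowP => i; rewrite mul_offmx mxE. Qed.
Lemma tr_offmx J : (offmx J)^T = offmx J.
Proof. by apply/matrixP => i j; rewrite !mxE eq_sym; case: eqP => // ->. Qed.

Lemma dmat_biholo Phi Psi : biholo (R := R) (n := n) Phi Psi -> dmat Psi *m dmat Phi = 1%:M.
Proof.
move=> [[OP P0] [OP' P0'] e _]; rewrite -dmat_comp // -dmat_id.
by apply: dmat_near => // j; apply: (O_map (f := fun z => Phi z ord0 j) (conj OP' P0')).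
Qed.

Lemma pd_lin (F : 'I_n -> V -> C) (c : 'I_n -> C) j : (forall l, O (F l)) ->
  pd j (fun y => \sum_l F l y * c l) 0 = \sum_l pd j (F l) 0 * c l.
Proof.
move=> OF; have h l := near0_0 (near0_grad_at (OF l)).
rewrite (grad_at_pd j (grad_at_sum (fun l => grad_at_mul (h l) (grad_at_const (c l) 0)))).
by apply: eq_bigr => l _; rewrite mulr0 add0r.
Qed.

(** If [J] were everything, a unit multiple of [f] would be constant, hence zero. This yields
    [0 < k < n] in the end. *)
Lemma flat_nontrivial f J Phi Psi u : O f -> f 0 = 0 -> ~ gzero f -> flat f J Phi Psi u ->
  offmx J != 0.
Proof.
move=> Of f0 nz [[hP hP' e1 e2] Ou u0 hfl]; apply: contra_notN nz => /eqP D0.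
pose ft z := u (Psi z) * f (Psi z); have Oft : O ft by apply: (O_map (f := fun z => u z * f z) hP'); exact: O_mul.
have h1 : near0 (fun z => ft z = 0).
  apply: near0_imp (pd0_pr Oft hfl) => z <-.
  by rewrite -pr_offmx D0 mulmx0 /ft hP'.2 f0 mulr0.
apply: near0_imp (near0_and (near0_map hP h1) (near0_and e2 (O_neq0 Ou u0))) => z [a1 [a2 a3]].
by move: a1; rewrite /ft a2 => /eqP; rewrite mulf_eq0 (negbTE a3) => /eqP.
Qed.

(** Required at all points and not only near the origin; the functions produced below factor through
    a linear projection, so they satisfy it. *)
Definition dep_on (P : pred 'I_n) (G : V -> C) :=
  forall z z', (forall i, P i -> z ord0 i = z' ord0 i) -> G z = G z'.

(* Each coordinate field is the sum of a field tangent to g = 0 and a field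
   tangent to h = 0. *)
Lemma leibniz_fields g h : O g -> O h -> gred g -> gred h -> gcop g h ->
  (forall k, exists a : 'I_n -> V -> C, (forall i, O (a i)) /\
    near0 (fun z => g z * pd k h z = \sum_i a i z * pd i (fun z => g z * h z) z)) ->
  forall k, exists a : 'I_n -> V -> C, [/\ forall i, O (a i), logf a g &
    logf (fun i z => (i == k)%:R - a i z) h].
Proof.
move=> Og Oh rg rh cop hJ k; have [a [Oa ha]] := hJ k; exists a.
pose b i z := (i == k)%:R - a i z.
have Ob i : O (b i) by apply: O_sub => //; exact: O_const.
have e1 z : dv b h z = pd k h z - dv a h z.
  rewrite /dv /b -[pd k h z](@sum_pick _ _ (fun i => pd i h z) (fun i => (i == k)%:R)) //.
  by rewrite -sumrB; apply: eq_bigr => i _; rewrite mulrBl mulrC.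
have e2 : near0 (fun z => g z * dv b h z = h z * dv a g z).
  apply: near0_imp (near0_and ha (dv_mul a Og Oh)) => z [h1 h2].
  rewrite e1 mulrBr h1 -/(dv a (fun z => g z * h z) z) h2 addrAC subrr add0r; exact: mulrC.
have h1 : gdvd h (dv b h).
  apply: (null_dvd Og Oh _ rh cop); first exact: O_dv.
  by apply: near0_imp e2 => z -> ->; rewrite mul0r.
have h2 : gdvd g (dv a g).
  apply: (null_dvd Oh Og _ rg (gcop_sym cop)); first exact: O_dv.
  by apply: near0_imp e2 => z <- ->; rewrite mul0r.
split=> //.
  by have [c [Oc hc]] := h2; exists c; split=> //; apply: near0_imp hc => z ->; rewrite mulrC.
by have [c [Oc hc]] := h1; exists c; split=> //; apply: near0_imp hc => z ->; rewrite mulrC.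
Qed.

Lemma germ_split g h : O g -> O h -> gred g -> gred h -> gcop g h -> g 0 = 0 -> h 0 = 0 ->
  (forall k, exists a : 'I_n -> V -> C, (forall i, O (a i)) /\
    near0 (fun z => g z * pd k h z = \sum_i a i z * pd i (fun z => g z * h z) z)) ->
  exists (k : nat) (Phi Psi : V -> V) (u v G H : V -> C), (0 < k < n)%N /\
  [/\ biholo Phi Psi, O u /\ u 0 != 0, O v /\ v 0 != 0,
    dep_on (fun i => (i < k)%N) G /\ near0 (fun z => u (Psi z) * g (Psi z) = G z) &
    dep_on (fun i => (k <= i)%N) H /\ near0 (fun z => v (Psi z) * h (Psi z) = H z)].
Proof.
move=> Og Oh rg rh cop g0 h0 hJ; have [a ha] := choice (leibniz_fields Og Oh rg rh cop hJ).
have [J1 [Phi1 [Psi1 [u [fl1 cl1]]]]] := flat_max Og.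
have [J2 [Phi2 [Psi2 [v [fl2 cl2]]]]] := flat_max Oh.
have D10 := flat_nontrivial Og g0 (gred_nz rg) fl1.
have D20 := flat_nontrivial Oh h0 (gred_nz rh) fl2.
have [B1 Ou u0 fl1'] := fl1; have [B2 Ov v0 fl2'] := fl2.
have [hP1 hQ1 e11 e12] := B1; have [hP2 hQ2 e21 e22] := B2.
set D1 := offmx J1 in D10; set D2 := offmx J2 in D20.
set M1 := dmat Phi1; set M2 := dmat Phi2.
(* Covectors of the two germs are compared in the second chart; [th] passes from it to the first. *)
pose th z := Phi1 (Psi2 z).
have hth : (forall i, O (fun z => th z ord0 i)) /\ th 0 = 0.
  split=> [i|]; last by rewrite /th hQ2.2 hP1.2.
  exact: (O_map (f := fun z => Phi1 z ord0 i) hQ2 (hP1.1 i)).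
have T0 : dmat th = dmat Psi2 *m M1 := dmat_comp hQ2.1 hQ2.2 hP1.1 hP1.2.
have [_ uM1] := mulmx1_unit (dmat_biholo B1).
(* Row [k] holds the components at the origin of the field tangent to [g = 0] that is part of the
   [k]-th coordinate field. *)
pose A : 'M[C]_n := \matrix_(k, i) a k i 0.
have hA k i : (A *m M1) k i = dv (a k) (fun z => Phi1 z ord0 i) 0.
  by rewrite mxE; apply: eq_bigr => j _; rewrite [A _ _]mxE [M1 _ _]mxE.
have hB k i : ((1%:M - A) *m M2) k i = dv (fun i z => (i == k)%:R - a k i z) (fun z => Phi2 z ord0 i) 0.
  rewrite mxE; apply: eq_bigr => j _; rewrite [M2 _ _]mxE; congr (_ * _).
  by rewrite 4!mxE eq_sym.
have A1 : A *m M1 *m D1 = 0.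
  apply: mul_offmx_eq0 => k i iJ; rewrite hA; have [Oa la _] := ha k; exact: cl1.
have A2 : (1%:M - A) *m M2 *m D2 = 0.
  apply: mul_offmx_eq0 => k i iJ; rewrite hB; have [Oa _ la] := ha k; apply: cl2 => // j; apply: O_sub => //; exact: O_const.
have [k [E1 [E2 [hk [uE z1 z2 [X hX] [Y hY]]]]]] := split_fields (dmat_biholo B2) uM1 T0
  (tr_offmx J1) (tr_offmx J2) A1 A2 D10 D20.
(* By the complementary supports of [E1] and [E2], each new coordinate is a linear combination
   either of coordinates of the first chart or of coordinates of the second. *)
pose W z : V := \row_i (\sum_l th z ord0 l * E1 i l + \sum_l z ord0 l * E2 i l).
have WE z i : W z ord0 i = \sum_l th z ord0 l * E1 i l + \sum_l z ord0 l * E2 i l by rewrite mxE.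
have WE' i : (fun z => W z ord0 i) =
    fun z => \sum_l th z ord0 l * E1 i l + \sum_l z ord0 l * E2 i l by apply/funext.
have O1 i : O (fun z => \sum_l th z ord0 l * E1 i l).
  by apply: O_sum => l; apply: O_mul; [exact: hth.1|exact: O_const].
have O2 i : O (fun z : V => \sum_l z ord0 l * E2 i l).
  by apply: O_sum => l; apply: O_mul; [exact: O_var|exact: O_const].
have OW i : O (fun z => W z ord0 i) by rewrite WE'; exact: O_add.
have W0 : W 0 = 0.
  apply/rowP => i; rewrite WE hth.2 [RHS]mxE !big1 ?addr0 // => l _; by rewrite mxE mul0r.
have dW : dmat W \in unitmx.
  suff -> : dmat W = (E1 *m (dmat th)^T + E2)^T by rewrite unitmx_tr.
  apply/matrixP => j i; rewrite [LHS]mxE WE' (near0_0 (pd_add j (O1 i) (O2 i))).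
  rewrite (pd_lin _ _ hth.1) (pd_lin _ _ (@O_var R n)) !mxE; congr (_ + _).
    by apply: eq_bigr => l _; rewrite [_^T _ _]mxE [dmat th _ _]mxE mulrC.
  rewrite (bigD1 j) //= pd_var eqxx mul1r big1 ?addr0 // => l lj.
  by rewrite pd_var eq_sym (negbTE lj) mul0r.
have [W' [OW' W'0 e1 e2]] := inverse_function OW W0 dW.
have BW : biholo W W' by split.
have hW' : (forall i, O (fun z => W' z ord0 i)) /\ W' 0 = 0 by [].
pose cut (P : pred 'I_n) z : V := \row_i (if P i then z ord0 i else 0).
pose gt z := u (Psi1 z) * g (Psi1 z); pose ht z := v (Psi2 z) * h (Psi2 z).
have Ogt : O gt by apply: (O_map (f := fun z => u z * g z) hQ1); exact: O_mul.
have Oht : O ht by apply: (O_map (f := fun z => v z * h z) hQ2); exact: O_mul.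
(* [gt] depends only on the image under [D1 = X *m E1] of the first chart, that is, on [X] applied
   to the first [k] new coordinates; [ht] is treated with [Y] and the remaining ones. *)
exists k, (fun z => W (Phi2 z)), (fun z => Psi2 (W' z)), u, v,
  (fun z => gt (cut (fun i => (i < k)%N) z *m X^T)), (fun z => ht (cut (fun i => (k <= i)%N) z *m Y^T)).
split; [exact: hk|split]; [exact: biholo_comp|exact: conj Ou u0|exact: conj Ov v0| |].
- split=> [z z' e|].
    by congr (gt (_ *m _)); apply/rowP => i; rewrite !mxE; case: ifP => // hi; exact: e.
  have hQ12 : near0 (fun z => Psi1 (Phi1 (Psi2 (W' z))) = Psi2 (W' z)).
    exact: near0_map hW' (near0_map hQ2 e12).
  have hp := near0_map hW' (near0_map hth (pd0_pr Ogt fl1')).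
  apply: near0_imp (near0_and e1 (near0_and hQ12 hp)) => z [a1 [a2 a3]].
  rewrite -a2 -/(gt _) -/(th _) -a3 -pr_offmx; congr gt.
  rewrite -tr_offmx hX trmx_mul mulmxA; congr (_ *m _).
  apply/rowP => i; rewrite [RHS]mxE -{2}a1 WE; case: (ltnP i k) => ik.
    rewrite [X in _ + X]big1 ?addr0 => [|l _]; last by rewrite z2 ?mulr0.
    by rewrite mxE; apply: eq_bigr => l _; rewrite mxE.
  by rewrite mxE big1 // => l _; rewrite mxE z1 ?mulr0.
- split=> [z z' e|].
    by congr (ht (_ *m _)); apply/rowP => i; rewrite !mxE; case: ifP => // hi; exact: e.
  have hp := near0_map hW' (pd0_pr Oht fl2').
  apply: near0_imp (near0_and e1 hp) => z [a1 a3].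
  rewrite -/(ht _) -a3 -pr_offmx; congr ht.
  rewrite -tr_offmx hY trmx_mul mulmxA; congr (_ *m _).
  apply/rowP => i; rewrite [RHS]mxE -{2}a1 WE; case: (leqP k i) => ik.
    rewrite [X in X + _]big1 ?add0r => [|l _]; last by rewrite z1 ?mulr0.
    by rewrite mxE; apply: eq_bigr => l _; rewrite mxE.
  by rewrite mxE big1 // => l _; rewrite mxE z2 ?mulr0.
Qed.
End GermSplit.

(** * Charts *)

Section LocalCharts.
Variables (R : realType) (n : nat).
Notation C := (Cplx R).
Notation V := 'rV[Cplx R]_n.
Implicit Types (z a : V).

Lemma nbhs_near0 a (Q : set V) : nbhs a Q <-> near0 (fun h => Q (a + h)).
Proof.
split=> [/nbhs_ballP[_ /= /pos_RC[e e0 ->] he]|[r [r0 hr]]].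
  exists (e / 2); split; first by rewrite divr_gt0.
  move=> h hh; apply: he; split=> [|i j]; first by rewrite RC_gt0.
  rewrite -ball_normE /= mxE opprD addrA subrr add0r normrN nmE RC_lt ord1.
  by apply: le_lt_trans (hh j) _; rewrite /cst; lra.
apply/nbhs_ballP; exists (RC r) => /=; first by rewrite RC_gt0.
move=> z [_ hz]; rewrite -(subrKC a z); apply: hr => i.
have := hz ord0 i; rewrite -ball_normE /= nmE RC_lt nm_sub => /ltW.
by rewrite !mxE.
Qed.

Lemma open_near0 (A : set V) : open A <-> forall a, A a -> near0 (fun h => A (a + h)).
Proof.
rewrite openE; split=> h a Aa; first by apply/nbhs_near0; exact: h.
by apply/nbhs_near0; exact: h.
Qed.

Lemma Oat_near0 a (F : V -> V) (P : V -> Prop) : (forall i, Oat (fun z => F z ord0 i) a) ->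
  near0 (fun h => P (F a + h)) -> near0 (fun h => P (F (a + h))).
Proof.
move=> OF h; have := @near0_comp _ _ (fun h => P (F a + h)) (fun h => F (a + h) - F a) _ _ h.
rewrite addr0 subrr => /(_ _ erefl) h'.
have {}h' : near0 (fun h => P (F a + (F (a + h) - F a))).
  apply: h' => i; apply: (@O_ext _ _ (fun h => F (a + h) ord0 i - F a ord0 i)).
    by apply: near0_all => z; rewrite !mxE.
  by apply: O_sub; [exact: OF|exact: O_const].
by apply: near0_imp h' => z; rewrite addrC subrK.
Qed.

Lemma Oat_comp f (F : V -> V) a : (forall i, Oat (fun z => F z ord0 i) a) -> Oat f (F a) ->
  Oat (fun z => f (F z)) a.
Proof.
move=> OF Of; apply: (@O_comp _ _ f (fun h => F (a + h))); first exact: OF.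
by rewrite addr0.
Qed.

Lemma Oat_ext f g a : near0 (fun h => f (a + h) = g (a + h)) -> Oat f a -> Oat g a.
Proof. exact: O_ext. Qed.

Variable T : topologicalType.
Implicit Types (c d : chart R n T) (q : T).

Lemma chart_open c q : is_chart c -> cdom c q -> near0 (fun h => (cmap c @` cdom c) (cmap c q + h)).
Proof. by move=> [_ /open_near0 h _ _ _] hq; apply: h; exists q. Qed.

Lemma chart_inv c z : is_chart c -> (cmap c @` cdom c) z -> cdom c (cinv c z) /\ cmap c (cinv c z) = z.
Proof. by move=> [_ _ h _ _] [q hq <-]; rewrite h. Qed.

Lemma chart_near c q (P : set T) : is_chart c -> cdom c q ->
  (\forall q' \near q, P q') <-> near0 (fun h => P (cinv c (cmap c q + h))).
Proof.
move=> hc hq; have [op1 op2 K c1 c2] := hc; split=> h.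
  move: c2; rewrite continuous_open_subspace // => c2; apply/(nbhs_near0 _ (fun z => P (cinv c z))).
  have qi : (cmap c @` cdom c) (cmap c q) by exists q.
  by apply: (c2 _ (mem_set qi) P); rewrite K.
move: c1; rewrite continuous_open_subspace // => c1.
have /c1 c3 := mem_set hq; have /c3 h1 := (nbhs_near0 (cmap c q) (fun z => P (cinv c z))).2 h.
have h2 : nbhs q (cdom c) by move: op1; rewrite openE => /(_ _ hq).
have {}h1 : nbhs q (fun q' => P (cinv c (cmap c q'))) := h1.
by apply: filterS2 h1 h2 => q' h1 h2; rewrite -(K q' h2).
Qed.

Lemma chart_nbhs c q : is_chart c -> cdom c q ->
  near0 (fun h => cdom c (cinv c (cmap c q + h)) /\ cmap c (cinv c (cmap c q + h)) = cmap c q + h).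
Proof. by move=> hc hq; apply: near0_imp (chart_open hc hq) => h; exact: chart_inv. Qed.

Definition opd (r : R) : set V := [set z | forall i, nm (z ord0 i) < r].
(* The chart c followed by the local biholomorphism Phi, restricted to the
   points of a polydisc of radius r around 0 sent by Phi into a polydisc of
   radius s. *)
Definition change_chart c (Phi Psi : V -> V) (r s : R) : chart R n T :=
  Chart (cdom c `&` [set q | opd r (cmap c q) /\ opd s (Phi (cmap c q))])
        (fun q => Phi (cmap c q)) (fun z => cinv c (Psi z)).

Lemma opd_open r : open (opd r).
Proof.
apply/open_near0 => a ha; have h : near0 (fun h : V => forall i, nm (h ord0 i) < r - nm (a ord0 i)).
  apply: near0_fin => i; exists ((r - nm (a ord0 i)) / 2); have := ha i => hai.
  by split=> [|z /(_ i)]; rewrite /cst; lra.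
apply: near0_imp h => h hh i; rewrite mxE; apply: le_lt_trans (nmD _ _) _.
by have := hh i; lra.
Qed.

Section Change.
Variables (c : chart R n T) (Phi Psi : V -> V) (r s : R).
Hypothesis hc : is_chart c.
Hypothesis hr : forall z, opd r z -> Psi (Phi z) = z /\ forall i, Oat (fun z => Phi z ord0 i) z.
Hypothesis hs : forall z, opd s z -> Phi (Psi z) = z /\ forall i, Oat (fun z => Psi z ord0 i) z.
Notation y := (change_chart c Phi Psi r s).

Lemma cdom_change q : cdom y q -> [/\ cdom c q, opd r (cmap c q), opd s (Phi (cmap c q)) &
  cinv y (cmap y q) = q].
Proof.
move=> [hq [h1 h2]]; split=> //=; have [-> _] := hr h1.
have [_ _ h _ _] := hc; exact: h.
Qed.

Lemma change_near q : cdom y q -> near0 (fun h => cdom y (cinv c (cmap c q + h))).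
Proof.
move=> /cdom_change[hq h1 h2 _]; have /open_near0 o1 := @opd_open r; have /open_near0 o2 := @opd_open s.
have k2 := Oat_near0 (hr h1).2 (o2 _ h2).
apply: near0_imp (near0_and (chart_nbhs hc hq) (near0_and (o1 _ h1) k2)) => h [[a1 a2] [a3 a4]].
by split=> //=; rewrite a2.
Qed.

Lemma change_near' q : cdom y q -> near0 (fun h => let z := cmap y q + h in
  [/\ opd s z, cdom y (cinv y z) & cmap y (cinv y z) = z]).
Proof.
move=> hyq; have [hq h1 h2 _] := cdom_change hyq; have /open_near0 o2 := @opd_open s.
have e : Psi (cmap y q) = cmap c q by have [] := hr h1.
have OP := (hs h2).2.
have k1 := change_near hyq; rewrite -e in k1; have k1' := Oat_near0 (P := fun z => cdom y (cinv c z)) OP k1.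
have k2 := chart_nbhs hc hq; rewrite -e in k2.
have k2' := Oat_near0 (P := fun z => cdom c (cinv c z) /\ cmap c (cinv c z) = z) OP k2.
apply: near0_imp (near0_and (o2 _ h2) (near0_and k1' k2')) => h [a1 [a2 [a3 a4]]].
by split=> //=; rewrite a4; have [] := hs a1.
Qed.

Lemma change_is_chart : is_chart y.
Proof.
have o1 : open (cdom y).
  rewrite openE => q hq; have [hq' _ _ _] := cdom_change hq.
  by apply/(chart_near _ hc hq'); exact: change_near.
have o2 : open (cmap y @` cdom y).
  apply/open_near0 => _ [q hq <-]; apply: near0_imp (change_near' hq) => h [_ a1 a2].
  by exists (cinv y (cmap y q + h)).
split=> //.
- by move=> q /cdom_change[].
- rewrite continuous_open_subspace // => q /set_mem hq B.
  have [hq' h1 h2 _] := cdom_change hq; move/nbhs_near0 => hB.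
  apply/(chart_near _ hc hq'); have k := Oat_near0 (hr h1).2 hB.
  by apply: near0_imp (near0_and k (chart_nbhs hc hq')) => h [a1 [a2 a3]] /=; rewrite a3.
- rewrite continuous_open_subspace // => _ /set_mem [q hq <-] B.
  have [hq' h1 h2 ->] := cdom_change hq; move/(chart_near _ hc hq') => hB.
  apply/nbhs_near0; have e : Psi (cmap y q) = cmap c q by have [] := hr h1.
  by rewrite -e in hB; exact: (Oat_near0 (P := fun z => B (cinv c z)) (hs h2).2 hB).
Qed.

Lemma change_compatible d : is_chart d -> compatible d c -> compatible d y.
Proof.
move=> [_ _ Kd _ _] [k1 k2]; have [_ _ Kc _ _] := hc.
split=> _ [q [hd hq] <-] i; apply/analyticP; have [hq' h1 h2 _] := cdom_change hq.
  apply: (@Oat_comp (fun z => Phi z ord0 i) (fun z => cmap c (cinv d z))).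
    by move=> j; apply/analyticP; apply: (k1 (cmap d q) _ j); exists q.
  by rewrite Kd //; exact: (hr h1).2.
have e : Psi (cmap y q) = cmap c q by have [] := hr h1.
apply: (@Oat_comp (fun z => cmap d (cinv c z) ord0 i) Psi); first exact: (hs h2).2.
by rewrite e; apply/analyticP; apply: (k2 (cmap c q) _ i); exists q.
Qed.
End Change.
End LocalCharts.

(** * Germs on a manifold *)

Section GermLeibniz.
Variables (R : realType) (n : nat).
Notation C := (Cplx R).
Notation V := 'rV[Cplx R]_n.
Implicit Types (z : V) (f g h u : V -> C) (J : {set 'I_n}).

(** The inclusion of [g J_h] in [J_gh], tested on generators. Together with [leib h g] and the
    product rule it amounts to the Jacobian equality. *)
Definition leib g h := forall k, exists a : 'I_n -> V -> C, (forall i, O (a i)) /\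
  near0 (fun z => g z * pd k h z = \sum_i a i z * pd i (fun z => g z * h z) z).

Lemma leib_near g h g' h' : O g -> O h -> near0 (fun z => g z = g' z) -> near0 (fun z => h z = h' z) ->
  leib g h -> leib g' h'.
Proof.
move=> Og Oh eg eh hl k; have [a [Oa ha]] := hl k; exists a; split; first exact: Oa.
have egh : near0 (fun z => g z * h z = g' z * h' z).
  by apply: near0_imp (near0_and eg eh) => z [-> ->].
have h1 := near0_fin (fun i => pd_near i (O_mul Og Oh) egh).
apply: near0_imp (near0_and ha (near0_and eg (near0_and (pd_near k Oh eh) h1))).
move=> z [a1 [a2 [a3 a4]]]; rewrite -a2 -a3 a1.
by apply: eq_bigr => i _; rewrite a4.
Qed.

(** In the split coordinates [d_j (g h) = g d_j h] for [j] in [J], as [g] does not involve these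
    variables, and only such [j] contribute to [d_k h] by the chain rule. Expressing the [d_j (g h)]
    through the original coordinates gives the multipliers. *)
Lemma leib_split g h (th eta : V -> V) J : O g -> O h -> biholo th eta ->
  (forall j, j \in J -> near0 (fun z => pd j (fun z => g (eta z)) z = 0)) ->
  (forall j, j \notin J -> near0 (fun z => pd j (fun z => h (eta z)) z = 0)) -> leib g h.
Proof.
move=> Og Oh [hth het e1 e2] hg hh k.
have [G eG] : exists G, G = (fun z => g (eta z)) by eexists.
have [H eH] : exists H, H = (fun z => h (eta z)) by eexists.
have OG : O G by rewrite eG; exact: O_map het Og.
have OH : O H by rewrite eH; exact: O_map het Oh.
have eGH : (fun z => g (eta z) * h (eta z)) = (fun z => G z * H z) by rewrite eG eH.
rewrite -eG in hg; rewrite -eH in hh.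
have Ogh := O_mul Og Oh.
exists (fun i z => \sum_(j in J) pd j (fun z => eta z ord0 i) (th z) * pd k (fun z => th z ord0 j) z).
split.
  move=> i; have Oj j : O (fun z => (if j \in J then 1 else 0) *
      (pd j (fun z => eta z ord0 i) (th z) * pd k (fun z => th z ord0 j) z)).
    apply: O_mul; first exact: O_const.
    apply: O_mul; last by apply: O_pd; exact: hth.1.
    by apply: (O_map hth); apply: O_pd; exact: het.1.
  have OS := O_sum (index_enum 'I_n) Oj; apply: O_ext OS; apply: near0_all => z.
  rewrite [RHS]big_mkcond; apply: eq_bigr => j _; case: (j \in J); first exact: mul1r.
  exact: mul0r.
have nH : near0 (fun z => H (th z) = h z) by apply: near0_imp e2 => z; rewrite eH => ->.
have hH : near0 (fun z => forall j, j \notin J -> pd j H (th z) = 0).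
  apply: near0_fin => j; case: (boolP (j \in J)) => [_|jJ]; first exact: near0_all.
  by apply: near0_imp (near0_map hth (hh j jJ)).
have hG : near0 (fun z => forall j, j \in J -> pd j G (th z) = 0).
  apply: near0_fin => j; case: (boolP (j \in J)) => [jJ|_]; last exact: near0_all.
  by apply: near0_imp (near0_map hth (hg j jJ)).
have k1 := pd_near k (O_map hth OH) nH.
have k2 := pd_comp k OH hth.1 hth.2.
have k3 := near0_map hth (near0_fin (fun j => pd_mul j OG OH)).
have k4 := near0_map hth (near0_fin (fun j => pd_comp j Ogh het.1 het.2)).
rewrite eGH in k4.
apply: near0_imp (near0_and k1 (near0_and k2 (near0_and k3 (near0_and k4
  (near0_and hH (near0_and hG e2)))))) => z [a1 [a2 [a3 [a4 [a5 [a6 a7]]]]]].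
have b1 : pd k h z = \sum_(j in J) pd j H (th z) * pd k (fun z => th z ord0 j) z.
  rewrite -a1 a2 [RHS]big_mkcond; apply: eq_bigr => j _.
  by case: (boolP (j \in J)) => // jJ; rewrite (a5 j jJ) mul0r.
have b2 j : j \in J -> g z * pd j H (th z) =
    \sum_i pd i (fun z => g z * h z) z * pd j (fun z => eta z ord0 i) (th z).
  move=> jJ; have c1 := a3 j; have c2 := a4 j; rewrite (a6 j jJ) mul0r addr0 in c1.
  have gG : G (th z) = g z by rewrite eG a7.
  rewrite gG in c1; rewrite a7 in c2.
  exact: etrans (esym c1) c2.
rewrite b1 mulr_sumr.
under [RHS]eq_bigr => i _ do rewrite mulr_suml.
rewrite [RHS]exchange_big; apply: eq_bigr => j jJ.
rewrite mulrA (b2 j jJ) mulr_suml; apply: eq_bigr => i _.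
by rewrite -[LHS]mulrA [LHS]mulrC.
Qed.

Lemma gred_unit u f : O u -> u 0 != 0 -> gred f -> gred (fun z => u z * f z).
Proof.
move=> Ou u0 hf a Oa ha; apply: hf => //.
apply: gdvd_ext _ _ (gdvd_mulr (O_inv Ou u0) ha); first exact: near0_all.
by apply: near0_imp (O_neq0 Ou u0) => z uz; rewrite mulrC mulKf.
Qed.

Lemma gcop_unit u v f g : O u -> u 0 != 0 -> O v -> v 0 != 0 -> gcop f g ->
  gcop (fun z => u z * f z) (fun z => v z * g z).
Proof.
move=> Ou u0 Ov v0 hf a Oa ha hb; apply: hf => //.
  apply: gdvd_ext _ _ (gdvd_mulr (O_inv Ou u0) ha); first exact: near0_all.
  by apply: near0_imp (O_neq0 Ou u0) => z uz; rewrite mulrC mulKf.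
apply: gdvd_ext _ _ (gdvd_mulr (O_inv Ov v0) hb); first exact: near0_all.
by apply: near0_imp (O_neq0 Ov v0) => z uz; rewrite mulrC mulKf.
Qed.
End GermLeibniz.

(** * Germs on the manifold read in a coordinate system at the point *)

Section Transfer.
Variables (R : realType) (n : nat) (S : complexManifold R n) (p : S).
Notation C := (Cplx R).
Notation V := 'rV[Cplx R]_n.
Implicit Types (f g h u v : S -> C) (c : chart R n S).

Lemma atlas_chart c : atlas c -> is_chart c.
Proof. by move: c; case: (S) => T A h1 h2 h3 h4 c; exact: h2. Qed.
Lemma atlas_cover (q : S) : exists2 c : chart R n S, atlas c & cdom c q.
Proof. by move: q; case: (S) => T A h1 h2 h3 h4 q; exact: h3. Qed.

Variable x : chart R n S.
Hypothesis hx : coordinates_at p x.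
Definition lc f (z : V) : C := f (cinv x z).

Let xc : is_chart x. Proof. by case: hx. Qed.
Let xp : cdom x p. Proof. by case: hx. Qed.
Let x0 : cmap x p = 0. Proof. by case: hx. Qed.

Lemma near_p (P : S -> Prop) : (\forall q \near p, P q) <-> near0 (fun z => P (cinv x z)).
Proof.
apply: iff_trans (chart_near P xc xp) _.
by split; apply: near0_imp => z; rewrite x0 add0r.
Qed.

Lemma near_xK : near0 (fun z : V => cdom x (cinv x z) /\ cmap x (cinv x z) = z).
Proof. by apply: near0_imp (chart_nbhs xc xp) => z; rewrite x0 add0r. Qed.

Lemma lc_map (f : V -> C) : near0 (fun z => lc (fun q => f (cmap x q)) z = f z).
Proof. by apply: near0_imp near_xK => z [_]; rewrite /lc => ->. Qed.

Lemma cinv_x0 : cinv x 0 = p.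
Proof. by have [_ _ h _ _] := xc; rewrite -x0 h. Qed.

Lemma lc0 f : lc f 0 = f p.
Proof. by rewrite /lc cinv_x0. Qed.

Lemma hol_lc f : holomorphic_at p f <-> O (lc f).
Proof.
have [_ hcx _ _] := hx; split=> [[c [ca cp /analyticP hf]]|hf].
  have [k1 k2] := hcx c ca; have [_ _ Kc _ _] := atlas_chart ca.
  have xi : (cmap x @` (cdom c `&` cdom x)) 0 by exists p.
  have OF : forall j, O (fun z => cmap c (cinv x z) ord0 j).
    by move=> j; apply/Oat0/analyticP; exact: k2.
  have h := @O_comp _ _ (f \o cinv c) (fun z => cmap c (cinv x z)) OF.
  apply: (O_ext _ (h _)); last by rewrite /= cinv_x0.
  have : \forall q \near p, cdom c q by apply: open_nbhs_nbhs; split=> //; have [] := atlas_chart ca.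
  by move/near_p; apply: near0_imp => z hz /=; rewrite Kc.
have [c ca cp] := atlas_cover p; exists c; split=> //; apply/analyticP.
have hc := atlas_chart ca; have [k1 k2] := hcx c ca; have [_ _ Kc _ _] := hc.
have [_ _ Kx _ _] := xc.
have ci : (cmap c @` (cdom c `&` cdom x)) (cmap c p) by exists p.
apply: (@Oat_ext _ _ (fun z => lc f (cmap x (cinv c z)))).
  have : \forall q \near p, cdom x q by apply: open_nbhs_nbhs; split=> //; have [] := xc.
  by move/(chart_near _ hc cp); apply: near0_imp => z hz; rewrite /lc Kx.
apply: (@Oat_comp _ _ (lc f) (fun z => cmap x (cinv c z))).
  by move=> i; apply/analyticP; exact: k1.
by rewrite Kc // x0; apply/Oat0.
Qed.

Lemma hol_map (f : V -> C) : O f -> holomorphic_at p (fun q => f (cmap x q)).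
Proof. by move=> Of; apply/hol_lc; apply: O_ext Of; apply: near0_imp (lc_map f) => z ->. Qed.

Lemma dvd_lc a f : germ_dvd p a f <-> gdvd (lc a) (lc f).
Proof.
split=> [[b /hol_lc Ob /near_p hb]|[b [Ob hb]]]; first by exists (lc b).
exists (fun q => b (cmap x q)); first exact: hol_map.
by apply/near_p; apply: near0_imp (near0_and hb near_xK) => z [h1 [_ h2]] /=; rewrite h2.
Qed.

Lemma unit_lc f : germ_unit p f <-> O (lc f) /\ f p != 0.
Proof.
split=> [[/hol_lc Of [v /hol_lc Ov /near_p hv]]|[Of f0]].
  split=> //; have := near0_0 hv; rewrite cinv_x0 /=.
  by apply: contra_eq_neq => ->; rewrite mul0r eq_sym oner_eq0.
split; first exact/hol_lc.
have f0' : lc f 0 != 0 by rewrite lc0.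
exists (fun q => (lc f (cmap x q))^-1); first by apply: hol_map (O_inv Of f0').
apply/near_p; apply: near0_imp (near0_and near_xK (O_neq0 Of f0')) => z [[_ h1] h2] /=.
by rewrite h1 mulfV.
Qed.

Lemma red_lc f : germ_reduced p f <-> gred (lc f).
Proof.
split=> h a Oa ha.
  have /unit_lc[_] : germ_unit p (fun q => a (cmap x q)).
    apply: h; first exact: hol_map.
    apply/dvd_lc; apply: gdvd_ext _ _ ha; last exact: near0_all.
    by apply: near0_imp (lc_map a) => z e; rewrite -e.
  by rewrite x0.
apply/unit_lc; move/hol_lc: Oa => Oa; split=> //; rewrite -lc0; apply: h => //.
exact: (dvd_lc (a \* a) f).1 ha.
Qed.

Lemma cop_lc f g : no_common_factor p f g -> gcop (lc f) (lc g).
Proof.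
move=> h a Oa ha hb; have /unit_lc[_] : germ_unit p (fun q => a (cmap x q)).
  have e : near0 (fun z => a z = lc (fun q => a (cmap x q)) z).
    by apply: near0_imp (lc_map a) => z ->.
  apply: h; first exact: hol_map.
    by apply/dvd_lc; apply: gdvd_ext _ _ ha => //; exact: near0_all.
  by apply/dvd_lc; apply: gdvd_ext _ _ hb => //; exact: near0_all.
by rewrite x0.
Qed.

Lemma pd_lc i f : near0 (fun z => partial_derivative x i f (cinv x z) = pd i (lc f) z).
Proof. by apply: near0_imp near_xK => z [_ h]; rewrite /partial_derivative h. Qed.

Lemma jac_lc f u : jacobian_ideal p x f u <-> exists a : 'I_n -> V -> C, (forall i, O (a i)) /\
  near0 (fun z => lc u z = \sum_i a i z * pd i (lc f) z).
Proof.
have hp := near0_fin (fun i => pd_lc i f).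
split=> [[a ha /near_p hu]|[a [Oa hu]]].
  exists (fun i => lc (a i)); split=> [i|]; first exact/hol_lc.
  apply: near0_imp (near0_and hu hp) => z [h1 h2]; rewrite /lc h1.
  by apply: eq_bigr => i _; rewrite h2.
exists (fun i q => a i (cmap x q)); first by move=> i; exact: hol_map.
apply/near_p; apply: near0_imp (near0_and hu (near0_and hp near_xK)) => z [h1 [h2 [_ h3]]].
by rewrite -/(lc u z) h1 h3; apply: eq_bigr => i _; rewrite h2.
Qed.

Lemma germ_eq_eq f g : f = g -> germ_eq p f g.
Proof. by move=> ->; apply/near_p; exact: near0_all. Qed.

(** The germ [g d_k h + h 0] belongs to the right-hand ideal, hence to [J_gh]. *)
Lemma leib_lc g h : jacobian_leibniz p x g h -> leib (lc g) (lc h).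
Proof.
move=> e k; have hk := pd_lc k h.
have hI : jacobian_ideal p x (g \* h) (g \* partial_derivative x k h).
  rewrite [jacobian_ideal _ _ _]e; exists (g \* partial_derivative x k h), (fun=> 0); split.
  - exists (partial_derivative x k h); last exact: germ_eq_eq.
    apply/jac_lc; exists (fun i _ => (i == k)%:R); split; first by move=> i; exact: O_const.
    apply: near0_imp hk => z e1; apply: etrans e1 _.
    rewrite -[LHS](@sum_pick _ _ (fun i => pd i (lc h) z) (fun i => (i == k)%:R)) //.
    by apply: eq_bigr => i _; rewrite mulrC.
  - exists (fun=> 0); last by apply: germ_eq_eq; apply/funext => q /=; rewrite mulr0.
    apply/jac_lc; exists (fun _ _ => 0); split; first by move=> i; exact: O_const.
    by apply: near0_all => z; rewrite big1 // => i _; rewrite mul0r.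
  - by apply: germ_eq_eq; apply/funext => q /=; rewrite addr0.
have [a [Oa ha]] := (jac_lc _ _).1 hI; exists a; split; first exact: Oa.
by apply: near0_imp (near0_and ha hk) => z [h1 h2]; rewrite -h1 /lc /= -h2.
Qed.

(** One inclusion is the product rule applied to a combination of derivatives of [g h]; the other
    expands both summands through the generators. *)
Lemma lc_leib g h : O (lc g) -> O (lc h) -> leib (lc g) (lc h) -> leib (lc h) (lc g) ->
  jacobian_leibniz p x g h.
Proof.
move=> Og Oh l1 l2; apply/seteqP; split=> u.
  move=> /jac_lc[a [Oa ha]].
  pose v f q := dv a (lc f) (cmap x q).
  have hv f : jacobian_ideal p x f (v f).
    apply/jac_lc; exists a; split; first exact: Oa.
    by apply: near0_imp near_xK => z [_ h1]; rewrite /lc /v h1.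
  exists (g \* v h), (h \* v g); split.
  - by exists (v h); [exact: hv|exact: germ_eq_eq].
  - by exists (v g); [exact: hv|exact: germ_eq_eq].
  - apply/near_p; apply: near0_imp (near0_and ha (near0_and (dv_mul a Og Oh) near_xK)) => z [h1 [h2 [_ h3]]].
    rewrite /= /v h3 -/(lc u z) h1 -/(lc g z) -/(lc h z) [lc h z * _]mulrC; exact: h2.
move=> [v [w [[v' /jac_lc[a [Oa ha]] /near_p ev] [w' /jac_lc[b [Ob hb]] /near_p ew] /near_p eu]]].
have [c hc] := choice l1; have [d hd] := choice l2.
apply/jac_lc; exists (fun i z => \sum_k (a k z * c k i z + b k z * d k i z)); split.
  move=> i; apply: O_sum => k; apply: O_add; apply: O_mul; try exact: Oa; try exact: Ob.
    exact: (hc k).1.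
  exact: (hd k).1.
have k1 := near0_fin (fun k => (hc k).2); have k2 := near0_fin (fun k => (hd k).2).
apply: near0_imp (near0_and ha (near0_and hb (near0_and ev (near0_and ew (near0_and eu (near0_and k1 k2)))))).
move=> z [a1 [a2 [a3 [a4 [a5 [a6 a7]]]]]].
rewrite {1}/lc a5 /= a3 a4 /= -/(lc g z) -/(lc h z) -/(lc v' z) -/(lc w' z) a1 a2 !mulr_sumr -big_split /=.
under [RHS]eq_bigr => i _ do rewrite mulr_suml.
rewrite [RHS]exchange_big /=; apply: eq_bigr => k _.
have e : lc h \* lc g = lc g \* lc h by apply/funext => y /=; rewrite mulrC.
have a7k := a7 k; rewrite (_ : (fun z => lc h z * lc g z) = lc g \* lc h) in a7k; last exact: e.
rewrite mulrCA (a6 k) [lc h z * _]mulrCA a7k !mulr_sumr -big_split /=; apply: eq_bigr => i _.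
by rewrite mulrDl !mulrA.
Qed.

(** The unit factors are carried along so that the first claim and one direction of the equivalence
    are both instances: they change neither the zero sets nor reducedness nor coprimality. *)
Lemma splayed_leib g h (u v : V -> C) (D : set S) : O (lc g) -> O (lc h) -> gred (lc g) -> gred (lc h) ->
  gcop (lc g) (lc h) -> g p = 0 -> h p = 0 -> O u -> u 0 != 0 -> O v -> v 0 != 0 ->
  leib (fun z => u z * lc g z) (fun z => v z * lc h z) ->
  (\forall q \near p, D q <-> g q * h q = 0) ->
  splayed p D [set q | g q = 0] [set q | h q = 0].
Proof.
move=> Og Oh rg rh cop g0 h0 Ou u0 Ov v0 hl hD.
have [||k [Phi [Psi [u1 [v1 [G [H [hk [B [Ou1 u10] [Ov1 v10] [dG eG] [dH eH]]]]]]]]]] :=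
  germ_split (O_mul Ou Og) (O_mul Ov Oh) (gred_unit Ou u0 rg) (gred_unit Ov v0 rh)
    (gcop_unit Ou u0 Ov v0 cop) _ _ hl; try by rewrite lc0 ?g0 ?h0 mulr0.
have [hP hQ e1 e2] := B.
have [r [r0 hr]] : near0 (fun z => Psi (Phi z) = z /\ forall i, Oat (fun z => Phi z ord0 i) z).
  by apply: near0_and e2 _; apply: near0_fin => i; apply: O_Oat; exact: hP.1.
have [s [s0 hs]] : near0 (fun z => Phi (Psi z) = z /\ forall i, Oat (fun z => Psi z ord0 i) z).
  by apply: near0_and e1 _; apply: near0_fin => i; apply: O_Oat; exact: hQ.1.
have hr' z : opd r z -> Psi (Phi z) = z /\ forall i, Oat (fun z => Phi z ord0 i) z.
  by move=> hz; apply: hr => i; exact: ltW (hz i).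
have hs' z : opd s z -> Phi (Psi z) = z /\ forall i, Oat (fun z => Psi z ord0 i) z.
  by move=> hz; apply: hs => i; exact: ltW (hz i).
pose y := change_chart x Phi Psi r s.
have yc : coordinates_at p y.
  split; [exact: change_is_chart| | |].
  - by move=> c ca; apply: (change_compatible xc hr' hs' (atlas_chart ca)); have [_ hcx _ _] := hx; exact: hcx.
  - by split=> //=; rewrite x0 hP.2; split=> i; rewrite mxE nm0.
  - by rewrite /= x0 hP.2.
pose h1 q := G (cmap y q); pose h2 q := H (cmap y q).
have E1 : near0 (fun z => lc h1 z = u1 z * (u z * lc g z)).
  apply: near0_imp (near0_and near_xK (near0_and e2 (near0_map hP eG))) => z [[_ a1] [a2 a3]].
  by rewrite /lc /h1 /= a1 -a3 a2.
have E2 : near0 (fun z => lc h2 z = v1 z * (v z * lc h z)).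
  apply: near0_imp (near0_and near_xK (near0_and e2 (near0_map hP eH))) => z [[_ a1] [a2 a3]].
  by rewrite /lc /h2 /= a1 -a3 a2.
have gred_near (f f' : V -> C) : near0 (fun z => f z = f' z) -> gred f' -> gred f.
  move=> e hf a Oa ha; apply: hf => //; apply: gdvd_ext _ e ha; exact: near0_all.
have O1 : O (lc h1).
  apply: (O_ext (f := fun z => u1 z * (u z * lc g z))).
    by apply: near0_imp E1 => z ->.
  by apply: O_mul => //; exact: O_mul.
have O2 : O (lc h2).
  apply: (O_ext (f := fun z => v1 z * (v z * lc h z))).
    by apply: near0_imp E2 => z ->.
  by apply: O_mul => //; exact: O_mul.
have R1 : gred (lc h1) by apply: gred_near E1 _; do 2!apply: gred_unit => //.
have R2 : gred (lc h2) by apply: gred_near E2 _; do 2!apply: gred_unit => //.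
have Z1 : near0 (fun z => lc g z = 0 <-> lc h1 z = 0).
  apply: near0_imp (near0_and E1 (near0_and (O_neq0 Ou u0) (O_neq0 Ou1 u10))) => z [-> [a1 a2]].
  split=> [->|/eqP]; first by rewrite !mulr0.
  by rewrite !mulf_eq0 (negbTE a1) (negbTE a2) => /eqP.
have Z2 : near0 (fun z => lc h z = 0 <-> lc h2 z = 0).
  apply: near0_imp (near0_and E2 (near0_and (O_neq0 Ov v0) (O_neq0 Ov1 v10))) => z [-> [a1 a2]].
  split=> [->|/eqP]; first by rewrite !mulr0.
  by rewrite !mulf_eq0 (negbTE a1) (negbTE a2) => /eqP.
have D12 : near0 (fun z => D (cinv x z) <-> lc g z = 0 \/ lc h z = 0).
  move/near_p: hD; apply: near0_imp => z ->; rewrite /lc.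
  by split=> [/eqP|[->|->]]; rewrite ?mul0r ?mulr0 // mulf_eq0 => /orP[] /eqP; tauto.
split; first exact/near_p.
exists y, k, h1, h2; split=> //.
- by case/andP: hk => k1 k2; rewrite k1 -ltnS prednK // (leq_ltn_trans _ k2).
- split; (exists (setT, setT); first by split; exact: filterT); move=> [q q'] _ /= e.
    exact: dG.
  exact: dH.
- split; split; try (by apply/hol_lc); try (by apply/red_lc); by apply/near_p.
- split; first by apply/hol_lc; exact: (O_mul O1 O2).
    apply/red_lc; apply: (gred_mul O1 O2 R1 R2).
    have c1 := gcop_unit Ou1 u10 Ov1 v10 (gcop_unit Ou u0 Ov v0 cop).
    move=> a Oa ha hb; apply: c1 => //.
      by apply: gdvd_ext _ E1 ha; exact: near0_all.
    by apply: gdvd_ext _ E2 hb; exact: near0_all.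
  apply/near_p; apply: near0_imp (near0_and D12 (near0_and Z1 Z2)) => z [a1 [a2 a3]].
  apply: (iff_trans a1); rewrite a2 a3 -/(lc h1 z) /= -/(lc h1 z) -/(lc h2 z).
  by split=> [[->|->]|/eqP]; rewrite ?mul0r ?mulr0 // mulf_eq0 => /orP[] /eqP; tauto.
Qed.

End Transfer.

(** * Two coordinate systems at one point and functions of separate variables *)

Section TwoCharts.
Variables (R : realType) (n : nat) (S : complexManifold R n) (p : S).
Notation C := (Cplx R).
Notation V := 'rV[Cplx R]_n.
Implicit Types (f g h : S -> C) (x y : chart R n S).

Lemma O_transition x y : coordinates_at p x -> coordinates_at p y ->
  (forall i, O (fun z => cmap y (cinv x z) ord0 i)) /\ cmap y (cinv x 0) = 0.
Proof.
move=> hx hy; split=> [i|]; last by rewrite (cinv_x0 hx); case: hy.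
apply: (hol_lc hx (fun q => cmap y q ord0 i)).1; apply/(hol_lc hy).
apply: (O_ext (f := fun z => z ord0 i)); last exact: O_var.
by apply: near0_imp (near_xK hy) => z [_]; rewrite /lc => ->.
Qed.

Lemma transition_biholo x y : coordinates_at p x -> coordinates_at p y ->
  biholo (fun z => cmap y (cinv x z)) (fun z => cmap x (cinv y z)).
Proof.
have aux x1 y1 : coordinates_at p x1 -> coordinates_at p y1 ->
    near0 (fun z => cmap y1 (cinv x1 (cmap x1 (cinv y1 z))) = z).
  move=> hx hy; have h1 := near_xK hy; have [[_ _ K _ _] _ _ _] := hx.
  have : \forall q \near p, cdom x1 q.
    by apply: open_nbhs_nbhs; split; case: hx => // -[].
  move/(near_p hy) => h2; apply: near0_imp (near0_and h1 h2) => z [[_ a1] a2].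
  by rewrite K.
by move=> hx hy; split; [exact: O_transition|exact: O_transition|exact: aux|exact: aux].
Qed.

(** Comparing a point with the one whose coordinates outside [P] are set to 0 shows that [f] is
    invariant under that projection, whence its derivatives in these directions vanish. *)
Lemma depends_pd x y (P : pred 'I_n) f : coordinates_at p x -> coordinates_at p y ->
  holomorphic_at p f -> depends_only_on p y P f ->
  forall j, ~~ P j -> near0 (fun z => pd j (fun z => lc x f (cmap x (cinv y z))) z = 0).
Proof.
move=> hx hy /(hol_lc hy) Of [[A B] /= [/(near_p hy) hA /(near_p hy) hB] hAB] j jP.
pose J : {set 'I_n} := [set i | ~~ P i]%SET.
have hp : (forall i, O (fun z : V => pr J z ord0 i)) /\ pr J 0 = 0 :> V by split; [exact: O_pr|exact: pr0].
have e : near0 (fun z => lc y f (pr J z) = lc y f z).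
  have yK := near_xK hy.
  apply: near0_imp (near0_and hB (near0_and yK (near0_and (near0_map hp hA) (near0_map hp yK)))).
  move=> z [a1 [[_ a2] [a3 [_ a4]]]]; apply: (hAB (_, _)) => //= i Pi.
  by rewrite a2 a4 mxE !inE Pi.
have h1 : near0 (fun z => pd j (lc y f) z = 0) by apply: (off_pd Of e); rewrite !inE.
have h2 : near0 (fun z => lc y f z = lc x f (cmap x (cinv y z))).
  have [[_ _ K _ _] _ _ _] := hx.
  have : \forall q \near p, cdom x q by apply: open_nbhs_nbhs; split; case: hx => // -[].
  by move/(near_p hy); apply: near0_imp => z hz; rewrite /lc K.
by apply: near0_imp (near0_and h1 (pd_near j Of h2)) => z [a1 a2]; rewrite -a2.
Qed.

Lemma separate_leib x y k g h : coordinates_at p x -> coordinates_at p y ->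
  holomorphic_at p g -> holomorphic_at p h -> separate_variables p y k g h ->
  leib (lc x g) (lc x h) /\ leib (lc x h) (lc x g).
Proof.
move=> hx hy hg hh [sg sh]; have B := transition_biholo hx hy.
have Og := (hol_lc hx g).1 hg; have Oh := (hol_lc hx h).1 hh.
have dg := depends_pd hx hy hg sg; have dh := depends_pd hx hy hh sh.
split.
  apply: (leib_split (J := [set i : 'I_n | (k <= i)%N]%SET) Og Oh B) => j.
    by rewrite inE leqNgt; exact: dg.
  by rewrite inE; exact: dh.
apply: (leib_split (J := [set i : 'I_n | (i < k)%N]%SET) Oh Og B) => j.
  by rewrite inE ltnNge; exact: dh.
by rewrite inE; exact: dg.
Qed.

End TwoCharts.

Theorem proposition3p3 (R : realType) (n : nat) (S : complexManifold R n)
    (D : set S) (p : S) (g h : S -> Cplx R) (x : chart R n S)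
    (D_divisor : is_divisor D)
    (x_coord : coordinates_at p x)
    (g_hol : holomorphic_at p g) (h_hol : holomorphic_at p h)
    (g_red : germ_reduced p g) (h_red : germ_reduced p h)
    (g_nonunit : ~ germ_unit p g) (h_nonunit : ~ germ_unit p h)
    (gh_coprime : no_common_factor p g h)
    (D_eq : \forall q \near p, D q <-> g q * h q = 0) :
  let D1 := [set q | g q = 0] in
  let D2 := [set q | h q = 0] in
  [/\ jacobian_leibniz p x g h -> splayed p D D1 D2,
      splayed p D D1 D2 ->
        (exists (y : chart R n S) (k : nat),
           [/\ coordinates_at p y, (1 <= k <= n.-1)%N & separate_variables p y k g h]) ->
        jacobian_leibniz p x g h
    & splayed p D D1 D2 <->
      exists u v : S -> Cplx R,
        [/\ germ_unit p u, germ_unit p v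
          & jacobian_leibniz p x (u \* g) (v \* h)]].
Proof.
move=> D1 D2.
have Og := (hol_lc x_coord g).1 g_hol; have Oh := (hol_lc x_coord h).1 h_hol.
have rg := (red_lc x_coord g).1 g_red; have rh := (red_lc x_coord h).1 h_red.
have cop := cop_lc x_coord gh_coprime.
have nonunit f : O (lc x f) -> ~ germ_unit p f -> f p = 0.
  by move=> Of hf; apply/eqP/negPn/negP => f0; apply: hf; apply/(unit_lc x_coord).
have g0 := nonunit g Og g_nonunit; have h0 := nonunit h Oh h_nonunit.
split.
- move=> /(leib_lc x_coord) hl.
  (* The first claim is the case where both units are 1. *)
  have O1 : O ((fun=> 1) : 'rV[Cplx R]_n -> Cplx R) := O_const _ 1.
  apply: (splayed_leib x_coord Og Oh rg rh cop g0 h0 O1 (oner_neq0 _) O1 (oner_neq0 _) _ D_eq).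
  by apply: leib_near hl => //; apply: near0_all => z; rewrite mul1r.
- move=> _ [y [k [hy _ hs]]].
  have [l1 l2] := separate_leib x_coord hy g_hol h_hol hs.
  exact: lc_leib.
split=> [|[u [v [/(unit_lc x_coord)[Ou u0] /(unit_lc x_coord)[Ov v0] /(leib_lc x_coord) hl]]]]; last first.
  rewrite -(lc0 x_coord u) in u0; rewrite -(lc0 x_coord v) in v0.
  exact: (splayed_leib x_coord Og Oh rg rh cop g0 h0 Ou u0 Ov v0 hl D_eq).
move=> [_ [y [k [h1 [h2 [hy _ hs [[H1 r1 z1] [H2 r2 z2]] _]]]]]].
have [l1 l2] := separate_leib x_coord hy H1 H2 hs.
have O1 := (hol_lc x_coord h1).1 H1; have O2 := (hol_lc x_coord h2).1 H2.
(* [g] and [h1] are reduced equations of the same hypersurface, so [h1] is a unit multiple of [g],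
   and likewise [h2] of [h]. The Jacobian equality is proved for these multiples, which have
   separated variables. *)
have [u [Ou u0 eu]] := gred_assoc Og O1 rg ((red_lc x_coord h1).1 r1) ((near_p x_coord _).1 z1).
have [v [Ov v0 ev]] := gred_assoc Oh O2 rh ((red_lc x_coord h2).1 r2) ((near_p x_coord _).1 z2).
pose u' q := u (cmap x q); pose v' q := v (cmap x q).
have x0 : cmap x p = 0 by case: x_coord.
have eu' : near0 (fun z => lc x h1 z = lc x (u' \* g) z).
  by apply: near0_imp (near0_and eu (lc_map x_coord u)) => z [-> <-].
have ev' : near0 (fun z => lc x h2 z = lc x (v' \* h) z).
  by apply: near0_imp (near0_and ev (lc_map x_coord v)) => z [-> <-].
exists u', v'; split.
- by apply/(unit_lc x_coord); rewrite /u' x0; split=> //; apply/(hol_lc x_coord); exact: hol_map.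
- by apply/(unit_lc x_coord); rewrite /v' x0; split=> //; apply/(hol_lc x_coord); exact: hol_map.
- exact: (lc_leib x_coord (O_ext eu' O1) (O_ext ev' O2) (leib_near O1 O2 eu' ev' l1)
    (leib_near O2 O1 ev' eu' l2)).
Qed.
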